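(* Let $p_1\equiv p_2\equiv1\pmod4$ be primes, $k=\mathbb{Q}(\sqrt{2p_1p_2},i)$, $\mathbb{K}_1=k(\sqrt{p_1})$, $\varepsilon_2$ the fundamental unit of $\mathbb{Q}(\sqrt{2p_2})$ and $\varepsilon_3=x+y\sqrt{2p_1p_2}$ that of $\mathbb{Q}(\sqrt{2p_1p_2})$. (1) If $N(\varepsilon_2)=N(\varepsilon_3)=-1$, or if $N(\varepsilon_2)=1$ and $N(\varepsilon_3)=-1$, then $|\ker J_{\mathbb{K}_1}|=4$. (2) If $N(\varepsilon_3)=1$ and $N(\varepsilon_2)=-1$, then $|\ker J_{\mathbb{K}_1}|=8$ when $x+1$ or $x-1$ is a perfect square in $\mathbb{N}$, and $|\ker J_{\mathbb{K}_1}|=4$ otherwise.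
   Context: $i=\sqrt{-1}$; $x,y\in\mathbb{Z}$; $N$ is the norm to $\mathbb{Q}$. $J_{\mathbb{K}_1}:\mathbf{C}_k\to\mathbf{C}_{\mathbb{K}_1}$ is the homomorphism of ideal class groups induced by extension of ideals. *)

(* Defs.v *)
From HB Require Import structures.
From mathcomp Require Import all_boot all_order all_algebra all_field.
Set Implicit Arguments. Unset Strict Implicit. Unset Printing Implicit Defensive.
Import Order.TTheory GRing.Theory Num.Theory.
Local Open Scope ring_scope.

Inductive Qgen (s : seq algC) : algC -> Prop :=
  | Qgen_rat (q : rat) : Qgen s (ratr q)
  | Qgen_gen (a : algC) : a \in s -> Qgen s a
  | Qgen_add (a b : algC) : Qgen s a -> Qgen s b -> Qgen s (a + b)
  | Qgen_opp (a : algC) : Qgen s a -> Qgen s (- a)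
  | Qgen_mul (a b : algC) : Qgen s a -> Qgen s b -> Qgen s (a * b)
  | Qgen_inv (a : algC) : Qgen s a -> Qgen s (a^-1).

Definition ringO (s : seq algC) (x : algC) : Prop := Qgen s x /\ x \in Aint.

Definition is_ideal (s : seq algC) (I : algC -> Prop) : Prop :=
  [/\ forall x, I x -> ringO s x,
      I 0,
      forall x y, I x -> I y -> I (x + y),
      forall a x, ringO s a -> I x -> I (a * x)
    & exists x, I x /\ x != 0].

Inductive ext_ideal (sL : seq algC) (I : algC -> Prop) : algC -> Prop :=
  | ext_zero : ext_ideal sL I 0
  | ext_gen (a x : algC) : ringO sL a -> I x -> ext_ideal sL I (a * x)
  | ext_add (u v : algC) : ext_ideal sL I u -> ext_ideal sL I v ->
      ext_ideal sL I (u + v).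

Definition principal (s : seq algC) (J : algC -> Prop) : Prop :=
  exists g, ringO s g /\ forall z, J z <-> exists a, ringO s a /\ z = g * a.

Definition ideal_equiv (s : seq algC) (I J : algC -> Prop) : Prop :=
  exists al be, [/\ ringO s al, ringO s be, al != 0, be != 0 &
    forall z, (exists x, I x /\ z = al * x) <-> (exists y, J y /\ z = be * y)].

Definition capitulates (sk sL : seq algC) (I : algC -> Prop) : Prop :=
  principal sL (ext_ideal sL I).

(* |ker J_L| = n : there are exactly n ideal classes of k capitulating in L
   (every class contains an integral ideal). *)
Definition card_capitulation_kernel (sk sL : seq algC) (n : nat) : Prop :=
  exists Is : seq (algC -> Prop),
    [/\ size Is = n,
        forall i, (i < n)%N -> is_ideal sk (nth (fun _ => False) Is i) /\
          capitulates sk sL (nth (fun _ => False) Is i),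
        forall i j, (i < n)%N -> (j < n)%N -> i <> j ->
          ~ ideal_equiv sk (nth (fun _ => False) Is i) (nth (fun _ => False) Is j)
      & forall J, is_ideal sk J -> capitulates sk sL J ->
          exists2 i, (i < n)%N & ideal_equiv sk J (nth (fun _ => False) Is i)].

Definition fund_unit (m : nat) (eps : algC) : Prop :=
  [/\ ringO [:: sqrtC m%:R] eps, ringO [:: sqrtC m%:R] eps^-1, 1 < eps &
    forall eta, ringO [:: sqrtC m%:R] eta -> ringO [:: sqrtC m%:R] eta^-1 ->
      1 < eta -> eps <= eta].

Definition qnorm_is (m : nat) (eps : algC) (v : rat) : Prop :=
  exists a b : rat, eps = ratr a + ratr b * sqrtC m%:R /\ a ^+ 2 - m%:R * b ^+ 2 = v.

(* Main.v *)
(** Write L = K1 and let sigma generate Gal(L/k).  If I is an ideal of k with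
    I O_L = (g), then g / sigma(g) is a unit of L of relative norm 1; since L/k
    is unramified, Galois descent of ideals shows that this identifies the
    capitulation kernel with
      {units u of L with u sigma(u) = 1} / {v / sigma(v) : v a unit of L}.
    Let e1, e2, e3 be the fundamental units of Q(sqrt p1), Q(sqrt(2 p2)) and
    Q(sqrt(2 p1 p2)); e1 has norm -1 because p1 = 1 mod 4.  Norms to subfields
    show that the numerator consists of the i^a e1^b e2^c of relative norm 1, so
    it has eight classes modulo the e1/sigma(e1) and e2/sigma(e2).  For a unit v
    with v / sigma(v) = i^a e1^b e2^c one finds v conj(v) = e1^b e2^c e3^m, and
    the signs of the conjugates of this totally positive number leave at most
    one nontrivial class among the eight in the denominator.  That class is
    +-e1 e2 (norms -1, -1), +-e2 (norms 1, -1), or -1 (norms -1, 1), and in the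
    last case it occurs exactly when 2 e3 is not a square in Q(sqrt(2 p1 p2)),
    that is when neither x + 1 nor x - 1 is a perfect square. *)

Require Import Defs.
From HB Require Import structures.
From mathcomp Require Import all_boot all_order all_algebra all_field.
From mathcomp Require Import zify ring lra.
From Stdlib Require Import Classical.
Import Order.TTheory GRing.Theory Num.Theory.
Local Open Scope ring_scope.
Set Implicit Arguments.
Unset Strict Implicit.
Unset Printing Implicit Defensive.

(** * Pell's equation *)

(** Products of a unit of L with its conjugates lie in quadratic fields, whose units are known: plus
    or minus powers of the least unit above 1 in the real case, a few roots of unity in the
    imaginary case. What such products leave open is each time a square root in L, and three facts
    decide it. The number 2 is not a square in L, whereas 2i = (1 + i)^2, so i is not a square
    either. A unit eps of norm 1 satisfies (1 + eps)^2 = (trace + 2) eps, so it is a square up to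
    the squarefree part of trace + 2, and integrality confines that number to the divisors of the
    radicand. Finally every divisor of 2 p1 p2 is a square in L up to a factor 2, that is, up to a
    power of i. Only e2 and e3 are given; e1 and its norm -1 have to be produced, and for this
    Pell's equation is solved. Descent of ideals rests on an explicit identity writing a as a sum of
    c Tr(d a) with c and d integral. *)

Lemma dirichlet_approx (R : archiRealFieldType) (s : R) (N : nat) :
  0 <= s -> (0 < N)%N ->
  exists x y : int, [/\ 0 < y, y <= N%:Z & `|x%:~R - y%:~R * s| < N%:R^-1].
Proof.
move=> s0 N0; have N0' : 0 < N%:R :> R by rewrite ltr0n.
(* The residue of [f j] modulo N tells which of the N intervals of length 1/N contains the
   fractional part of j s. Two of the N + 1 multiples share an interval, and their difference is the
   approximation; the quotients of [f j] by N are the integer parts. *)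
pose f (j : 'I_N.+1) : int := Num.floor (N%:R * j%:R * s).
have [N' defN] : {N' | N = N'.+1} by exists N.-1; rewrite prednK.
pose g (j : 'I_N.+1) : 'I_N'.+1 := inord `|(f j %% N)%Z|%N.
have /injectivePn[j1 [j2 nj Eg]] : ~~ injectiveb g.
  apply/injectiveP => /leq_card; rewrite !card_ord defN; lia.
wlog lt12 : j1 j2 nj Eg / (j1 < j2)%N.
  move=> H; case: (ltngtP j1 j2) => [h|h|/val_inj h]; first exact: (H j1 j2).
    by apply: (H j2 j1); rewrite // eq_sym.
  by rewrite h eqxx in nj.
have {}Eg : (f j1 %% N)%Z = (f j2 %% N)%Z.
  have /(congr1 val) := Eg; rewrite /g /=.
  have Nz : (N%:Z != 0) by lia.
  have b j : (`|(f j %% N)%Z| < N'.+1)%N.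
    by have := ltz_pmod (f j) (d := N%:Z); have := modz_ge0 (f j) Nz; lia.
  rewrite !inordK ?b // => E.
  by have := modz_ge0 (f j1) Nz; have := modz_ge0 (f j2) Nz; lia.
have d1 := divz_eq (f j1) N; have d2 := divz_eq (f j2) N.
pose X := (f j2 %/ N)%Z - (f j1 %/ N)%Z.
exists X, (j2%:Z - j1%:Z).
have := ltn_ord j2; split; [lia | lia |].
have {}Eg : f j2 - f j1 = X * N by rewrite /X; lia.
have H1 := floor_itv (N%:R * j1%:R * s); have H2 := floor_itv (N%:R * j2%:R * s).
rewrite -/(f _) in H1; rewrite -/(f _) in H2.
have {}Eg : (f j2)%:~R - (f j1)%:~R = X%:~R * N%:R :> R.
  by rewrite -rmorphB /= Eg rmorphM.
have -> : ((j2%:Z - j1%:Z)%:~R = j2%:R - j1%:R :> R) by rewrite intrB.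
rewrite !intrD in H1 H2; case/andP: H1 => a1 a2; case/andP: H2 => a3 a4.
rewrite -(ltr_pM2r N0') mulVf ?gt_eqF // -[X in _ * X < _](gtr0_norm N0') -normrM.
rewrite ltr_norml; apply/andP; split; nra.
Qed.

Lemma pell_form_neq0 (D : nat) (x y : int) : (forall n, n ^ 2 != D)%N -> 0 < y ->
  x ^+ 2 - D%:Z * y ^+ 2 != 0.
Proof.
move=> nsq y0; apply/eqP => E.
have E3 : (`|x| ^ 2 = D * `|y| ^ 2)%N by lia.
have dv : (`|y| %| `|x|)%N by rewrite -(@dvdn_pexp2r _ _ 2) // E3 dvdn_mull.
case/dvdnP: dv => q Eq; move/eqP: (nsq q); apply.
rewrite Eq expnMn in E3; have : (0 < `|y| ^ 2)%N by rewrite expn_gt0; lia.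
nia.
Qed.

(** The quotient of x2 + y2 sqrt D by x1 + y1 sqrt D has norm 1, and the congruences make its
    coordinates [P] and [Q] integral. [Q] = 0 would force the two pairs to agree, both y's being
    positive. The modulus is any multiple of the norm, so that one modulus can serve all norms at
    once. *)
Lemma pell_quotient (D : nat) (x1 y1 x2 y2 W : int) :
  let k := x1 ^+ 2 - D%:Z * y1 ^+ 2 in
  (forall n, n ^ 2 != D)%N -> 0 < y1 -> 0 < y2 -> (k %| W)%Z ->
  x2 ^+ 2 - D%:Z * y2 ^+ 2 = k -> (x1 = x2 %[mod W])%Z -> (y1 = y2 %[mod W])%Z ->
  (x1, y1) != (x2, y2) ->
  exists x y : nat, (0 < y)%N /\ (x ^ 2 = D * y ^ 2 + 1)%N.
Proof.
move=> k nsq y1p y2p kW Ek EX EY nd.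
have k0 : k != 0 by exact: pell_form_neq0.
have /dvdzP[a Ea] : (k %| x1 - x2)%Z.
  by apply: dvdz_trans kW _; rewrite -eqz_mod_dvd; apply/eqP.
have /dvdzP[b Eb] : (k %| y1 - y2)%Z.
  by apply: dvdz_trans kW _; rewrite -eqz_mod_dvd; apply/eqP.
have defk : k = x1 ^+ 2 - D%:Z * y1 ^+ 2 by [].
move: (k) defk k0 Ek Ea Eb => {kW} {}k defk k0 Ek Ea Eb.
pose P := 1 - x1 * a + D%:Z * y1 * b; pose Q := a * y1 - x1 * b.
have Ex2 : x2 = x1 - a * k by rewrite -Ea; ring.
have Ey2 : y2 = y1 - b * k by rewrite -Eb; ring.
have EP : x1 * x2 - D%:Z * y1 * y2 = k * P.
  transitivity (x1 ^+ 2 - D%:Z * y1 ^+ 2 - k * (x1 * a - D%:Z * y1 * b)).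
    by rewrite Ex2 Ey2; ring.
  by rewrite -defk /P; ring.
have EQ : x1 * y2 - x2 * y1 = k * Q by rewrite Ex2 Ey2 /Q; ring.
have N1 : P ^+ 2 - D%:Z * Q ^+ 2 = 1.
  have k00 : k ^+ 2 != 0 by rewrite expf_neq0.
  apply: (mulfI k00); rewrite mulr1.
  transitivity ((k * P) ^+ 2 - D%:Z * (k * Q) ^+ 2); first by ring.
  rewrite -EP -EQ; transitivity ((x2 ^+ 2 - D%:Z * y2 ^+ 2) * (x1 ^+ 2 - D%:Z * y1 ^+ 2)).
    by ring.
  by rewrite Ek -defk.
have Q0 : Q != 0.
  apply/eqP => Q0; rewrite Q0 mulr0 in EQ.
  have EQ' : x1 * y2 = x2 * y1 by apply/eqP; rewrite -subr_eq0 EQ.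
  have E1 : k * y2 ^+ 2 = k * y1 ^+ 2.
    transitivity ((x1 * y2) ^+ 2 - D%:Z * y1 ^+ 2 * y2 ^+ 2); first by rewrite defk; ring.
    by rewrite EQ' -Ek; ring.
  move/(mulfI k0) : E1 => E1.
  have E2 : y2 = y1.
    by apply/eqP; rewrite -(eqrXn2 (n := 2)) ?(ltW y1p) ?(ltW y2p) //; apply/eqP.
  have E3 : x1 = x2.
    have y10 : y1 != 0 by rewrite gt_eqF.
    by apply: (mulIf y10); rewrite -EQ' E2.
  by move: nd; rewrite E3 E2 eqxx.
clear -N1 Q0.
by exists `|P|%N, `|Q|%N; split; lia.
Qed.

(** If |x - y s| < 1/N with y at most N, then |x + y s| is at most 1/N + 2 N s, and the product is
    at most 1 + 2 s, hence at most 2 D + 1. *)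
Lemma pell_bounded (R : archiRealFieldType) (s : R) (D : nat) (e : R) :
  (forall n, n ^ 2 != D)%N -> (0 < D)%N -> 0 <= s -> s ^+ 2 = D%:R -> 0 < e ->
  exists x y : int, [/\ 0 < y, `|x ^+ 2 - D%:Z * y ^+ 2| <= (2 * D + 1)%:Z,
    0 < `|x%:~R - y%:~R * s| & `|x%:~R - y%:~R * s| < e].
Proof.
move=> nsq D0 s0 sD e0.
have [N N0 Ne] : exists2 N, (0 < N)%N & N%:R^-1 < e.
  exists (Num.bound e^-1).+1 => //.
  rewrite -[ltRHS]invrK ltf_pV2 ?posrE ?invr_gt0 ?ltr0n //.
  have := archi_boundP (ltW (_ : 0 < e^-1)); rewrite invr_gt0 => /(_ e0) /lt_trans; apply.
  by rewrite ltr_nat.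
have [x [y [y0 yN H]]] := dirichlet_approx s0 N0.
have N1 : N%:R^-1 * N%:R = 1 :> R by rewrite mulVf // pnatr_eq0; lia.
have N1' : N%:R^-1 <= 1 :> R by rewrite invf_le1 ?ltr0n // ler1n.
have N2 : 0 < N%:R^-1 :> R by rewrite invr_gt0 ltr0n.
exists x, y; split => //; last exact: lt_trans Ne.
  rewrite -(ler_int R) intr_norm intrB intrM !rmorphXn /=.
  have -> : x%:~R ^+ 2 - D%:~R * y%:~R ^+ 2 =
     (x%:~R - y%:~R * s) * (x%:~R - y%:~R * s + 2 * y%:~R * s).
     by rewrite -[D%:~R]/(D%:R) -sD; ring.
  set d := _ - _ in H *; rewrite normrM.
  have y0' : 0 <= y%:~R :> R by rewrite ler0z ltW.
  have yN' : y%:~R <= N%:R :> R by rewrite -[N%:R]/(N%:Z%:~R) ler_int.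
  have sD' : s <= D%:R.
    have [s1|s1] := leP s 1; first by apply: le_trans s1 _; rewrite ler1n.
    by rewrite -sD; nra.
  have h1 : `|d + 2 * y%:~R * s| <= N%:R^-1 + 2 * N%:R * s.
    apply: le_trans (ler_normD _ _) _; apply: lerD; first exact: ltW.
    by rewrite ger0_norm; nra.
  have -> : (2 * D + 1)%:Z%:~R = 2 * D%:R + 1 :> R by rewrite -[_%:~R]/(_%:R) natrD natrM.
  have h0 : 0 <= `|d| by [].
  apply: (@le_trans _ _ (N%:R^-1 * (N%:R^-1 + 2 * N%:R * s))).
    by apply: ler_pM => //; exact: ltW.
  have -> : N%:R^-1 * (N%:R^-1 + 2 * N%:R * s) = N%:R^-1 * N%:R^-1 + 2 * s * (N%:R^-1 * N%:R) by ring.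
  by rewrite N1; nra.
rewrite normr_gt0 subr_eq0; apply/eqP => E.
have : (x ^+ 2)%:~R = (D%:Z * y ^+ 2)%:~R :> R.
  by rewrite [RHS]intrM !rmorphXn /= E exprMn sD mulrC.
move/intr_inj => E2.
by move/eqP: (@pell_form_neq0 _ x _ nsq y0); apply; rewrite E2 subrr.
Qed.

Lemma absz_shift_inj (m : nat) (a b : int) : `|a| <= m%:Z -> `|b| <= m%:Z ->
  `|(a + m%:Z)%R|%N = `|(b + m%:Z)%R|%N -> a = b.
Proof. by lia. Qed.

Lemma dvdz_fact (m : nat) (a : int) : `|a| <= m%:Z -> a != 0 -> (a %| m`!%:Z)%Z.
Proof. by move=> h a0; rewrite /dvdz /=; apply: dvdn_fact; lia. Qed.

(** Ever better approximations give infinitely many distinct pairs of bounded norm; the pigeonhole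
    principle finds two with equal norm and congruent coordinates, to which [pell_quotient]
    applies. *)
Lemma pell (D : nat) : (forall n, n ^ 2 != D)%N -> (0 < D)%N ->
  exists x y : nat, (0 < y)%N /\ (x ^ 2 = D * y ^ 2 + 1)%N.
Proof.
move=> nsq D0.
pose s : algR := Num.sqrt D%:R.
have s0 : 0 <= s by exact: sqrtr_ge0.
have sD : s ^+ 2 = D%:R by rewrite sqr_sqrtr // ler0n.
pose dl (u : int * int) : algR := `|u.1%:~R - u.2%:~R * s|.
pose M := (2 * D + 1)%N.
pose good (u : int * int) := [/\ 0 < u.2,
  `|u.1 ^+ 2 - D%:Z * u.2 ^+ 2| <= M%:Z & 0 < dl u].
have base e : 0 < e -> {u | good u /\ dl u < e}.
  move=> e0; pose Q (u : int * int) := [&& 0 < u.2,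
     `|u.1 ^+ 2 - D%:Z * u.2 ^+ 2| <= M%:Z, 0 < dl u & dl u < e].
  have /sigW[u /and4P[? ? ? ?]] : exists u, Q u.
    have [x [y [? ? ? ?]]] := pell_bounded (s := s) nsq D0 s0 sD e0.
    by exists (x, y); apply/and4P; split.
  by exists u; split=> //; split.
have step (u : {u | good u}) : {v : {v | good v} | dl (sval v) < dl (sval u)}.
  case: u => u gu; have [v [gv lv]] := base (dl u) (let: And3 _ _ h := gu in h).
  by exists (exist _ v gv).
have [u0 [gu0 _]] := base 1 ltr01.
pose sq n := iter n (fun u => sval (step u)) (exist _ u0 gu0).
have dec i j : (i < j)%N -> dl (sval (sq j)) < dl (sval (sq i)).
  elim: j => // j IH; rewrite ltnS leq_eqVlt => /orP[/eqP->|/IH h].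
    exact: (svalP (step (sq j))).
  exact: lt_trans (svalP (step (sq j))) h.
pose X i : int := (sval (sq i)).1; pose Y i : int := (sval (sq i)).2.
pose k i : int := X i ^+ 2 - D%:Z * Y i ^+ 2.
(* A factorial is divisible by every nonzero norm of absolute value at most [M]. *)
pose W := M`!.
have W0 : (0 < W)%N by exact: fact_gt0.
have Wz : W%:Z != 0 by lia.
pose T : finType := ('I_(2 * M + 1) * ('I_W.-1.+1 * 'I_W.-1.+1))%type.
have k2 i : (`|(k i + M%:Z)%R| < (2 * M + 1))%N.
  by case: (svalP (sq i)) => _; rewrite -/(k i) => ? _; lia.
have mb (z : int) : (`|(z %% W)%Z| < W.-1.+1)%N.
  by have := ltz_pmod z (d := W%:Z); have := modz_ge0 z Wz; lia.
pose g (i : 'I_#|T|.+1) : T := (Ordinal (k2 i), (Ordinal (mb (X i)), Ordinal (mb (Y i)))).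
have /injectivePn[i1 [i2 ni Eg]] : ~~ injectiveb g.
  by apply/injectiveP => /leq_card; rewrite card_ord ltnn.
have nd : dl (sval (sq i1)) != dl (sval (sq i2)).
  case: (ltngtP i1 i2) => [/dec h|/dec h|/val_inj h]; rewrite ?(gt_eqF h) ?(lt_eqF h) //.
  by rewrite h eqxx in ni.
case: Eg => Ek EX EY.
have {}EX : (X i1 %% W)%Z = (X i2 %% W)%Z.
  by have := modz_ge0 (X i1) Wz; have := modz_ge0 (X i2) Wz; lia.
have {}EY : (Y i1 %% W)%Z = (Y i2 %% W)%Z.
  by have := modz_ge0 (Y i1) Wz; have := modz_ge0 (Y i2) Wz; lia.
have [y1 b1 d1] := svalP (sq i1); have [y2 b2 d2] := svalP (sq i2).
rewrite -/(X i1) -/(Y i1) -/(k i1) in y1 b1; rewrite -/(X i2) -/(Y i2) -/(k i2) in y2 b2.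
have {}Ek : k i1 = k i2 by apply: absz_shift_inj Ek.
have kW : (k i1 %| W%:Z)%Z.
  exact: dvdz_fact b1 (@pell_form_neq0 _ (X i1) _ nsq y1).
apply: (pell_quotient nsq y1 y2 kW (esym Ek) EX EY).
apply: contra_neq nd => -[E1 E2].
by rewrite /dl -/(X i1) -/(Y i1) -/(X i2) -/(Y i2) E1 E2.
Qed.

Lemma coprime_mul_sqr (u w v : nat) : coprime u w -> (u * w = v ^ 2)%N ->
  (u = gcdn u v ^ 2)%N.
Proof.
move=> cuw E.
case: (posnP v) => [v0|v0].
  move: E; rewrite v0 gcdn0 => /eqP; rewrite muln_eq0 => /orP[/eqP->//|/eqP w0].
  by move: cuw; rewrite w0 /coprime gcdn0 => /eqP->.
have g0 : (0 < gcdn u v)%N by rewrite gcdn_gt0 v0 orbT.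
have [u' Eu] := dvdnP (dvdn_gcdl u v); have [v' Ev] := dvdnP (dvdn_gcdr u v).
move: Eu Ev g0; set g := gcdn u v => Eu Ev g0.
have cop : coprime u' v'.
  by rewrite /coprime -(eqn_pmul2r g0) mul1n muln_gcdl -Eu -Ev.
have E2 : (u' * w = g * v' ^ 2)%N.
  by apply/eqP; rewrite -(eqn_pmul2l g0); apply/eqP; rewrite Eu Ev in E; lia.
have d1 : (u' %| g)%N.
  by rewrite -(@Gauss_dvdl _ _ (v' ^ 2)) -?E2 ?dvdn_mulr // coprimeXr.
have d2 : (g %| u')%N.
  rewrite -(@Gauss_dvdl _ _ w) ?E2 ?dvdn_mulr //.
  by apply: coprime_dvdl cuw; rewrite Eu dvdn_mull.
have Eg : u' = g by apply/eqP; rewrite eqn_dvd d1 d2.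
by rewrite -mulnn [LHS]Eu Eg.
Qed.

(** Legendre's argument on the least solution of x^2 - p y^2 = 1. Modulo 4, y = 2v is even and x =
    2w + 1 odd, so w (w + 1) = p v^2 with coprime factors. If p divides w + 1, then w = a^2 and w +
    1 = p b^2, the solution sought. If p divides w, then w + 1 = a^2 and w = p b^2, a smaller
    solution of the original equation. *)
Lemma negative_pell (p : nat) : prime p -> (p %% 4 = 1)%N ->
  exists x y : nat, (x ^ 2 + 1 = p * y ^ 2)%N.
Proof.
move=> pp p4; have p0 := prime_gt0 pp.
have nsq n : (n ^ 2 != p)%N.
  by apply/eqP => E; move: pp; rewrite -E -mulnn; move/primeP => [h1 /(_ n (dvdn_mulr _ (dvdnn _)))]; nia.
have ex : exists y, (0 < y)%N && [exists x : 'I_(p * y ^ 2 + 2), x ^ 2 == p * y ^ 2 + 1]%N.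
  have [x [y [y0 E]]] := pell nsq p0; exists y; rewrite y0 /=.
  have lx : (x < p * y ^ 2 + 2)%N by rewrite -(addn1 1) addnA -E; nia.
  by apply/existsP; exists (Ordinal lx); rewrite /= E.
case: (ex_minnP ex) => y /andP[y0 /existsP[[x _] /= /eqP E]] ymin.
have oddy : ~~ odd y.
  apply/negP => oy; have [t Et] : exists t, y = (2 * t + 1)%N by exists y./2; lia.
  have [q Eq] : exists q, p = (4 * q + 1)%N by exists (p %/ 4)%N; lia.
  have [w [Ew|Ew]] : exists w, x = (2 * w)%N \/ x = (2 * w + 1)%N by exists (x./2); lia.
    by rewrite Ew Et Eq in E; nia.
  by rewrite Ew Et Eq in E; nia.
have [v Ev] : exists v, y = (2 * v)%N by exists y./2; lia.
have [w Ew] : exists w, x = (2 * w + 1)%N.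
  exists x./2; have : odd (x ^ 2)%N by rewrite E Ev; lia.
  rewrite oddX /=; lia.
have E1 : (w.+1 * w = p * v ^ 2)%N by rewrite Ew Ev in E; nia.
have cop : coprime w.+1 w by rewrite coprime_sym coprimenS.
have v0 : (0 < v)%N by lia.
have w0 : (0 < w)%N by nia.
have : (p %| w.+1 * w)%N by rewrite E1 dvdn_mulr.
rewrite Euclid_dvdM // => /orP[] /dvdnP[c Ec].
  have E2 : (w * c = v ^ 2)%N by apply/eqP; rewrite -(eqn_pmul2l p0) -E1 Ec; apply/eqP; lia.
  have cop2 : coprime w c.
    by rewrite coprime_sym in cop; apply: coprime_dvdr cop; rewrite Ec dvdn_mulr.
  have e1 := coprime_mul_sqr cop2 E2.
  rewrite mulnC in E2; rewrite coprime_sym in cop2; have e2 := coprime_mul_sqr cop2 E2.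
  by exists (gcdn w v), (gcdn c v); rewrite -e1 -e2; lia.
have E2 : (w.+1 * c = v ^ 2)%N by apply/eqP; rewrite -(eqn_pmul2l p0) -E1 Ec; apply/eqP; lia.
have cop2 : coprime w.+1 c by apply: coprime_dvdr cop; rewrite Ec dvdn_mulr.
have e1 := coprime_mul_sqr cop2 E2.
rewrite mulnC in E2; rewrite coprime_sym in cop2; have e2 := coprime_mul_sqr cop2 E2.
have lt : (gcdn c v < y)%N by apply: leq_ltn_trans (dvdn_leq v0 (dvdn_gcdr _ _)) _; lia.
have g0 : (0 < gcdn c v)%N by rewrite gcdn_gt0 v0 orbT.
have E3 : (gcdn w.+1 v ^ 2 = p * gcdn c v ^ 2 + 1)%N by rewrite -e1 -e2; lia.
suff : (y <= gcdn c v)%N by lia.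
apply: ymin; rewrite g0 /=; apply/existsP.
have lx : (gcdn w.+1 v < p * gcdn c v ^ 2 + 2)%N.
  rewrite addn2 -(addn1 (p * _)) -E3 ltnS -mulnn.
  by case: (gcdn w.+1 v) => // n; rewrite leq_pmulr.
by exists (Ordinal lx); rewrite /= E3.
Qed.

(** * Subfields of algC and their automorphisms *)

Lemma Qgen_int s (n : int) : Qgen s n%:~R.
Proof. by have := Qgen_rat s n%:~R; rewrite ratr_int. Qed.

Lemma Qgen_nat s (n : nat) : Qgen s n%:R.
Proof. exact: (Qgen_int s n). Qed.

Lemma Qgen0 s : Qgen s 0. Proof. exact: (Qgen_nat s 0). Qed.
Lemma Qgen1 s : Qgen s 1. Proof. exact: (Qgen_nat s 1). Qed.

Lemma Qgen_sub s a b : Qgen s a -> Qgen s b -> Qgen s (a - b).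
Proof. by move=> ? ?; apply: Qgen_add => //; exact: Qgen_opp. Qed.

Lemma Qgen_div s a b : Qgen s a -> Qgen s b -> Qgen s (a / b).
Proof. by move=> ? ?; apply: Qgen_mul => //; exact: Qgen_inv. Qed.

Lemma Qgen_exp s a n : Qgen s a -> Qgen s (a ^+ n).
Proof.
by move=> sa; elim: n => [|n IH]; rewrite ?expr0 ?exprS; [exact: Qgen1|exact: Qgen_mul].
Qed.

Lemma Qgen_expz s a (n : int) : Qgen s a -> Qgen s (a ^ n).
Proof.
by move=> sa; case: n => n; [|apply: Qgen_inv]; exact: Qgen_exp.
Qed.

#[local] Hint Resolve Qgen_int Qgen_nat Qgen0 Qgen1 : core.
#[local] Hint Resolve Qgen_rat Qgen_add Qgen_opp Qgen_mul Qgen_inv Qgen_sub Qgen_div Qgen_exp Qgen_expz : core.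

Lemma Qgen_trans s s' z : (forall a, a \in s -> Qgen s' a) -> Qgen s z -> Qgen s' z.
Proof.
by move=> H; elim=> *; auto.
Qed.

Lemma Qgen_subset s s' z : {subset s <= s'} -> Qgen s z -> Qgen s' z.
Proof. by move=> H; apply: Qgen_trans => a /H; exact: Qgen_gen. Qed.

Lemma Qgen_nil z : Qgen [::] z -> exists q : rat, z = ratr q.
Proof.
elim=> {z} [q|//|a b _ [p ->] _ [q ->]|a _ [p ->]|a b _ [p ->] _ [q ->]|a _ [p ->]].
- by exists q.
- by exists (p + q); rewrite rmorphD.
- by exists (- p); rewrite rmorphN.
- by exists (p * q); rewrite rmorphM.
- by exists p^-1; rewrite fmorphV.
Qed.

Lemma Qgen_aut (nu : {rmorphism algC -> algC}) s s' z :
  (forall a, a \in s -> Qgen s' (nu a)) -> Qgen s z -> Qgen s' (nu z).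
Proof.
move=> H; elim=> {z} [q|a /H //|a b _ IHa _ IHb|a _ IH|a b _ IHa _ IHb|a _ IH].
- by rewrite fmorph_rat.
- by rewrite rmorphD; auto.
- by rewrite rmorphN; auto.
- by rewrite rmorphM; auto.
- by rewrite fmorphV; auto.
Qed.

Lemma Qgen_aut_eq (nu mu : {rmorphism algC -> algC}) s z :
  (forall a, a \in s -> nu a = mu a) -> Qgen s z -> nu z = mu z.
Proof.
move=> H; elim=> {z} [q|a /H //|a b _ IHa _ IHb|a _ IH|a b _ IHa _ IHb|a _ IH].
- by rewrite !fmorph_rat.
- by rewrite !rmorphD IHa IHb.
- by rewrite !rmorphN IH.
- by rewrite !rmorphM IHa IHb.
- by rewrite !fmorphV IH.
Qed.

Lemma Qgen_quad s a z : Qgen s (a ^+ 2) -> Qgen (a :: s) z ->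
  exists u v, [/\ Qgen s u, Qgen s v & z = u + v * a].
Proof.
move=> sa; elim=> {z}.
- by move=> q; exists (ratr q), 0; split; auto; ring.
- move=> b; rewrite inE => /orP[/eqP->|sb].
    by exists 0, 1; split; auto; ring.
  by exists b, 0; split; auto; [exact: Qgen_gen | ring].
- move=> z w _ [u [v [su sv ->]]] _ [u' [v' [su' sv' ->]]].
  by exists (u + u'), (v + v'); split; auto; ring.
- move=> z _ [u [v [su sv ->]]].
  by exists (- u), (- v); split; auto; ring.
- move=> z w _ [u [v [su sv ->]]] _ [u' [v' [su' sv' ->]]].
  exists (u * u' + v * v' * a ^+ 2), (u * v' + u' * v); split; auto; ring.
move=> z _ [u [v [su sv ->]]].
have [E|nE] := eqVneq (u ^+ 2 - v ^+ 2 * a ^+ 2) 0; last first.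
  have [/eqP h1 /eqP h2] : u + v * a != 0 /\ u - v * a != 0.
    by apply/andP; rewrite -negb_or -mulf_eq0; apply: contra_neq nE => <-; ring.
  exists (u / (u ^+ 2 - v ^+ 2 * a ^+ 2)), (- v / (u ^+ 2 - v ^+ 2 * a ^+ 2)).
  by split; auto; field; rewrite exprMn nE; exact/eqP.
(* Nothing says that a lies outside the field of s, so the norm form can vanish without u and v
   being 0. In that case u + v a already lies in the smaller field. *)
suff sz : Qgen s (u + v * a) by exists ((u + v * a)^-1), 0; split; auto; ring.
have [v0|v0] := eqVneq v 0; first by rewrite v0 mul0r addr0.
have : (u - v * a) * (u + v * a) = 0 by rewrite -E; ring.
move/eqP; rewrite mulf_eq0 => /orP[|/eqP->//].
by rewrite subr_eq0 => /eqP <-; auto.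
Qed.

(** If neither u nor v is 0 in z = u + v a, the cross term 2 u v a of z^2 puts a itself in the
    smaller field. *)
Lemma Qgen_sqr s a z : Qgen s (a ^+ 2) -> Qgen (a :: s) z -> Qgen s (z ^+ 2) ->
  Qgen s z \/ exists2 v, Qgen s v & z = v * a.
Proof.
move=> sa /(Qgen_quad sa) [u [v [su sv ->]]] sz.
have [v0|v0] := eqVneq v 0; first by left; rewrite v0 mul0r addr0.
have [u0|u0] := eqVneq u 0; first by right; exists v; rewrite // u0 add0r.
left; apply: Qgen_add => //; apply: Qgen_mul => //.
have -> : a = ((u + v * a) ^+ 2 - u ^+ 2 - v ^+ 2 * a ^+ 2) / (2 * u * v).
  by field; rewrite u0 v0.
by auto 10.
Qed.

Lemma Qgen_fixed (nu : {rmorphism algC -> algC}) s a z :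
  Qgen s (a ^+ 2) -> (forall b, b \in s -> nu b = b) -> nu a = - a ->
  Qgen (a :: s) z -> nu z = z -> Qgen s z.
Proof.
move=> sa fs na /(Qgen_quad sa) [u [v [su sv ->]]].
have fs' w : Qgen s w -> nu w = w by move=> ?; apply: (@Qgen_aut_eq _ idfun s).
rewrite rmorphD rmorphM /= na !fs' // => /addrI /eqP.
rewrite -subr_eq0 mulrN -opprD oppr_eq0 -mulr2n mulrn_eq0 /= => /eqP->.
by rewrite addr0.
Qed.

(** Links [Qgen] to subfields of an abstract number field, where minimal polynomials and extension
    of homomorphisms are at hand. *)
Lemma Qgen_adjoin (Qs : fieldExtType rat) (QsC : {rmorphism Qs -> algC}) (t : seq Qs) y :
  y \in <<1 & t>>%VS <-> Qgen (map QsC t) (QsC y).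
Proof.
split.
  elim/last_ind: t y => [|t x IH] y.
    rewrite Fadjoin_nil => /vlineP[q ->].
    by rewrite alg_num_field fmorph_rat; exact: Qgen_rat.
  rewrite adjoin_rcons => /Fadjoin_polyP[p /polyOverP Ep ->].
  have sub : forall z, Qgen (map QsC t) z -> Qgen (map QsC (rcons t x)) z.
    by move=> z; apply: Qgen_subset => w; rewrite map_rcons mem_rcons inE orbC => ->.
  rewrite horner_coef rmorph_sum /=.
  elim/big_rec: _ => [//|i w _ Hw]; apply: Qgen_add => //.
  rewrite rmorphM rmorphXn /=; apply: Qgen_mul; first by apply/sub/IH/Ep.
  by apply: Qgen_exp; apply: Qgen_gen; rewrite map_rcons mem_rcons mem_head.
suff H z : Qgen (map QsC t) z -> exists2 y, y \in <<1 & t>>%VS & QsC y = z.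
  by case/H => y' Hy' /fmorph_inj <-.
elim=> {z} [q|a /mapP[b tb ->]|a b _ [a' ? <-] _ [b' ? <-]|a _ [a' ? <-]|a b _ [a' ? <-] _ [b' ? <-]|a _ [a' ? <-]].
- exists (ratr q); last by rewrite fmorph_rat.
  by rewrite -alg_num_field rpredZ ?mem1v.
- by exists b => //; apply: seqv_sub_adjoin.
- by exists (a' + b'); rewrite ?rmorphD ?rpredD.
- by exists (- a'); rewrite ?rmorphN ?rpredN.
- by exists (a' * b'); rewrite ?rmorphM ?rpredM.
- by exists (a'^-1); rewrite ?fmorphV ?rpredV.
Qed.

(** The minimal polynomial of a over the field of s is X^2 - a^2, so the identity extends by a -> -a
    to the number field generated, and from there to [algC]. *)
Lemma sqrt_aut s a : Qgen s (a ^+ 2) -> ~ Qgen s a ->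
  exists nu : {rmorphism algC -> algC}, (forall z, Qgen s z -> nu z = z) /\ nu a = - a.
Proof.
move=> sa nsa.
have [Qs [QsC [s1 Es1 gen]]] := num_field_exists (rcons s a).
have [[t x] Et] : {tx : seq Qs * Qs | s1 = rcons tx.1 tx.2}.
  case: (lastP s1) Es1 => [|t x]; last by exists (t, x).
  by move/(congr1 size); rewrite size_rcons.
rewrite Et /= map_rcons in Es1; case/rcons_inj: Es1 => Es Ea.
rewrite Et /= adjoin_rcons in gen.
pose E : {subfield Qs} := <<1 & t>>%AS.
have Ex2 : x ^+ 2 \in E by apply/(Qgen_adjoin QsC); rewrite rmorphXn /= Es Ea.
have nEx : x \notin E by apply/negP => /(Qgen_adjoin QsC); rewrite Es Ea.
have dv : minPoly E x %| 'X^2 - (x ^+ 2)%:P.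
  apply: minPoly_dvdp; last by rewrite rootE !hornerE subrr.
  by rewrite rpredB ?rpredX ?polyOverX ?polyOverC.
have sz : size ('X^2 - (x ^+ 2)%:P) = 3%N by rewrite size_XnsubC.
have eqp : minPoly E x %= 'X^2 - (x ^+ 2)%:P.
  rewrite -dvdp_size_eqp // sz size_minPoly.
  have : (size (minPoly E x) <= 3)%N by rewrite -sz dvdp_leq // -size_poly_eq0 sz.
  have := adjoin_deg_eq1 E x; rewrite (negbTE nEx) size_minPoly.
  by rewrite /adjoin_degree; lia.
have rt : root (map_poly \1%VF (minPoly E x)) (- x).
  by rewrite lfun1_poly (eqp_root eqp) rootE !hornerE sqrrN subrr.
pose phi := kHomExtend E \1 x (- x).
have hom1 : kHom 1 E (\1%VF : 'End(Qs)) by rewrite kHom1.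
have phim : monoid_morphism phi.
  by apply/kHom_monoid_morphism; rewrite -gen kHomExtendP // sub1v.
pose phimM := GRing.isMonoidMorphism.Build _ _ phi phim.
pose phiRM : {rmorphism _ -> _} := HB.pack (fun_of_lfun phi) phimM.
have [nu Dnu] := extend_algC_subfield_aut QsC phiRM.
exists nu; split; last first.
  by rewrite -Ea -Dnu /= (kHomExtend_val hom1) // rmorphN.
move=> z sz'; apply: (@Qgen_aut_eq _ idfun s z) => // b.
rewrite -Es => /mapP[c tc ->]; rewrite -Dnu /= kHomExtend_id ?id_lfunE //.
exact: seqv_sub_adjoin.
Qed.

(** * Capitulation as a cohomology group *)

Lemma ringO0 s : ringO s 0. Proof. by split => //; exact: Aint0. Qed.
Lemma ringO1 s : ringO s 1. Proof. by split => //; exact: Aint1. Qed.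

Lemma ringO_add s x y : ringO s x -> ringO s y -> ringO s (x + y).
Proof. by move=> [? ?] [? ?]; split; [exact: Qgen_add|exact: rpredD]. Qed.

Lemma ringO_opp s x : ringO s x -> ringO s (- x).
Proof. by move=> [? ?]; split; [exact: Qgen_opp|rewrite rpredN]. Qed.

Lemma ringO_mul s x y : ringO s x -> ringO s y -> ringO s (x * y).
Proof. by move=> [? ?] [? ?]; split; [exact: Qgen_mul|exact: rpredM]. Qed.

Definition unitO s u := [/\ ringO s u, ringO s u^-1 & u != 0].

Lemma unitO_of_mul1 s x y : ringO s x -> ringO s y -> x * y = 1 -> unitO s x.
Proof.
move=> sx sy E; have x0 : x != 0.
  by apply/eqP => x0; move/eqP: E; rewrite x0 mul0r eq_sym oner_eq0.
by split=> //; suff -> : x^-1 = y by []; apply: (mulfI x0); rewrite mulfV.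
Qed.

Lemma unitO_inv s u : unitO s u -> unitO s u^-1.
Proof. by case=> ? ? ?; split; rewrite ?invrK ?invr_eq0. Qed.

Lemma unitO_mul s u v : unitO s u -> unitO s v -> unitO s (u * v).
Proof.
case=> ? ? ? [? ? ?]; split; rewrite ?invfM ?mulf_neq0 //; exact: ringO_mul.
Qed.

Section Capitulation.

Variables (sk sL : seq algC) (sigma : {rmorphism algC -> algC}).
Hypothesis sub_kL : forall z, Qgen sk z -> Qgen sL z.
Hypothesis sigma_k : forall z, Qgen sk z -> sigma z = z.
Hypothesis sigma_L : forall z, Qgen sL z -> Qgen sL (sigma z).
Hypothesis sigmaK : forall z, Qgen sL z -> sigma (sigma z) = z.
Hypothesis fixed_k : forall z, Qgen sL z -> sigma z = z -> Qgen sk z.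
(** Each datum has one use: [t], of trace 1, shows that extending an ideal and contracting it again
    gives it back; [a0] is the Hilbert 90 witness for the unit -1; [l] plays the part of a basis of
    L with its dual under the trace form. *)
Variables (t a0 : algC) (l : seq (algC * algC)).
Hypothesis ring_t : ringO sL t.
Hypothesis trace_t : t + sigma t = 1.
Hypothesis ring_a0 : ringO sL a0.
Hypothesis a0_neq0 : a0 != 0.
Hypothesis sigma_a0 : sigma a0 = - a0.
Hypothesis ring_l : forall p, p \in l -> ringO sL p.1 /\ ringO sL p.2.
(* This is the unramifiedness of the extension: it descends sigma-stable ideals
   of sL to sk. *)
Hypothesis galois_l : forall a, Qgen sL a ->
  a = \sum_(p <- l) p.1 * (p.2 * a + sigma (p.2 * a)).

Let ringO_kL z : ringO sk z -> ringO sL z.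
Proof. by case=> /sub_kL. Qed.

Let ringO_sigma z : ringO sL z -> ringO sL (sigma z).
Proof. by case=> ? ?; split; rewrite ?Aint_aut //; exact: sigma_L. Qed.

Let ringO_trace z : ringO sL z -> ringO sk (z + sigma z).
Proof.
move=> sz; have [? ?] := ringO_add sz (ringO_sigma sz); split=> //.
apply: fixed_k; first by [].
by rewrite rmorphD (sigmaK (proj1 sz)) addrC.
Qed.

Let ringO_norm z : ringO sL z -> ringO sk (z * sigma z).
Proof.
move=> sz; have [? ?] := ringO_mul sz (ringO_sigma sz); split=> //.
apply: fixed_k; first by [].
by rewrite rmorphM (sigmaK (proj1 sz)) mulrC.
Qed.

(** The usual witness 1 + z vanishes only at z = -1, where the element negated by [sigma] takes
    over. *)
Lemma hilbert90 z : ringO sL z -> z * sigma z = 1 ->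
  exists al, [/\ ringO sL al, al != 0 & al = z * sigma al].
Proof.
move=> sz E; have [z1|z1] := eqVneq z (-1).
  by exists a0; split=> //; rewrite z1 sigma_a0 mulrNN mul1r.
exists (1 + z); split; first exact: ringO_add (ringO1 _) sz.
  by rewrite addrC -[1]opprK subr_eq0.
by rewrite rmorphD rmorph1 mulrDr mulr1 E addrC.
Qed.

(** The ideal of k cut out by the principal ideal of L generated by [al]. It is the descent of that
    ideal when [al] / [sigma al] is a unit. *)
Definition contraction al x := ringO sk x /\ exists2 b, ringO sL b & x = al * b.

Lemma contraction_is_ideal al : ringO sL al -> al != 0 -> is_ideal sk (contraction al).
Proof.
move=> sal al0; split.
- by move=> x [].
- by split; [exact: ringO0 | exists 0; [exact: ringO0 | rewrite mulr0]].
- move=> x y [sx [b sb Ex]] [sy [c sc Ey]]; split; first exact: ringO_add.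
  by exists (b + c); [exact: ringO_add | rewrite Ex Ey mulrDr].
- move=> a x sa [sx [b sb Ex]]; split; first exact: ringO_mul.
  by exists (a * b); [apply: ringO_mul => //; exact: ringO_kL | rewrite Ex mulrCA].
exists (al * sigma al); split; last by rewrite mulf_neq0 // fmorph_eq0.
split; first exact: ringO_norm.
by exists (sigma al) => //; exact: ringO_sigma.
Qed.

Lemma ext_ideal_sum I (r : seq (algC * algC)) (F : algC * algC -> algC) :
  (forall p, p \in r -> ringO sL p.1 /\ I (F p)) ->
  ext_ideal sL I (\sum_(p <- r) p.1 * F p).
Proof.
elim: r => [|p r IH] H; first by rewrite big_nil; exact: ext_zero.
rewrite big_cons; apply: ext_add.
  by case: (H p (mem_head _ _)) => ? ?; exact: ext_gen.
by apply: IH => q qr; apply: H; rewrite inE qr orbT.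
Qed.

(** As z is a unit, the ideal generated by [al] is stable under [sigma], so it contains the traces
    Tr(d w) of its elements. These traces lie in k, and [galois_l] rebuilds w from them. *)
Lemma ext_contraction al z w : ringO sL al -> unitO sL z -> al = z * sigma al ->
  ext_ideal sL (contraction al) w <-> exists a, ringO sL a /\ w = al * a.
Proof.
move=> sal [sz szV z0] E; split.
  elim=> {w} [|a x sa [_ [b sb ->]]|u v _ [a [sa ->]] _ [b [sb ->]]].
  - by exists 0; rewrite mulr0; split => //; exact: ringO0.
  - by exists (a * b); rewrite mulrCA; split => //; exact: ringO_mul.
  - by exists (a + b); rewrite mulrDr; split => //; exact: ringO_add.
case=> a [sa Ew].
have sw : ringO sL w by rewrite Ew; exact: ringO_mul.
rewrite (galois_l (proj1 sw)); apply: ext_ideal_sum => p /ring_l[s1 s2]; split=> //.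
split; first by apply: ringO_trace; exact: ringO_mul.
have E2 : sigma al = z^-1 * al by rewrite {2}E mulKf.
exists (p.2 * a + z^-1 * sigma (p.2 * a)).
  apply: ringO_add; first exact: ringO_mul.
  by apply: ringO_mul => //; apply: ringO_sigma; exact: ringO_mul.
by rewrite Ew !rmorphM E2; ring.
Qed.

Lemma ext_ideal_trace J w u : is_ideal sk J -> ext_ideal sL J w -> ringO sL u ->
  J (u * w + sigma (u * w)).
Proof.
case=> Jring J0 JD JM _ Hw su; elim: Hw => {w} [|a x sa Jx|v w _ Hv _ Hw].
- by rewrite mulr0 rmorph0 addr0.
- have -> : u * (a * x) + sigma (u * (a * x)) = (u * a + sigma (u * a)) * x.
    by rewrite mulrA [sigma (_ * x)]rmorphM (sigma_k (proj1 (Jring _ Jx))) mulrDl.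
  by apply: JM => //; apply: ringO_trace; exact: ringO_mul.
- have -> : u * (v + w) + sigma (u * (v + w)) =
     (u * v + sigma (u * v)) + (u * w + sigma (u * w)) by rewrite mulrDr rmorphD; ring.
  exact: JD.
Qed.

(** The trace of t w lies in J by linearity over k, and it equals w because t has trace 1. *)
Lemma ext_ideal_contract J w : is_ideal sk J -> ext_ideal sL J w -> Qgen sk w -> J w.
Proof.
move=> idJ Hw kw; have := ext_ideal_trace idJ Hw ring_t.
by rewrite rmorphM (sigma_k kw) -mulrDl trace_t mul1r.
Qed.

Lemma ext_ideal_sigma J w : is_ideal sk J -> ext_ideal sL J w -> ext_ideal sL J (sigma w).
Proof.
case=> Jring _ _ _ _; elim=> {w} [|a x sa Jx|v w _ Hv _ Hw].
- by rewrite rmorph0; exact: ext_zero.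
- rewrite rmorphM (sigma_k (proj1 (Jring _ Jx))); apply: ext_gen => //.
  exact: ringO_sigma.
- by rewrite rmorphD; exact: ext_add.
Qed.

(** An inclusion of multiples of ideals of k becomes, after extension to L, a divisibility of
    generators. Used in both directions it shows that the cofactor is a unit. *)
Lemma equiv_ext_gen al be I1 I2 g1 g2 :
  (forall w, ext_ideal sL I1 w <-> exists a, ringO sL a /\ w = g1 * a) ->
  (forall w, ext_ideal sL I2 w <-> exists a, ringO sL a /\ w = g2 * a) ->
  (forall z, (exists x, I1 x /\ z = al * x) -> (exists y, I2 y /\ z = be * y)) ->
  exists2 b, ringO sL b & al * g1 = be * g2 * b.
Proof.
move=> H1 H2 H.
have {H1} : ext_ideal sL I1 g1 by apply/H1; exists 1; rewrite mulr1; split=> //; exact: ringO1.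
elim: {g1}_ / => [|a x sa Ix|u v _ [b sb Eb] _ [c sc Ec]].
- by exists 0; [exact: ringO0 | rewrite !mulr0].
- have [y [Iy Ey]] := H (al * x) (ex_intro _ x (conj Ix erefl)).
  have /H2[c [sc Ec]] : ext_ideal sL I2 (a * y) by exact: ext_gen.
  by exists c => //; rewrite mulrCA Ey -mulrA -Ec; ring.
- by exists (b + c); [exact: ringO_add | rewrite !mulrDr Eb Ec].
Qed.

(** A unit z = al / [sigma] al is sent to the class of the contraction of the ideal generated by al.
    Representatives of norm-one units modulo boundaries therefore give representatives of the
    capitulating classes. *)
Theorem card_kernel_cohomology (zs : seq algC) :
  (forall z, z \in zs -> unitO sL z /\ z * sigma z = 1) ->
  (forall i j, (i < size zs)%N -> (j < size zs)%N -> i <> j ->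
     forall v, unitO sL v -> zs`_i / zs`_j <> v / sigma v) ->
  (forall z, unitO sL z -> z * sigma z = 1 ->
     exists2 i, (i < size zs)%N & exists2 v, unitO sL v & z = zs`_i * (v / sigma v)) ->
  card_capitulation_kernel sk sL (size zs).
Proof.
move=> Hu Hinj Hsurj.
have [als [sz_als Hals]] : exists als : seq algC, size als = size zs /\
    forall i, (i < size zs)%N ->
      [/\ ringO sL als`_i, als`_i != 0 & als`_i = zs`_i * sigma als`_i].
  elim: (zs) Hu => [|z r IH] H; first by exists [::].
  have [als [sa Ha]] := IH (fun w wr => H w (@mem_behead _ (z :: r) w wr)).
  have [[sz _ _] E] := H z (mem_head _ _); have [al Hal] := hilbert90 sz E.
  by exists (al :: als); rewrite /= sa; split=> // [[|i]] //=; exact: Ha.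
have Hz i : (i < size zs)%N -> unitO sL zs`_i by move=> /(mem_nth 0)/Hu[].
have Hext i w : (i < size zs)%N ->
    ext_ideal sL (contraction als`_i) w <-> exists a, ringO sL a /\ w = als`_i * a.
  by move=> li; have [? _ ?] := Hals i li; apply: (@ext_contraction _ zs`_i) => //; exact: Hz.
have Hnth i : (i < size zs)%N ->
    nth (fun _ => False) [seq contraction al | al <- als] i = contraction als`_i.
  by move=> li; rewrite (nth_map 0) // sz_als.
exists [seq contraction al | al <- als]; split.
- by rewrite size_map.
- move=> i li; rewrite Hnth //; have [sal al0 _] := Hals i li.
  split; first exact: contraction_is_ideal.
  by exists als`_i; split=> // w; exact: Hext.
- move=> i j li lj nij; rewrite !Hnth // => -[al [be [sal sbe al0 be0 H]]].
  have [b sb Eb] := equiv_ext_gen (Hext i ^~ li) (Hext j ^~ lj) (fun z => proj1 (H z)).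
  have [c sc Ec] := equiv_ext_gen (Hext j ^~ lj) (Hext i ^~ li) (fun z => proj2 (H z)).
  have [si ai0 Ei] := Hals i li; have [sj aj0 Ej] := Hals j lj.
  have ub : unitO sL b.
    apply: (unitO_of_mul1 sb sc); apply: (mulfI (mulf_neq0 be0 aj0)).
    by rewrite mulrA -Eb -Ec mulr1.
  have [_ _ b0] := ub; apply: (Hinj i j li lj nij b ub).
  (* Dividing [Eb] by its conjugate cancels [al] and [be], which lie in k, and leaves the quotient
     of the two representatives equal to b / [sigma b]. *)
  have Es := congr1 sigma Eb; rewrite !rmorphM (sigma_k (proj1 sal)) (sigma_k (proj1 sbe)) in Es.
  have [_ _ zi0] := Hz i li; have [_ _ zj0] := Hz j lj.
  have si0 : sigma als`_i != 0 by rewrite fmorph_eq0.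
  have sj0 : sigma als`_j != 0 by rewrite fmorph_eq0.
  have sb0 : sigma b != 0 by rewrite fmorph_eq0.
  rewrite Ei Ej in Eb.
  have E2 : al = be * sigma als`_j * sigma b / sigma als`_i by rewrite -Es mulfK.
  rewrite E2 in Eb.
  have E3 : be * sigma als`_j * (zs`_i * sigma b) = be * sigma als`_j * (zs`_j * b).
    transitivity (be * sigma als`_j * sigma b / sigma als`_i * (zs`_i * sigma als`_i)); first by field.
    by rewrite Eb; ring.
  move/(mulfI (mulf_neq0 be0 sj0)): E3 => E3.
  by apply/eqP; rewrite eqr_div // E3 mulrC.
move=> J idJ [g [sg Hg]].
have g0 : g != 0.
  apply/eqP => g0; have [_ _ _ _ [x [Jx /eqP[]]]] := idJ.
  have /Hg[a [_ ->]] : ext_ideal sL J x; last by rewrite g0 mul0r.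
  by rewrite -[x]mul1r; apply: ext_gen => //; exact: ringO1.
have Jg : ext_ideal sL J g by apply/Hg; exists 1; rewrite mulr1; split=> //; exact: ringO1.
(* An ideal extended from k is stable under [sigma], so [sigma g] = g u with u of relative norm 1.
   The unit attached to J is g / [sigma g], the inverse of u, that is [sigma u]. *)
have /Hg[u [su Eu]] := ext_ideal_sigma idJ Jg.
have uu : u * sigma u = 1.
  apply: (mulfI g0); rewrite mulrA -Eu -rmorphM -Eu sigmaK ?mulr1 //.
  by case: sg.
have uu' : unitO sL (sigma u).
  by apply: (unitO_of_mul1 (ringO_sigma su) su); rewrite mulrC.
have uu2 : sigma u * sigma (sigma u) = 1 by rewrite (sigmaK (proj1 su)) mulrC.
have [i li [v uv Ev]] := Hsurj _ uu' uu2.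
have [sai ai0 Eai] := Hals i li; have [[szi sziV zi0] Ezi] := Hu _ (mem_nth 0 li).
have [sv svV v0] := uv.
move: (als`_i) (zs`_i) sai ai0 Eai szi sziV zi0 Ezi Ev (Hext i) (Hnth i li) =>
  al z sal al0 Eal szi sziV zi0 Ezi Ev Hexti Hnthi.
have sal0 : sigma al != 0 by rewrite fmorph_eq0.
have sv0 : sigma v != 0 by rewrite fmorph_eq0.
have Esg : g = sigma g * sigma u.
  have := congr1 sigma Eu; rewrite rmorphM sigmaK //; by case: sg.
pose N := (al * v) * sigma (al * v).
have rav : ringO sL (al * v) by exact: ringO_mul.
have av0 : al * v != 0 by rewrite mulf_neq0.
have sav0 : sigma (al * v) != 0 by rewrite fmorph_eq0.
have N0 : N != 0 by rewrite mulf_neq0.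
(* [g] and [al * v] have the same quotient by their conjugates, so [kap] lies in k. It need not be
   integral, but N and N [kap] = g [sigma (al * v)] are, and they serve as the multipliers of the
   equivalence. *)
pose kap := g / (al * v).
have kkap : Qgen sk kap.
  apply: fixed_k; first by apply: Qgen_div; [case: sg | case: rav].
  rewrite fmorph_div rmorphM /kap.
  apply/eqP; rewrite eqr_div ?mulf_neq0 //; apply/eqP.
  rewrite {2}Esg Ev {1}Eal; field.
  by rewrite sv0.
have rNk : ringO sk (N * kap).
  split.
    by apply: Qgen_mul => //; case: (ringO_norm rav).
  have -> : N * kap = g * sigma (al * v) by rewrite /N /kap; field; rewrite v0 al0.
  by case: (ringO_mul sg (ringO_sigma rav)).
have kap0 : kap != 0 by rewrite mulf_neq0 ?invr_eq0.
have Ekap : g = kap * (al * v) by rewrite /kap divfK.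
exists i => //; exists N, (N * kap); rewrite Hnthi; split=> //.
- exact: ringO_norm.
- by rewrite mulf_neq0.
move=> w; split.
  case=> x [Jx ->].
  have rx : ringO sk x by case: idJ => H _ _ _ _; exact: H.
  have /Hg[a [sa Ea]] : ext_ideal sL J x.
    by rewrite -[x]mul1r; apply: ext_gen => //; exact: ringO1.
  have Ey : x / kap = al * (v * a) by rewrite Ea Ekap; field.
  exists (x / kap); split; last by field.
  split; last by exists (v * a) => //; exact: ringO_mul.
  split; first by apply: Qgen_div => //; case: rx.
  by rewrite Ey; case: (ringO_mul sal (ringO_mul sv sa)).
case=> y [[ry [b sb Eb]] ->].
exists (kap * y); rewrite mulrA; split=> //.
apply: ext_ideal_contract => //; last by apply: Qgen_mul => //; case: ry.
apply/Hg; exists (v^-1 * b); split; first exact: ringO_mul.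
by rewrite Ekap Eb; field.
Qed.

End Capitulation.

(** * Units of quadratic fields *)

Lemma Qgen_real s z : (forall a, a \in s -> a \is Num.real) -> Qgen s z -> z \is Num.real.
Proof.
move=> H sz; apply/CrealP; apply: (@Qgen_aut_eq Num.conj idfun s) sz => a sa.
exact/CrealP/H.
Qed.

Lemma rat_int z : Qgen [::] z -> z \in Aint -> exists n : int, z = n%:~R.
Proof.
by case/Qgen_nil=> q -> /(Cint_rat_Aint (Crat_rat q)) /intrP.
Qed.

Lemma rat_unit z : Qgen [::] z -> z \in Aint -> z^-1 \in Aint -> z != 0 -> z = 1 \/ z = -1.
Proof.
move=> qz iz izV z0; have [n En] := rat_int qz iz.
have [m Em] := rat_int (Qgen_inv qz) izV.
have : (m * n)%:~R = 1%:~R :> algC by rewrite intrM -En -Em mulVf.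
move/intr_inj => E; rewrite En.
have [->|->] : n = 1 \/ n = -1; last by right.
  have /eqP : (`|m| * `|n| = 1)%N by rewrite -abszM E.
  by rewrite muln_eq1 => /andP[_ /eqP]; lia.
by left.
Qed.

Lemma expr_unbounded (e x : algC) : 1 < e -> x \is Num.real -> exists n, x < e ^+ n.
Proof.
move=> e1 xR.
have B n : 1 + (e - 1) *+ n <= e ^+ n.
  elim: n => [|n IH]; first by rewrite mulr0n addr0.
  rewrite exprS; apply: (@le_trans _ _ (e * (1 + (e - 1) *+ n))).
    have -> : e * (1 + (e - 1) *+ n) = 1 + (e - 1) *+ n.+1 + (e - 1) * ((e - 1) *+ n).
      by rewrite mulrSr; ring.
    rewrite lerDl mulr_ge0 ?mulrn_wge0 // subr_ge0 ltW //.
  by rewrite ler_pM2l // (lt_trans ltr01).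
have e10 : 0 < e - 1 by rewrite subr_gt0.
have nx : 0 <= `|x| / (e - 1) by rewrite divr_ge0 // ltW.
exists (Num.bound (`|x| / (e - 1))); apply: lt_le_trans (B _).
have := archi_boundP nx; rewrite ltr_pdivrMr // mulr_natl => H.
apply: le_lt_trans (real_ler_norm xR) _; apply: lt_trans H _.
by rewrite ltrDr.
Qed.

Lemma unit_power_pos m eps eta : fund_unit m eps -> unitO [:: sqrtC m%:R] eta ->
  1 <= eta -> exists n : nat, eta = eps ^+ n.
Proof.
case=> re reV e1 emin [ru ruV u0] u1.
have e0 : 0 < eps by exact: lt_trans e1.
have uR : eta \is Num.real by rewrite ger0_real // (le_trans ler01).
have ex := expr_unbounded e1 uR.
(* n + 1 is the least exponent with eta < eps^(n+1), so eta / eps^n lies in [1, eps) and minimality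
   of eps makes it 1. *)
case: (ex_minnP ex) => -[|n] ltn nmin; first by move: (le_lt_trans u1 ltn); rewrite ltxx.
exists n.
have le : eps ^+ n <= eta.
  rewrite real_leNgt ?rpredX ?(gtr0_real e0) //; by apply/negP => h; have := nmin _ h; rewrite ltnn.
have en0 : 0 < eps ^+ n by rewrite exprn_gt0.
have se : unitO [:: sqrtC m%:R] (eps ^+ n).
  have : unitO [:: sqrtC m%:R] eps by split; rewrite ?gt_eqF.
  elim: (n) => [|k IH] ue; first by rewrite expr0; split; rewrite ?invr1 ?oner_eq0 //; exact: ringO1.
  by rewrite exprS; apply: unitO_mul => //; exact: IH.
have [rw rwV w0] : unitO [:: sqrtC m%:R] (eta / eps ^+ n).
  by apply: unitO_mul => //; exact: unitO_inv.
have w1 : 1 <= eta / eps ^+ n by rewrite ler_pdivlMr // mul1r.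
move: w1; rewrite le_eqVlt => /orP[/eqP w1|w1].
  by rewrite -[LHS](divfK (lt0r_neq0 en0)) -w1 mul1r.
have := emin _ rw rwV w1; rewrite ler_pdivlMr // -exprS => h.
by move: (lt_le_trans ltn h); rewrite ltxx.
Qed.

Lemma unit_power m eps eta : fund_unit m eps -> unitO [:: sqrtC m%:R] eta ->
  exists (b : bool) (n : int), eta = (-1) ^+ b * eps ^ n.
Proof.
move=> fu uu; have uR : eta \is Num.real.
  case: uu => -[+ _] _ _; apply: Qgen_real => a; rewrite inE => /eqP->.
  by rewrite ger0_real // sqrtC_ge0 ler0n.
wlog up : eta uu uR / 0 < eta.
  move=> H; have [_ _ u0] := uu.
  have [up|lt] : 0 < eta \/ eta < 0.
    by have := u0; rewrite real_neqr_lt ?real0 // => /orP[]; auto.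
    exact: H.
  have un : unitO [:: sqrtC m%:R] (- eta).
    by case: uu => ? ? ?; split; rewrite ?invrN ?oppr_eq0 //; exact: ringO_opp.
  have nR : - eta \is Num.real by rewrite rpredN.
  have np : 0 < - eta by rewrite oppr_gt0.
  have [b [n E]] := H _ un nR np.
  exists (~~ b), n; rewrite -[LHS]opprK E -mulNr; congr (_ * _).
  by case: (b); rewrite ?expr1 ?expr0 ?opprK.
have [le|le] : 1 <= eta \/ eta <= 1.
  by apply/orP; rewrite -[_ || _]/(_ >=< _) //; exact: real_comparable.
  by have [n ->] := unit_power_pos fu uu le; exists false, n; rewrite mul1r.
have uuV := unitO_inv uu.
have leV : 1 <= eta^-1 by rewrite invf_ge1.
have [n E] := unit_power_pos fu uuV leV.
by exists false, (- n%:Z); rewrite mul1r -invr_expz -exprnP -E invrK.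
Qed.

Lemma intr_sqr (t : int) : t%:~R ^+ 2 = (`|t| ^ 2)%N%:R :> algC.
Proof.
rewrite -(rmorphXn (intr : int -> algC)) /= -[RHS]/((`|t| ^ 2)%N%:Z%:~R).
by congr intmul; lia.
Qed.

(** For a unit v the inverse is plus or minus [nu v], so (v + 1/v)^2 is T^2 or T^2 + 4, with T the
    trace of v: a natural number. It grows with v > 1, so a least unit above 1 is reached by
    induction on it. *)
Lemma fund_unit_exists m (nu : {rmorphism algC -> algC}) u :
  nu (sqrtC m%:R) = - sqrtC m%:R ->
  unitO [:: sqrtC m%:R] u -> 1 < u -> exists eps, fund_unit m eps.
Proof.
set a := sqrtC _ => na.
have a2 : Qgen [::] (a ^+ 2) by rewrite sqrtCK; exact: Qgen_nat.
have nuK z : Qgen [:: a] z -> nu (nu z) = z.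
  move=> sz; apply: (@Qgen_aut_eq (nu \o nu) idfun [:: a]) => // b; rewrite inE => /eqP->.
  by rewrite /= na rmorphN na opprK.
have nuL z : Qgen [:: a] z -> Qgen [:: a] (nu z).
  apply: Qgen_aut => b; rewrite inE => /eqP->; rewrite na; apply: Qgen_opp.
  by apply: Qgen_gen; rewrite mem_head.
have fx z : Qgen [:: a] z -> nu z = z -> Qgen [::] z.
  exact: Qgen_fixed.
have S v : unitO [:: a] v -> exists n : nat, (v + v^-1) ^+ 2 = n%:R.
  case=> -[sv iv] [svV ivV] v0.
  have nv0 : nu v != 0 by rewrite fmorph_eq0.
  have inv' : nu v \in Aint by rewrite Aint_aut.
  have [t Et] : exists t : int, v + nu v = t%:~R.
    apply: rat_int; last exact: rpredD.
    apply: fx; first by apply: Qgen_add => //; exact: nuL.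
    by rewrite rmorphD nuK // addrC.
  have [] : v * nu v = 1 \/ v * nu v = -1.
    apply: rat_unit; [|exact: rpredM| |exact: mulf_neq0].
      apply: fx; first by apply: Qgen_mul => //; exact: nuL.
      by rewrite rmorphM nuK // mulrC.
    by rewrite invfM rpredM // -fmorphV Aint_aut.
  - move=> E; have -> : v^-1 = nu v by apply: (mulfI v0); rewrite mulfV.
    by exists (`|t| ^ 2)%N; rewrite Et intr_sqr.
  move=> E; have EV : v^-1 = - nu v by apply: (mulfI v0); rewrite mulfV // mulrN E opprK.
  exists (`|t| ^ 2 + 4)%N; rewrite natrD -intr_sqr -Et EV.
  have -> : (v - nu v) ^+ 2 = (v + nu v) ^+ 2 - 4 * (v * nu v) by ring.
  by rewrite E; ring.
suff H n : forall v, unitO [:: a] v -> 1 < v -> (v + v^-1) ^+ 2 = n%:R ->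
    exists eps, fund_unit m eps.
  by move=> uu u1; have [n En] := S u uu; exact: H En.
elim/ltn_ind: n => n IH v uv v1 Ev.
have [[w [uw [w1 ltwv]]]|H] := classic (exists w, unitO [:: a] w /\ (1 < w /\ w < v)).
  have [n' En'] := S w uw; apply: (IH n' _ w) => //.
  have w0 : 0 < w by exact: lt_trans w1.
  have v0 : 0 < v by exact: lt_trans v1.
  rewrite -(ltr_nat algC) -En' -Ev ltrXn2r //.
    by rewrite ltW // addr_gt0 ?invr_gt0.
  rewrite -subr_gt0.
  have -> : v + v^-1 - (w + w^-1) = (v - w) * (v * w - 1) / (v * w).
    by field; rewrite !gt_eqF.
  rewrite divr_gt0 ?mulr_gt0 ?subr_gt0 //.
  by rewrite -[1]mulr1; apply: ltr_pM.
have [rv rvV v0] := uv; exists v; split=> // w rw rwV w1.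
have wR : w \is Num.real by rewrite gtr0_real // (lt_trans ltr01).
have vR : v \is Num.real by rewrite gtr0_real // (lt_trans ltr01).
rewrite real_leNgt //; apply/negP => lt; apply: H; exists w; split=> //.
by split=> //; rewrite gt_eqF // (lt_trans ltr01).
Qed.

Lemma rat_sqr_nat (q : rat) (m n : nat) : (0 < n)%N ->
  m%:R = ratr q ^+ 2 * n%:R :> algC -> exists k, (m * n = k ^ 2)%N.
Proof.
move=> n0 E.
have {}E : m%:R = q ^+ 2 * n%:R :> rat.
  by apply: (fmorph_inj (@ratr algC)); rewrite rmorphM rmorphXn /= !ratr_nat.
have dn0 : (denq q)%:~R != 0 :> rat by rewrite intr_eq0 denq_eq0.
have {}E : (m * `|denq q| ^ 2 = `|numq q| ^ 2 * n)%N.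
  have : (m%:Z * denq q ^+ 2)%:~R = (numq q ^+ 2 * n%:Z)%:~R :> rat.
    rewrite [LHS]intrM [RHS]intrM !(rmorphXn (intr : int -> rat)) /= -[m%:~R]/(m%:R) E -{1}[q]divq_num_den.
    by field.
  by move/intr_inj; lia.
have E2 : (m * n * `|denq q| ^ 2 = (n * `|numq q|) ^ 2)%N.
  by rewrite expnMn mulnAC E -mulnA mulnn mulnC.
have dv : (`|denq q| %| n * `|numq q|)%N.
  by rewrite -(@dvdn_pexp2r _ _ 2) // -E2 dvdn_mull.
case/dvdnP: dv => k Ek; exists k; apply/eqP.
by rewrite -(@eqn_pmul2r (`|denq q| ^ 2)) ?expn_gt0 ?absz_gt0 ?denq_eq0 // E2 Ek expnMn.
Qed.

(** Kummer theory in exponent 2: an element of a multiquadratic field with rational square is a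
    rational multiple of a product of some of the generators. *)
Lemma Qgen_mask s z : (forall a, a \in s -> Qgen [::] (a ^+ 2)) -> Qgen s z ->
  Qgen [::] (z ^+ 2) ->
  exists m (q : rat), size m = size s /\ z = ratr q * \prod_(a <- mask m s) a.
Proof.
elim: s z => [|a s IH] z H sz z2.
  by have [q Eq] := Qgen_nil sz; exists [::], q; split=> //; rewrite big_nil mulr1.
have up w : Qgen [::] w -> Qgen s w by apply: Qgen_subset.
have Hs b : b \in s -> Qgen [::] (b ^+ 2) by move=> sb; apply: H; rewrite inE sb orbT.
have a2 := H a (mem_head _ _).
have [sz'|[v sv Ev]] := Qgen_sqr (up _ a2) sz (up _ z2).
  have [m [q [Em Eq]]] := IH z Hs sz' z2.
  by exists (false :: m), q; rewrite /= Em.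
have [a0|a0] := eqVneq a 0.
  have [m [q [Em Eq]]] := IH 0 Hs (Qgen0 _) (Qgen_exp 2 (Qgen0 _)).
  by exists (false :: m), q; rewrite /= Em Ev a0 mulr0.
have v2 : Qgen [::] (v ^+ 2).
  have -> : v ^+ 2 = z ^+ 2 / a ^+ 2 by rewrite Ev; field.
  exact: Qgen_div.
have [m [q [Em Eq]]] := IH v Hs sv v2.
exists (true :: m), q; rewrite /= Em big_cons Ev Eq; split=> //.
by rewrite mulrCA mulrC.
Qed.

(** Squarefreeness of r is put in the form in which it is applied: r divides k as soon as it divides
    a power of k. *)
Lemma squarefree_part n : (0 < n)%N ->
  exists r c, [/\ n = (r * c ^ 2)%N, (0 < r)%N & forall k e, (r %| k ^ e)%N -> (r %| k)%N].
Proof.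
elim/ltn_ind: n => n IH n0.
have [[q [pq qn]]|H] := classic (exists q, prime q /\ (q ^ 2 %| n)%N).
  case/dvdnP: qn => n' En'; have q1 := prime_gt1 pq.
  have n'0 : (0 < n')%N by lia.
  have lt : (n' < n)%N by rewrite En' -[X in (X < _)%N]muln1 ltn_pmul2l // (@ltn_exp2l q 0 2).
  have [r [c [E r0 Hr]]] := IH n' lt n'0.
  by exists r, (c * q)%N; split=> //; rewrite En' E expnMn mulnA.
exists n, 1; split=> // [|k e]; first by rewrite exp1n muln1.
have [->|k0] := posnP k; first by rewrite dvdn0.
move=> nk; apply/dvdn_partP => // q; rewrite mem_primes => /and3P[pq _ qn].
have qk : (q %| k)%N.
  by have := dvdn_trans qn nk; rewrite (Euclid_dvdX _ _ pq) => /andP[].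
have -> : (n`_q = q)%N; last by [].
rewrite p_part; have : (logn q n < 2)%N.
  by rewrite ltnNge -pfactor_dvdn //; apply/negP => h; apply: H; exists q.
have : (0 < logn q n)%N by rewrite logn_gt0 mem_primes pq n0.
by case: (logn q n) => [|[|]].
Qed.

(** With t the trace of z, 4 - t^2 is m times a rational square, so |t| is at most 2. The values t =
    0 and |t| = 1 would make 4m or 3m a square, the fields Q(i) and Q(sqrt(-3)). *)
Lemma imag_quad_unit (m : nat) z : (0 < m)%N ->
  (forall k, 4 * m != k ^ 2)%N -> (forall k, 3 * m != k ^ 2)%N ->
  Qgen [:: 'i * sqrtC m%:R] z -> z \in Aint -> z * z^* = 1 -> z = 1 \/ z = -1.
Proof.
move=> m0 n4 n3 sz iz E.
pose w := 'i * sqrtC m%:R : algC.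
have w2 : w ^+ 2 = - m%:R by rewrite exprMn sqrCi sqrtCK mulN1r.
have qw2 : Qgen [::] (w ^+ 2) by rewrite w2; apply: Qgen_opp; exact: Qgen_nat.
have cw : w^* = - w.
  by rewrite rmorphM /= conjCi mulNr conj_Creal // ger0_real // sqrtC_ge0 ler0n.
have [u [v [/Qgen_nil[u' Eu] /Qgen_nil[v' Ev] Ez]]] := Qgen_quad qw2 sz.
have cz : z^* = u - v * w.
  rewrite Ez rmorphD rmorphM /= cw mulrN !conj_Creal //.
    by rewrite Ev; apply: Creal_Crat; exact: Crat_rat.
  by rewrite Eu; apply: Creal_Crat; exact: Crat_rat.
have [t Et] : exists t : int, z + z^* = t%:~R.
  apply: rat_int; last by rewrite rpredD ?Aint_aut.
  by rewrite cz Ez Eu; have := Qgen_rat [::] (u' + u'); rewrite rmorphD; congr Qgen; ring.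
have E1 : 4 - t%:~R ^+ 2 = (2 * v) ^+ 2 * m%:R.
  rewrite -Et; transitivity (4 * (z * z^*) - (z + z^*) ^+ 2); first by rewrite E mulr1.
  have -> : m%:R = - w ^+ 2 by rewrite w2 opprK.
  by rewrite cz Ez; ring.
have m0' : 0 < m%:R :> algC by rewrite ltr0n.
have vR : 0 <= (2 * v) ^+ 2 * m%:R.
  have vr : v \is Num.real by rewrite Ev; apply: Creal_Crat; exact: Crat_rat.
  by rewrite mulr_ge0 ?ler0n // -realEsqr realM ?realn.
have tb : (t ^+ 2 <= 4).
  by rewrite -(ler_int algC) rmorphXn /= -subr_ge0 E1.
have noq c : (forall k, c * m != k ^ 2)%N -> c%:R <> (2 * v) ^+ 2 * m%:R.
  move=> nc; rewrite Ev; have -> : 2 * ratr v' = ratr (2 * v') :> algC.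
    by rewrite rmorphM /= ratr_nat.
  by case/(rat_sqr_nat m0) => k Ek; move/eqP: (nc k).
have : `|t|%N \in [:: 0; 1; 2]%N.
  have : (`|t| ^ 2 <= 4)%N by lia.
  by case: (`|t|%N) => [|[|[|k]]] //; rewrite -!mulnn; lia.
rewrite !inE => /or3P[] /eqP ht.
- have t0 : t = 0 by lia.
  by case: (noq 4%N n4); rewrite -E1 t0 mulr0z expr0n subr0.
- case: (noq 3%N n3); rewrite -E1 -(rmorphXn (intr : int -> algC)) /=.
  have -> : t ^+ 2 = 1 by lia.
  by ring.
have v0 : v = 0.
  move/eqP: E1; rewrite -(rmorphXn (intr : int -> algC)) /=.
  have -> : t ^+ 2 = 4 by lia.
  rewrite subrr eq_sym mulf_eq0 (gt_eqF m0') orbF expf_eq0 mulf_eq0 pnatr_eq0 /=.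
  by move/eqP.
have Ez' : z = u by rewrite Ez v0 mul0r addr0.
have cz' : z^* = u by rewrite cz v0 mul0r subr0.
move: E; rewrite cz' Ez' -expr2 => /eqP; rewrite sqrf_eq1 => /orP[]/eqP; auto.
Qed.

(** The doubled coordinates t and r of z are integers with t^2 + r^2 = 4, so one of them is 0 and
    the other is 2 or -2. *)
Lemma gauss_unit z : Qgen [:: 'i] z -> z \in Aint -> z * z^* = 1 ->
  exists n : nat, z = 'i ^+ n.
Proof.
move=> sz iz E.
have qi2 : Qgen [::] (('i : algC) ^+ 2) by rewrite sqrCi; apply: Qgen_opp; exact: Qgen1.
have iA : ('i : algC) \in Aint.
  apply: (@Aint_unity_root 4) => //; apply/unity_rootP.
  by rewrite (exprM _ 2 2) sqrCi sqrrN expr1n.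
have [u [v [/Qgen_nil[u' Eu] /Qgen_nil[v' Ev] Ez]]] := Qgen_quad qi2 sz.
have cz : z^* = u - v * 'i.
  rewrite Ez rmorphD rmorphM /= conjCi mulrN !conj_Creal //.
    by rewrite Ev; apply: Creal_Crat; exact: Crat_rat.
  by rewrite Eu; apply: Creal_Crat; exact: Crat_rat.
have [t Et] : exists t : int, z + z^* = t%:~R.
  apply: rat_int; last by rewrite rpredD ?Aint_aut.
  by rewrite cz Ez Eu; have := Qgen_rat [::] (u' + u'); rewrite rmorphD; congr Qgen; ring.
have [r Er] : exists r : int, 'i * (z^* - z) = r%:~R.
  apply: rat_int; last by rewrite rpredM ?rpredB ?Aint_aut.
  have := Qgen_rat [::] (v' + v'); rewrite rmorphD /= -Ev; congr Qgen.
  have -> : 'i * (z^* - z) = - 'i ^+ 2 * (v + v) by rewrite cz Ez; ring.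
  by rewrite sqrCi opprK mul1r.
have u2 : 2 * u = t%:~R by rewrite -Et cz Ez; ring.
have v2 : 2 * v = r%:~R.
  rewrite -Er; have -> : 'i * (z^* - z) = - 'i ^+ 2 * (2 * v) by rewrite cz Ez; ring.
  by rewrite sqrCi opprK mul1r.
have E1 : t ^+ 2 + r ^+ 2 = 4.
  apply: (@intr_inj algC); rewrite rmorphD !rmorphXn /= -u2 -v2.
  have : u ^+ 2 - v ^+ 2 * 'i ^+ 2 = 1 by rewrite -E cz Ez; ring.
  rewrite sqrCi => H.
  have -> : (2 * u) ^+ 2 + (2 * v) ^+ 2 = 4 * (u ^+ 2 - v ^+ 2 * -1) by ring.
  by rewrite H mulr1.
have two0 : (2 : algC) != 0 by rewrite pnatr_eq0.
have z2 : 2 * z = t%:~R + r%:~R * 'i by rewrite -u2 -v2 Ez; ring.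
have : `|t|%N \in [:: 0; 1; 2]%N.
  have : (`|t| ^ 2 <= 4)%N by lia.
  by case: (`|t|%N) => [|[|[|k]]] //; rewrite -!mulnn; lia.
rewrite !inE => /or3P[] /eqP ht.
- have t0 : t = 0 by lia.
  have [] : r = 2 \/ r = -2.
    have r4 : (`|r| ^ 2 = 2 ^ 2)%N by lia.
    by move/eqP: r4; rewrite eqn_exp2r // => /eqP; lia.
  + by move=> r2; exists 1%N; apply: (mulfI two0); rewrite z2 t0 r2 add0r expr1.
  + move=> r2; exists 3%N; apply: (mulfI two0); rewrite z2 t0 r2 add0r exprS sqrCi.
    by rewrite mulrN1 mulrN -mulNr.
- exfalso; have : (`|r| ^ 2 = 3)%N by lia.
  by case: (`|r|%N) => [|[|k]] //; rewrite -mulnn; lia.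
have r0 : r = 0.
  by have : (`|t| ^ 2 = 4)%N; [rewrite ht | lia].
have [t2|t2] : t = 2 \/ t = -2 by lia.
  by exists 0; apply: (mulfI two0); rewrite z2 t2 r0 mul0r addr0 mulr1.
exists 2; apply: (mulfI two0); rewrite z2 t2 r0 mul0r addr0 sqrCi.
by rewrite mulrN1.
Qed.

Lemma Aint_nat (n : nat) : n%:R \in Aint.
Proof. exact: Aint_int n. Qed.

Lemma Aint_sqrt (x : algC) : x ^+ 2 \in Aint -> x \in Aint.
Proof.
move=> H; apply: (@root_monic_Aint (minCpoly (x ^+ 2) \Po 'X^2)).
- by rewrite rootE horner_comp hornerXn -rootE root_minCpoly.
- rewrite monicE lead_coef_comp ?size_polyXn // lead_coefXn expr1n mulr1.
  by rewrite -monicE minCpoly_monic.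
- by rewrite polyOver_comp ?rpredX ?polyOverX.
Qed.

Lemma dvdn_of_Aint (r n : nat) : (0 < r)%N -> (n%:R / r%:R : algC) \in Aint -> (r %| n)%N.
Proof.
move=> r0 H; have [k Ek] : exists k : int, n%:R / r%:R = k%:~R :> algC.
  by apply: rat_int H; apply: Qgen_div; exact: Qgen_nat.
have r0' : r%:R != 0 :> algC by rewrite pnatr_eq0 -lt0n.
have : (n%:Z)%:~R = (k * r%:Z)%:~R :> algC by rewrite intrM -Ek divfK.
move/intr_inj => E; apply/dvdnP; exists `|k|%N; lia.
Qed.

Lemma squarefree_dvd_int (r : nat) (t : int) : (0 < r)%N ->
  (forall k e, (r %| k ^ e)%N -> (r %| k)%N) ->
  (t%:~R ^+ 2 / r%:R : algC) \in Aint -> (t%:~R / r%:R : algC) \in Aint.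
Proof.
move=> r0 Hr; rewrite intr_sqr => /(dvdn_of_Aint r0) /Hr /dvdnP[k Ek].
have r0' : r%:R != 0 :> algC by rewrite pnatr_eq0 -lt0n.
have [Et|Et] : t = k%:Z * r%:Z \/ t = - (k%:Z * r%:Z) by lia.
  by rewrite Et intrM mulfK // Aint_int.
by rewrite Et mulrNz intrM mulNr mulfK // rpredN Aint_int.
Qed.

Lemma prime_mul_dvdn p m r : prime p -> (r %| p * m)%N ->
  exists2 r', (r' %| m)%N & r = r' \/ r = (p * r')%N.
Proof.
move=> pp d; have [/dvdnP[r' Er]|np] := boolP (p %| r)%N.
  exists r'; last by right; rewrite mulnC.
  by move: d; rewrite Er mulnC dvdn_pmul2l ?prime_gt0.
exists r; last by left.
by rewrite -(@Gauss_dvdr _ p) // coprime_sym prime_coprime.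
Qed.

Lemma fund_unit_unitO m eps : fund_unit m eps -> unitO [:: sqrtC m%:R] eps.
Proof.
by case=> ? ? e1 _; split=> //; rewrite gt_eqF // (lt_trans ltr01).
Qed.

Lemma unitO_expz s u (n : int) : unitO s u -> unitO s (u ^ n).
Proof.
move=> uu; have N (k : nat) : unitO s (u ^+ k).
  elim: k => [|k IH]; last by rewrite exprS; exact: unitO_mul.
  by rewrite expr0; split; rewrite ?invr1 ?oner_eq0 //; exact: ringO1.
by case: n => k; [exact: N | apply: unitO_inv; exact: N].
Qed.

Lemma unitO_sqrt s x : unitO s (x ^+ 2) -> Qgen s x -> unitO s x.
Proof.
case=> [[_ i1] [_ i2] n0] sx; split.
- by split=> //; exact: Aint_sqrt.
- by split; [exact: Qgen_inv | apply: Aint_sqrt; rewrite exprVn].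
- by move: n0; rewrite expf_eq0.
Qed.

Lemma expz_inj (e : algC) (m n : int) : 1 < e -> e ^ m = e ^ n -> m = n.
Proof.
move=> e1; have e0 : 0 < e by exact: lt_trans e1.
have e00 : e != 0 by rewrite gt_eqF.
have H (a : int) : e ^ a = 1 -> a = 0.
  have N (k : nat) : e ^+ k.+1 = 1 -> False.
    by move/eqP; rewrite gt_eqF // exprn_egt1.
  case: a => [[|k]|k] //.
    by move/N.
  by move/(congr1 GRing.inv); rewrite invr1 -[e ^ _]/((e ^+ k.+1)^-1) invrK => /N.
move=> E; apply/eqP; rewrite -subr_eq0; apply/eqP/H.
by rewrite expfzDr // E -expfzDr // subrr expr0z.
Qed.

Lemma fund_unit_not_square m eps b : fund_unit m eps -> Qgen [:: sqrtC m%:R] b ->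
  b ^+ 2 <> eps.
Proof.
move=> fu sb Eb; have ub : unitO [:: sqrtC m%:R] b.
  by apply: unitO_sqrt => //; rewrite Eb; exact: fund_unit_unitO.
have [s [n En]] := unit_power fu ub.
case: (fu) => _ _ e1 _.
have : eps ^ (n * 2) = eps ^ 1.
  by rewrite expr1z -[RHS]Eb En exprMn sqrr_sign mul1r -exprz_exp.
move/(expz_inj e1); lia.
Qed.

(** * The square class of a unit of norm one in a real quadratic field *)

Section NormOne.

Variables (m : nat) (nu : {rmorphism algC -> algC}) (eps : algC).
Hypothesis m0 : (0 < m)%N.
Hypothesis nu_m : nu (sqrtC m%:R) = - sqrtC m%:R.
Hypothesis fu : fund_unit m eps.
Hypothesis norm1 : eps * nu eps = 1.
Let a := sqrtC m%:R : algC.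

Let a2 : a ^+ 2 = m%:R. Proof. exact: sqrtCK. Qed.
Let qa2 : Qgen [::] (a ^+ 2). Proof. rewrite a2; exact: Qgen_nat. Qed.

Let nuK z : Qgen [:: a] z -> nu (nu z) = z.
Proof.
move=> sz; apply: (@Qgen_aut_eq (nu \o nu) idfun [:: a]) => // b; rewrite inE => /eqP->.
by rewrite /= nu_m rmorphN nu_m opprK.
Qed.

Let nuL z : Qgen [:: a] z -> Qgen [:: a] (nu z).
Proof.
apply: Qgen_aut => b; rewrite inE => /eqP->; rewrite nu_m; apply: Qgen_opp.
by apply: Qgen_gen; rewrite mem_head.
Qed.

Let trace_int z : Qgen [:: a] z -> z \in Aint -> exists t : int, z + nu z = t%:~R.
Proof.
move=> sz iz; apply: rat_int; last by rewrite rpredD // Aint_aut.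
apply: (@Qgen_fixed nu [::] a) => //; first by apply: Qgen_add => //; exact: nuL.
by rewrite rmorphD nuK // addrC.
Qed.

(* Since (1 + eps)^2 = (eps + nu eps + 2) eps, the number r is the squarefree
   part of the trace plus 2; the traces of b and of a b are divisible by r. *)
Lemma norm_one_sqrt : exists t : int, exists r c : nat, exists b,
  [/\ eps + nu eps = t%:~R, t + 2 = (r * c ^ 2)%N%:Z, (r %| (2 * m) ^ 2)%N,
    (forall k e, (r %| k ^ e)%N -> (r %| k)%N) & Qgen [:: a] b /\ b ^+ 2 = r%:R * eps].
Proof.
case: (fu) => -[se ie] [_ ieV] e1 _; have e0 : 0 < eps by exact: lt_trans e1.
have e00 : eps != 0 by rewrite gt_eqF.
have nue : nu eps = eps^-1 by apply: (mulfI e00); rewrite norm1 mulfV.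
have [t Et] := trace_int se ie.
have t0 : 0 < t + 2.
  by rewrite -(ltr_int algC) intrD -Et nue !addr_gt0 ?invr_gt0.
have [|r [c [Ec r0 Hr]]] := @squarefree_part `|(t + 2)%R|; first by lia.
have rc0 : r%:R * c%:R ^+ 2 = eps + eps^-1 + 2 :> algC.
  have -> : eps + eps^-1 + 2 = (t + 2)%:~R by rewrite intrD -Et nue.
  by rewrite -natrX -natrM -Ec natr_absz gtr0_norm.
have c0 : c%:R != 0 :> algC.
  by rewrite pnatr_eq0; apply/eqP => c0; rewrite c0 in Ec; lia.
have r0' : r%:R != 0 :> algC by rewrite pnatr_eq0 -lt0n.
exists t, r, c; exists ((1 + eps) / c%:R).
set b := (1 + eps) / c%:R.
have b2 : b ^+ 2 = r%:R * eps.
  have -> : r%:R = (eps + eps^-1 + 2) / c%:R ^+ 2 by rewrite -rc0 mulfK // expf_neq0.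
  by rewrite /b; field; rewrite c0 e00.
have sb : Qgen [:: a] b.
  by apply: Qgen_div; [apply: Qgen_add => //; exact: Qgen1 | exact: Qgen_nat].
clearbody b.
have ib : b \in Aint by apply: Aint_sqrt; rewrite b2 rpredM ?Aint_nat.
have nb2 : (nu b) ^+ 2 = r%:R * eps^-1 by rewrite -rmorphXn b2 rmorphM rmorph_nat /= nue.
have bnb : b * nu b = r%:R \/ b * nu b = - r%:R.
  have : (b * nu b) ^+ 2 == r%:R ^+ 2.
    by rewrite exprMn b2 nb2; apply/eqP; field.
  by rewrite eqf_sqr => /orP[]/eqP; auto.
split=> //; first by lia.
have [t1 Et1] := trace_int sb ib.
have sa : Qgen [:: a] a by apply: Qgen_gen; rewrite mem_head.
have ia : a \in Aint by apply: Aint_sqrt; rewrite a2 Aint_nat.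
have [t2 Et2] := trace_int (Qgen_mul sb sa) (rpredM ib ia).
have iV : nu eps \in Aint by rewrite Aint_aut.
have ibn : b * nu b / r%:R \in Aint.
  by case: bnb => ->; rewrite ?mulNr divff ?rpredN ?Aint1.
(* The square of the trace of b is r times an integer, because b^2 and its conjugate are r times
   units and b times its conjugate is r or -r. As r is squarefree, it divides the trace itself; the
   same holds for the trace of a b below. *)
have i1 : (t1%:~R / r%:R : algC) \in Aint.
  apply: squarefree_dvd_int => //; rewrite -Et1.
  have -> : (b + nu b) ^+ 2 / r%:R = eps + nu eps + (b * nu b) / r%:R * 2.
    have -> : (b + nu b) ^+ 2 = b ^+ 2 + (nu b) ^+ 2 + 2 * (b * nu b) by ring.
    by rewrite b2 nb2 nue; field; rewrite ?r0' ?e00.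
  apply: rpredD; first exact: rpredD.
  by apply: rpredM => //; exact: Aint_nat.
have i2 : (t2%:~R / r%:R : algC) \in Aint.
  apply: squarefree_dvd_int => //; rewrite -Et2 rmorphM nu_m.
  have -> : (b * a + nu b * - a) ^+ 2 / r%:R = m%:R * (eps + nu eps - (b * nu b) / r%:R * 2).
    have -> : (b * a + nu b * - a) ^+ 2 = a ^+ 2 * (b ^+ 2 + (nu b) ^+ 2 - 2 * (b * nu b)) by ring.
    by rewrite b2 nb2 nue a2; field; rewrite ?r0' ?e00.
  apply: rpredM; first exact: Aint_nat.
  apply: rpredB; first exact: rpredD.
  by apply: rpredM => //; exact: Aint_nat.
apply: dvdn_of_Aint => //.
(* The two traces recover b through 2 m b = m [t1] + a [t2], so 2 m b / r is integral; its square is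
   (2m)^2 eps / r. *)
have -> : ((2 * m) ^ 2)%:R / r%:R = (m%:R * (t1%:~R / r%:R) + a * (t2%:~R / r%:R)) ^+ 2 * eps^-1 :> algC.
  have -> : m%:R * (t1%:~R / r%:R) + a * (t2%:~R / r%:R) = 2 * m%:R * b / r%:R.
    rewrite -Et1 -Et2 (rmorphM nu) -/a nu_m -/a -a2; field.
    by rewrite r0'.
  rewrite natrX natrM; have -> : (2 * m%:R * b / r%:R) ^+ 2 = 4 * m%:R ^+ 2 * b ^+ 2 / r%:R ^+ 2 by field.
  by rewrite b2; field; rewrite ?r0' ?e00.
apply: rpredM => //; apply: rpredX; apply: rpredD; apply: rpredM => //.
exact: Aint_nat.
Qed.

End NormOne.

(** * Signs and their integer powers *)

Lemma sgn_sq x : x = 1 \/ x = -1 :> algC -> x * x = 1.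
Proof. by case=> ->; rewrite ?mulrNN mulr1. Qed.
Lemma sgn_aut (nu : {rmorphism algC -> algC}) x : x = 1 \/ x = -1 :> algC -> nu x = x.
Proof. by case=> ->; rewrite ?rmorphN rmorph1. Qed.
Lemma sgn_expz x (n : int) : x = 1 \/ x = -1 :> algC -> x ^ n = 1 \/ x ^ n = -1.
Proof.
case=> ->; first by left; rewrite exp1rz.
have N (m : nat) : (-1) ^+ m = 1 :> algC \/ (-1) ^+ m = -1 :> algC.
  have := esym (@signr_odd algC m).
  by case: (odd m) => E; [right | left]; exact: E.
case: n => m; first exact: N.
by rewrite NegzE -invr_expz; case: (N m.+1); rewrite -exprnP => ->; rewrite ?invrN1 ?invr1; auto.
Qed.
Lemma sgn_mul x y : x = 1 \/ x = -1 :> algC -> y = 1 \/ y = -1 :> algC ->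
  x * y = 1 \/ x * y = -1.
Proof. by case=> ->; case=> ->; rewrite ?mulrNN ?mul1r ?mulr1; auto. Qed.
Lemma sgn_bool (b : bool) : (-1) ^+ b = 1 :> algC \/ (-1) ^+ b = -1 :> algC.
Proof. by case: b; [right | left]. Qed.
Lemma sgn_pos x : x = 1 \/ x = -1 :> algC -> 0 < x -> x = 1.
Proof. by case=> // ->; rewrite oppr_gt0 ltr10. Qed.
Lemma sgn_i x : x = 1 \/ x = -1 :> algC -> exists n : nat, x = 'i ^+ n.
Proof. by case=> ->; [exists 0 | exists 2; rewrite sqrCi]. Qed.

Lemma int_parity (n : int) : exists m : int, n = m * 2 \/ n = m * 2 + 1.
Proof.
exists (n %/ 2)%Z; have := divz_eq n 2; have := modz_ge0 n (isT : 2 != 0 :> int).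
by have := ltz_pmod n (isT : 0 < 2 :> int); lia.
Qed.

Lemma sgn_even (x : algC) (n m : int) : x = 1 \/ x = -1 :> algC -> n = m * 2 -> x ^ n = 1.
Proof.
move=> sx ->; rewrite mulrC -exprz_exp -[x ^ 2]/(x * x) sgn_sq //.
by rewrite exp1rz.
Qed.
Lemma neg1_odd (n m : int) : n = m * 2 + 1 -> (-1 : algC) ^ n = -1.
Proof.
move=> ->; rewrite expfzDr ?oppr_eq0 ?oner_eq0 // expr1z (@sgn_even _ _ m) ?mul1r //.
by right.
Qed.
Lemma neg1_pos (n : int) : 0 < (-1 : algC) ^ n -> exists m : int, n = m * 2.
Proof.
have [m [E|E]] := int_parity n; first by exists m.
by rewrite (neg1_odd E) oppr_gt0 ltr10.
Qed.

Lemma conj_pos (u : algC) : u != 0 -> 0 < u * u^*. Proof. by rewrite mul_conjC_gt0. Qed.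

Lemma div_expz (x y : algC) (n : int) : (x / y) ^ n = x ^ n / y ^ n.
Proof. by rewrite expfzMl exprz_inv invr_expz. Qed.

Lemma opp_inv_expz (x : algC) (n : int) : (- x^-1) ^ n = (-1) ^ n / x ^ n.
Proof. by rewrite -div_expz mulN1r. Qed.

(** The cross term a b / r is integral because its square is the product of the two given
    integers. *)
Lemma sqr_div_Aint_add (r a b : algC) : r != 0 ->
  a ^+ 2 / r \in Aint -> b ^+ 2 / r \in Aint -> (a + b) ^+ 2 / r \in Aint.
Proof.
move=> r0 Ha Hb.
have -> : (a + b) ^+ 2 / r = a ^+ 2 / r + b ^+ 2 / r + 2 * (a * b / r) by field.
apply: rpredD; first exact: rpredD.
apply: rpredM; first exact: Aint_nat.
apply: Aint_sqrt; have -> : (a * b / r) ^+ 2 = (a ^+ 2 / r) * (b ^+ 2 / r) by field.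
exact: rpredM.
Qed.

Lemma sqr_div_Aint_mul (r a b : algC) :
  a \in Aint -> b ^+ 2 / r \in Aint -> (a * b) ^+ 2 / r \in Aint.
Proof. by move=> ia Hb; rewrite exprMn -mulrA rpredM // rpredX. Qed.

(** A solution of s^2 + 1 = p t^2 yields the unit s + t sqrt p of norm -1. Being a power of eps up
    to sign, it would have norm 1 if eps had. *)
Lemma fund_unit_norm_neg1 p (nu : {rmorphism algC -> algC}) : prime p -> (p %% 4 = 1)%N ->
  nu (sqrtC p%:R) = - sqrtC p%:R ->
  exists2 eps, fund_unit p eps & eps * nu eps = -1.
Proof.
move=> pp p4; set a := sqrtC _ => na.
have [s [t Est]] := negative_pell pp p4.
have a2 : a ^+ 2 = p%:R by exact: sqrtCK.
have qa2 : Qgen [::] (a ^+ 2) by rewrite a2; exact: Qgen_nat.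
have Qa : Qgen [:: a] a by apply: Qgen_gen; rewrite mem_head.
have ia : a \in Aint by apply: Aint_sqrt; rewrite a2; exact: Aint_nat.
have ra : ringO [:: a] a by [].
have rn n : ringO [:: a] n%:R by split; [exact: Qgen_nat | exact: Aint_nat].
have Estc : p%:R * t%:R ^+ 2 = s%:R ^+ 2 + 1 :> algC.
  by rewrite -!natrX -natrM -Est natrD.
pose u : algC := s%:R + t%:R * a.
have uu : unitO [:: a] u.
  apply: (@unitO_of_mul1 _ _ (- s%:R + t%:R * a)).
  - by apply: ringO_add => //; exact: ringO_mul.
  - by apply: ringO_add; [exact: ringO_opp | exact: ringO_mul].
  - have -> : u * (- s%:R + t%:R * a) = a ^+ 2 * t%:R ^+ 2 - s%:R ^+ 2 by rewrite /u; ring.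
    by rewrite a2 Estc; ring.
have a1 : 1 < a.
  have a0 : 0 <= a by rewrite sqrtC_ge0 ler0n.
  by rewrite -(@ltr_pXn2r _ 2) ?nnegrE // expr1n a2 ltr1n prime_gt1.
have t1 : (0 < t)%N by case: t Est {Estc u uu} => // ; rewrite exp0n // muln0 addn1.
have u1 : 1 < u.
  apply: lt_le_trans a1 _; rewrite -[leLHS]add0r lerD ?ler0n //.
  by rewrite ler_peMl ?ler1n // sqrtC_ge0 ler0n.
have [eps fu] := fund_unit_exists na uu u1; exists eps => //.
have [[Qe ie] [QeV ieV] e0] := fund_unit_unitO fu.
have nuK z : Qgen [:: a] z -> nu (nu z) = z.
  move=> sz; apply: (@Qgen_aut_eq (nu \o nu) idfun [:: a]) => // b; rewrite inE => /eqP->.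
  by rewrite /= na rmorphN na opprK.
have nuL z : Qgen [:: a] z -> Qgen [:: a] (nu z).
  by apply: Qgen_aut => b; rewrite inE => /eqP->; rewrite na; exact: Qgen_opp.
have [N|//] : eps * nu eps = 1 \/ eps * nu eps = -1.
  apply: rat_unit.
  - apply: (@Qgen_fixed nu [::] a) => //; first by apply: Qgen_mul => //; exact: nuL.
    by rewrite rmorphM nuK // mulrC.
  - by rewrite rpredM // Aint_aut.
  - by rewrite invfM rpredM // -fmorphV Aint_aut.
  - by rewrite mulf_neq0 // fmorph_eq0.
have [b [n En]] := unit_power fu uu.
have Nu : u * nu u = -1.
  rewrite /u rmorphD rmorphM !rmorph_nat na.
  have -> : (s%:R + t%:R * a) * (s%:R + t%:R * - a) = s%:R ^+ 2 - a ^+ 2 * t%:R ^+ 2 by ring.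
  by rewrite a2 Estc; ring.
have : u * nu u = 1.
  rewrite En rmorphM rmorph_sign fmorphXz mulrACA -expfzMl N exp1rz mulr1.
  by apply: sgn_sq; exact: sgn_bool.
rewrite Nu => /eqP; rewrite eq_sym -subr_eq0 opprK -[X in X == 0]/(2%:R : algC) pnatr_eq0.
by [].
Qed.

Lemma qnorm_aut m (nu : {rmorphism algC -> algC}) eps v :
  nu (sqrtC m%:R) = - sqrtC m%:R -> qnorm_is m eps v -> eps * nu eps = ratr v.
Proof.
move=> nm [a [b [-> <-]]]; rewrite (rmorphD nu) (fmorph_rat nu) (rmorphM nu (ratr b)) (fmorph_rat nu) nm.
have -> : ratr (a ^+ 2 - m%:R * b ^+ 2) = ratr a ^+ 2 - sqrtC m%:R ^+ 2 * ratr b ^+ 2 :> algC.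
  by rewrite rmorphB [X in _ - X]rmorphM !rmorphXn /= ratr_nat sqrtCK.
by ring.
Qed.

(** * The field Q(sqrt p1, sqrt (2 p2), i) *)

Lemma sqr_odd_logn (n k q : nat) : (n = k ^ 2)%N -> ~~ odd (logn q n).
Proof. by move->; rewrite lognX oddM. Qed.

(** By [Qgen_mask], n is a rational square times some of a, b and -1; the factor -1 coming from i is
    excluded by n > 0. *)
Lemma sqrt_in_field (a b n : nat) z : (0 < a)%N -> (0 < b)%N -> (0 < n)%N ->
  Qgen [:: sqrtC a%:R; sqrtC b%:R; 'i] z -> z ^+ 2 = n%:R ->
  exists b1 b2 : bool, exists k, (n * (a ^ b1 * b ^ b2) = k ^ 2)%N.
Proof.
move=> a0 b0 n0 sz Ez.
have [|| m [q [Em Eq]]] := @Qgen_mask [:: sqrtC a%:R; sqrtC b%:R; 'i] z _ sz.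
- move=> c; rewrite !inE => /or3P[]/eqP->; rewrite ?sqrtCK ?sqrCi; try exact: Qgen_nat.
  by apply: Qgen_opp; exact: Qgen1.
- by rewrite Ez; exact: Qgen_nat.
case: m Em Eq => [|b1 [|b2 [|b3 [|? ?]]]] // _ Eq.
have E2 : n%:R = ratr q ^+ 2 * (a ^ b1 * b ^ b2)%N%:R * (-1) ^+ b3 :> algC.
  rewrite -Ez Eq; case: b1 Eq => Eq; case: b2 Eq => Eq; case: b3 Eq => Eq;
  rewrite /= ?big_cons ?big_nil ?exprMn ?sqrtCK ?sqrCi ?expr0 ?expr1 ?natrM ?expn0 ?expn1; ring.
have ab : (0 < a ^ b1 * b ^ b2)%N by rewrite muln_gt0 !expn_gt0 a0 b0.
have {E2} : n%:R = ratr q ^+ 2 * (a ^ b1 * b ^ b2)%N%:R :> algC.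
  case: b3 E2 {Eq} => // E2; last by rewrite [LHS]E2 expr0 mulr1.
  have : 0 < n%:R :> algC by rewrite ltr0n.
  rewrite E2 expr1 mulrN1 oppr_gt0 => /(le_lt_trans _) H.
  have : (0 : algC) < 0; last by rewrite ltxx.
  apply: H; rewrite mulr_ge0 ?ler0n // -realEsqr.
  by apply: Creal_Crat; exact: Crat_rat.
by case/(rat_sqr_nat ab) => k Ek; exists b1, b2, k.
Qed.

Lemma Qgen_fixed_sub (nu : {rmorphism algC -> algC}) s t a z :
  (forall b, b \in t -> Qgen (a :: s) b) -> Qgen s (a ^+ 2) ->
  (forall b, b \in s -> nu b = b) -> nu a = - a -> Qgen t z -> nu z = z -> Qgen s z.
Proof.
by move=> H sa fs na tz; apply: (Qgen_fixed sa fs na); exact: Qgen_trans tz.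
Qed.

Section Field.

Variables p1 p2 : nat.
Hypotheses (pr1 : prime p1) (pr2 : prime p2) (neq12 : p1 != p2).
Hypotheses (p1mod4 : (p1 %% 4 = 1)%N) (p2mod4 : (p2 %% 4 = 1)%N).

Let A : algC := sqrtC p1%:R.
Let B : algC := sqrtC (2 * p2)%:R.
Let D : algC := sqrtC (2 * p1 * p2)%:R.
Let k : seq algC := [:: D; 'i].
Let L : seq algC := [:: D; 'i; A].

Let p1_gt0 : (0 < p1)%N. Proof. exact: prime_gt0. Qed.
Let p2_gt0 : (0 < p2)%N. Proof. exact: prime_gt0. Qed.
Let p1n2 : p1 != 2%N. Proof. by apply/eqP; lia. Qed.
Let p2n2 : p2 != 2%N. Proof. by apply/eqP; lia. Qed.

Let lognE q (e f g : nat) : prime q ->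
  logn q (2 ^ e * (p1 ^ f * p2 ^ g)) = ((q == 2) * e + ((q == p1) * f + (q == p2) * g))%N.
Proof.
move=> pq; rewrite !lognM ?muln_gt0 ?expn_gt0 ?p1_gt0 ?p2_gt0 //.
by rewrite !lognX !logn_prime // !(mulnC _ (nat_of_bool _)).
Qed.

Lemma sqr_exponents_even (e f g n : nat) : (2 ^ e * (p1 ^ f * p2 ^ g) = n ^ 2)%N ->
  [/\ ~~ odd e, ~~ odd f & ~~ odd g].
Proof.
move=> E; have H q := sqr_odd_logn q E.
have := H 2; have := H p1; have := H p2; rewrite !lognE //.
have [/negbTE e1 /negbTE e2] : (2%N != p1) /\ (2%N != p2) by split; rewrite eq_sym.
have /negbTE e3 : p2 != p1 by rewrite eq_sym.
rewrite e1 e2 e3 (negbTE p1n2) (negbTE p2n2) (negbTE neq12) !eqxx.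
by rewrite !mul0n !mul1n ?add0n ?addn0; split.
Qed.

Let A_gt0 : 0 < A. Proof. by rewrite sqrtC_gt0 ltr0n. Qed.
Let B_gt0 : 0 < B. Proof. by rewrite sqrtC_gt0 ltr0n muln_gt0. Qed.
Let D_gt0 : 0 < D. Proof. by rewrite sqrtC_gt0 ltr0n !muln_gt0 p1_gt0. Qed.
Let A0 : A != 0. Proof. by rewrite gt_eqF. Qed.
Let B0 : B != 0. Proof. by rewrite gt_eqF. Qed.
Let D0 : D != 0. Proof. by rewrite gt_eqF. Qed.
Let i0 : ('i : algC) != 0. Proof. exact: neq0Ci. Qed.
Let A2 : A ^+ 2 = p1%:R. Proof. exact: sqrtCK. Qed.
Let B2 : B ^+ 2 = (2 * p2)%:R. Proof. exact: sqrtCK. Qed.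
Let D2 : D ^+ 2 = (2 * p1 * p2)%:R. Proof. exact: sqrtCK. Qed.
Let DAB : D = A * B.
Proof.
by rewrite /D /A /B -sqrtCM ?nnegrE ?ler0n // -natrM mulnCA mulnA.
Qed.

Let LD : Qgen L D. Proof. by apply: Qgen_gen; rewrite !inE eqxx. Qed.
Let Li : Qgen L 'i. Proof. by apply: Qgen_gen; rewrite !inE eqxx orbT. Qed.
Let LA : Qgen L A. Proof. by apply: Qgen_gen; rewrite !inE eqxx !orbT. Qed.
Let LB : Qgen L B.
Proof. have -> : B = D / A by rewrite DAB mulrC mulKf. exact: Qgen_div. Qed.

Lemma field_basis z : Qgen L z -> Qgen [:: A; B; 'i] z.
Proof.
apply: Qgen_trans => a; rewrite !inE => /or3P[]/eqP->.
- by rewrite DAB; apply: Qgen_mul; apply: Qgen_gen; rewrite !inE eqxx ?orbT.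
- by apply: Qgen_gen; rewrite !inE eqxx ?orbT.
- by apply: Qgen_gen; rewrite !inE eqxx ?orbT.
Qed.

(** Otherwise 2 p1^b1 (2 p2)^b2 would be a square: the exponent of 2 needs b2 = 1 and that of p2
    needs b2 = 0. This excludes a square root of i from L, and a common square class of e2 and 2
    e2. *)
Lemma sqrt2_notin_L z : Qgen L z -> z ^+ 2 <> 2.
Proof.
move=> /field_basis sz Ez.
have d0 : (0 < 2 * p2)%N by rewrite muln_gt0.
have [b1 [b2 [n En]]] := sqrt_in_field p1_gt0 d0 (isT : (0 < 2)%N) sz Ez.
have : (2 ^ (1 + b2) * (p1 ^ b1 * p2 ^ b2) = n ^ 2)%N.
  by rewrite -En expnD expn1 expnMn -mulnA; congr muln; rewrite mulnCA.
by case/sqr_exponents_even; case: b2 {En}.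
Qed.

Lemma sqrt_p1_notin_k : ~ Qgen k A.
Proof.
move=> kA; have d0 : (0 < 2 * p1 * p2)%N by rewrite !muln_gt0 p1_gt0.
(* The generator is repeated because [sqrt_in_field] expects two radicands. *)
have sz : Qgen [:: D; D; 'i] A.
  by apply: Qgen_subset kA => z; rewrite !inE => /orP[]->; rewrite ?orbT.
have [b1 [b2 [n En]]] := sqrt_in_field d0 d0 p1_gt0 sz A2.
have : (2 ^ (b1 + b2) * (p1 ^ (1 + (b1 + b2)) * p2 ^ (b1 + b2)) = n ^ 2)%N.
  by rewrite -En -expnD !expnMn (expnD p1 1) expn1 -!mulnA [RHS]mulnCA.
by case/sqr_exponents_even; case: b1 {En}; case: b2.
Qed.

Lemma sqrt_2p2_notin : ~ Qgen [:: A; 'i] B.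
Proof.
move=> kA; have d0 : (0 < 2 * p2)%N by rewrite !muln_gt0.
have sz : Qgen [:: A; A; 'i] B.
  by apply: Qgen_subset kA => z; rewrite !inE => /orP[]->; rewrite ?orbT.
have [b1 [b2 [n En]]] := sqrt_in_field p1_gt0 p1_gt0 d0 sz B2.
have : (2 ^ 1 * (p1 ^ (b1 + b2) * p2 ^ 1) = n ^ 2)%N.
  by rewrite -En expnD !expn1 -[RHS]mulnA; congr muln; exact: mulnC.
by case/sqr_exponents_even.
Qed.

Lemma field_automorphisms : exists sg rh : {rmorphism algC -> algC},
  [/\ sg A = - A, sg D = D & sg 'i = 'i] /\ [/\ rh A = A, rh B = - B & rh 'i = 'i].
Proof.
have [|sg [fs sA]] := @sqrt_aut k A _ sqrt_p1_notin_k; first by rewrite A2; exact: Qgen_nat.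
have [|rh [fr rB]] := @sqrt_aut [:: A; 'i] B _ sqrt_2p2_notin; first by rewrite B2; exact: Qgen_nat.
exists sg, rh; split; split=> //; rewrite ?fs ?fr //; apply: Qgen_gen;
  by rewrite !inE eqxx ?orbT.
Qed.

(* sg generates Gal(L/k); together with rh and complex conjugation it generates
   Gal(L/Q). *)
Variables sg rh : {rmorphism algC -> algC}.
Hypotheses (sgA : sg A = - A) (sgD : sg D = D) (sgi : sg 'i = 'i).
Hypotheses (rhA : rh A = A) (rhB : rh B = - B) (rhi : rh 'i = 'i).

Let sgB : sg B = - B.
Proof.
apply: (mulfI A0); rewrite -[in LHS](opprK A) mulNr -[in LHS]sgA -rmorphM -DAB sgD DAB.
by rewrite mulrN.
Qed.
Let rhD : rh D = - D.
Proof. by rewrite DAB rmorphM rhA rhB mulrN. Qed.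
Let conjA : A^* = A. Proof. by rewrite conj_Creal // gtr0_real. Qed.
Let conjB : B^* = B. Proof. by rewrite conj_Creal // gtr0_real. Qed.
Let conjD : D^* = D. Proof. by rewrite conj_Creal // gtr0_real. Qed.

Let L_ind (P : algC -> Prop) : P D -> P 'i -> P A -> forall a, a \in L -> P a.
Proof. by move=> ? ? ? a; rewrite !inE => /or3P[]/eqP->. Qed.

Let sgL z : Qgen L z -> Qgen L (sg z).
Proof.
apply: Qgen_aut; apply: L_ind; rewrite ?sgD ?sgi ?sgA //; exact: Qgen_opp.
Qed.
Let rhL z : Qgen L z -> Qgen L (rh z).
Proof.
apply: Qgen_aut; apply: L_ind; rewrite ?rhD ?rhi ?rhA //; exact: Qgen_opp.
Qed.
Let conjL z : Qgen L z -> Qgen L z^*.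
Proof.
apply: (@Qgen_aut Num.conj); apply: L_ind; rewrite /= ?conjD ?conjCi ?conjA //; exact: Qgen_opp.
Qed.
Let sgK z : Qgen L z -> sg (sg z) = z.
Proof.
apply: (@Qgen_aut_eq (sg \o sg) idfun L).
by apply: L_ind; rewrite /= ?sgD ?sgi ?sgA ?rmorphN ?sgA ?opprK.
Qed.
Let rhK z : Qgen L z -> rh (rh z) = z.
Proof.
apply: (@Qgen_aut_eq (rh \o rh) idfun L).
by apply: L_ind; rewrite /= ?rhD ?rhi ?rhA ?rmorphN ?rhD ?rhA ?opprK.
Qed.
Let rhsg z : Qgen L z -> rh (sg z) = sg (rh z).
Proof.
apply: (@Qgen_aut_eq (rh \o sg) (sg \o rh) L).
by apply: L_ind; rewrite /= ?sgD ?rhD ?rhi ?sgi ?rhA ?sgA ?rmorphN ?rhD ?rhA ?sgD ?sgA ?rhi.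
Qed.
Let sgconj z : Qgen L z -> sg z^* = (sg z)^*.
Proof.
apply: (@Qgen_aut_eq (sg \o Num.conj) (Num.conj \o sg) L).
by apply: L_ind; rewrite /= ?conjD ?conjA ?conjCi ?sgD ?sgA ?sgi ?rmorphN /= ?conjD ?conjA ?sgA ?sgi ?conjCi.
Qed.
Let rhconj z : Qgen L z -> rh z^* = (rh z)^*.
Proof.
apply: (@Qgen_aut_eq (rh \o Num.conj) (Num.conj \o rh) L).
by apply: L_ind; rewrite /= ?conjD ?conjA ?conjCi ?rhD ?rhA ?rhi ?rmorphN /= ?conjD ?conjA ?rhA ?rhi ?conjCi.
Qed.

Let kL z : Qgen k z -> Qgen L z.
Proof. by apply: Qgen_subset => a; rewrite !inE => /orP[]->; rewrite ?orbT. Qed.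

Let sgk z : Qgen k z -> sg z = z.
Proof.
apply: (@Qgen_aut_eq sg idfun k) => a; rewrite !inE => /orP[]/eqP->; rewrite /= ?sgD ?sgi //.
Qed.

Let fixk z : Qgen L z -> sg z = z -> Qgen k z.
Proof.
apply: (@Qgen_fixed_sub sg k L A) => //.
- by move=> a aL; apply: Qgen_gen; move: aL; rewrite !inE => /or3P[]->; rewrite ?orbT.
- by rewrite A2; exact: Qgen_nat.
- by move=> b; rewrite !inE => /orP[]/eqP->.
Qed.

Let gen2 s (a b : algC) : Qgen (a :: b :: s) a /\ Qgen (a :: b :: s) b.
Proof. by split; apply: Qgen_gen; rewrite !inE eqxx ?orbT. Qed.

Let gen_div_i a : Qgen [:: 'i; 'i * a] a.
Proof.
have [si sa] := gen2 [::] 'i ('i * a).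
by have := Qgen_div sa si; rewrite [X in Qgen _ X]mulrC mulKf.
Qed.

(** This and the following facts identify the fixed fields of subgroups of Gal(L/Q) and Gal(k/Q),
    peeling off one square root for each automorphism. *)
Let fix_real z : Qgen L z -> z^* = z -> Qgen [:: A; B] z.
Proof.
apply: (@Qgen_fixed_sub Num.conj [:: A; B] L 'i) => //.
- apply: L_ind; try by apply: Qgen_gen; rewrite !inE eqxx ?orbT.
  by rewrite DAB; apply: Qgen_mul; apply: Qgen_gen; rewrite !inE eqxx ?orbT.
- by rewrite sqrCi; apply: Qgen_opp; exact: Qgen1.
- by move=> b; rewrite !inE => /orP[]/eqP->.
- by rewrite /= conjCi.
Qed.

Let fix_QA z : Qgen L z -> z^* = z -> rh z = z -> Qgen [:: A] z.
Proof.
move=> sz cz; have := fix_real sz cz.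
apply: (@Qgen_fixed_sub rh [:: A] [:: A; B] B) => //.
- by move=> b; rewrite !inE => /orP[]/eqP->; apply: Qgen_gen; rewrite !inE eqxx ?orbT.
- by rewrite B2; exact: Qgen_nat.
- by move=> b; rewrite !inE => /eqP->.
Qed.

Let fix_QB z : Qgen L z -> z^* = z -> sg (rh z) = z -> Qgen [:: B] z.
Proof.
move=> sz cz; have := fix_real sz cz.
apply: (@Qgen_fixed_sub (sg \o rh) [:: B] [:: A; B] A) => //.
- by move=> b; rewrite !inE => /orP[]/eqP->; apply: Qgen_gen; rewrite !inE eqxx ?orbT.
- by rewrite A2; exact: Qgen_nat.
- by move=> b; rewrite !inE => /eqP->; rewrite /= rhB rmorphN sgB opprK.
- by rewrite /= rhA sgA.
Qed.

Let fix_QD z : Qgen L z -> z^* = z -> sg z = z -> Qgen [:: D] z.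
Proof.
move=> sz cz; have := fix_real sz cz.
apply: (@Qgen_fixed_sub sg [:: D] [:: A; B] A) => //.
- move=> b; rewrite !inE => /orP[]/eqP->; first by apply: Qgen_gen; rewrite !inE eqxx ?orbT.
  have -> : B = D / A by rewrite DAB mulrC mulKf.
  by apply: Qgen_div; apply: Qgen_gen; rewrite !inE eqxx ?orbT.
- by rewrite A2; exact: Qgen_nat.
- by move=> b; rewrite !inE => /eqP->.
Qed.

Let fix_iA z : Qgen L z -> rh z = z -> (sg z)^* = z -> Qgen [:: 'i * A] z.
Proof.
move=> sz rz cz.
have : Qgen [:: A; 'i] z.
  apply: (@Qgen_fixed_sub rh [:: A; 'i] [:: A; B; 'i] B) => //; last exact: field_basis.
  - by move=> b; rewrite !inE => /or3P[]/eqP->; apply: Qgen_gen; rewrite !inE eqxx ?orbT.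
  - by rewrite B2; exact: Qgen_nat.
  - by move=> b; rewrite !inE => /orP[]/eqP->.
move=> sz'; apply: (@Qgen_fixed_sub (Num.conj \o sg) [:: 'i * A] [:: A; 'i] 'i) sz' cz.
- move=> b; rewrite !inE => /orP[]/eqP->; last by case: (gen2 [::] 'i ('i * A)).
  exact: gen_div_i.
- by rewrite sqrCi; apply: Qgen_opp; exact: Qgen1.
- by move=> b; rewrite !inE => /eqP->; rewrite /= rmorphM sgi sgA rmorphM /= conjCi rmorphN /= conjA mulrNN.
- by rewrite /= sgi conjCi.
Qed.

Let fix_iB z : Qgen L z -> sg (rh z) = z -> (sg z)^* = z -> Qgen [:: 'i * B] z.
Proof.
move=> sz rz cz.
have : Qgen [:: B; 'i] z.
  apply: (@Qgen_fixed_sub (sg \o rh) [:: B; 'i] [:: A; B; 'i] A) => //; last exact: field_basis.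
  - by move=> b; rewrite !inE => /or3P[]/eqP->; apply: Qgen_gen; rewrite !inE eqxx ?orbT.
  - by rewrite A2; exact: Qgen_nat.
  - by move=> b; rewrite !inE => /orP[]/eqP->; rewrite /= ?rhi ?rhB ?rmorphN ?sgB ?opprK.
  - by rewrite /= rhA sgA.
move=> sz'; apply: (@Qgen_fixed_sub (Num.conj \o sg) [:: 'i * B] [:: B; 'i] 'i) sz' cz.
- move=> b; rewrite !inE => /orP[]/eqP->; last by case: (gen2 [::] 'i ('i * B)).
  exact: gen_div_i.
- by rewrite sqrCi; apply: Qgen_opp; exact: Qgen1.
- by move=> b; rewrite !inE => /eqP->; rewrite /= rmorphM sgi sgB rmorphM /= conjCi rmorphN /= conjB mulrNN.
- by rewrite /= sgi conjCi.
Qed.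

Let fix_Qi z : Qgen k z -> rh z = z -> Qgen [:: 'i] z.
Proof.
apply: (@Qgen_fixed_sub rh [:: 'i] k D) => //.
- by move=> b; rewrite !inE => /orP[]/eqP->; apply: Qgen_gen; rewrite !inE eqxx ?orbT.
- by rewrite D2; exact: Qgen_nat.
- by move=> b; rewrite !inE => /eqP->.
Qed.

Let fix_iD z : Qgen k z -> rh z^* = z -> Qgen [:: 'i * D] z.
Proof.
move=> sz cz; apply: (@Qgen_fixed_sub (rh \o Num.conj) [:: 'i * D] k 'i) sz cz.
- move=> b; rewrite !inE => /orP[]/eqP->; last by case: (gen2 [::] 'i ('i * D)).
  exact: gen_div_i.
- by rewrite sqrCi; apply: Qgen_opp; exact: Qgen1.
- by move=> b; rewrite !inE => /eqP->; rewrite /= rmorphM /= conjCi conjD rmorphM rmorphN rhi rhD mulrNN.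
- by rewrite /= conjCi rmorphN rhi.
Qed.

(** * Units of relative norm one *)

Variables e1 e2 e3 n2 n3 : algC.
Hypotheses (fu1 : fund_unit p1 e1) (fu2 : fund_unit (2 * p2) e2).
Hypothesis fu3 : fund_unit (2 * p1 * p2) e3.
Hypothesis norm_e1 : e1 * sg e1 = -1.
Hypotheses (norm_e2 : e2 * rh e2 = n2) (norm_e3 : e3 * rh e3 = n3).
Hypotheses (sgn_n2 : n2 = 1 \/ n2 = -1) (sgn_n3 : n3 = 1 \/ n3 = -1).

Let U := unitO L.

Let e1_gt1 : 1 < e1. Proof. by case: fu1. Qed.
Let e2_gt1 : 1 < e2. Proof. by case: fu2. Qed.
Let e3_gt1 : 1 < e3. Proof. by case: fu3. Qed.
Let e1_gt0 : 0 < e1. Proof. exact: lt_trans e1_gt1. Qed.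
Let e2_gt0 : 0 < e2. Proof. exact: lt_trans e2_gt1. Qed.
Let e3_gt0 : 0 < e3. Proof. exact: lt_trans e3_gt1. Qed.
Let e10 : e1 != 0. Proof. by rewrite gt_eqF. Qed.
Let e20 : e2 != 0. Proof. by rewrite gt_eqF. Qed.
Let e30 : e3 != 0. Proof. by rewrite gt_eqF. Qed.

Let Q1 : Qgen [:: A] e1. Proof. by case: fu1 => -[]. Qed.
Let Q2 : Qgen [:: B] e2. Proof. by case: fu2 => -[]. Qed.
Let Q3 : Qgen [:: D] e3. Proof. by case: fu3 => -[]. Qed.

Let QAL z : Qgen [:: A] z -> Qgen L z.
Proof. by apply: Qgen_trans => a; rewrite inE => /eqP->. Qed.
Let QBL z : Qgen [:: B] z -> Qgen L z.
Proof. by apply: Qgen_trans => a; rewrite inE => /eqP->. Qed.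
Let QDL z : Qgen [:: D] z -> Qgen L z.
Proof. by apply: Qgen_trans => a; rewrite inE => /eqP->. Qed.

Let QD_sg z : Qgen [:: D] z -> sg z = z.
Proof. by apply: (@Qgen_aut_eq sg idfun) => a; rewrite inE => /eqP->. Qed.
Let QA_rh z : Qgen [:: A] z -> rh z = z.
Proof. by apply: (@Qgen_aut_eq rh idfun) => a; rewrite inE => /eqP->. Qed.
Let QB_sgrh z : Qgen [:: B] z -> sg (rh z) = z.
Proof.
apply: (@Qgen_aut_eq (sg \o rh) idfun) => a; rewrite inE => /eqP->.
by rewrite /= rhB rmorphN sgB opprK.
Qed.

Let unit_sub s z : U z -> Qgen s z -> unitO s z.
Proof. by case=> -[_ i1] [_ i2] z0 sz; split=> //; split=> //; exact: Qgen_inv. Qed.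
Let unit_up s z : unitO s z -> (forall y, Qgen s y -> Qgen L y) -> U z.
Proof. by case=> -[s1 i1] [s2 i2] z0 H; split=> //; split; auto. Qed.

Let U1 : U e1. Proof. exact: unit_up (fund_unit_unitO fu1) QAL. Qed.
Let U2 : U e2. Proof. exact: unit_up (fund_unit_unitO fu2) QBL. Qed.
Let U3 : U e3. Proof. exact: unit_up (fund_unit_unitO fu3) QDL. Qed.
Let Ui : U 'i.
Proof.
apply: unitO_sqrt Li; rewrite sqrCi; split; rewrite ?invrN1 ?oppr_eq0 ?oner_eq0 //;
  exact: ringO_opp (ringO1 _).
Qed.
Let UL u : U u -> Qgen L u. Proof. by case=> -[]. Qed.
Let Un0 u : U u -> u != 0. Proof. by case. Qed.
Let U_aut (nu : {rmorphism algC -> algC}) u :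
  (forall z, Qgen L z -> Qgen L (nu z)) -> U u -> U (nu u).
Proof.
move=> H [[s1 i1] [s2 i2] u0]; split; rewrite ?fmorph_eq0 //.
  by split; [exact: H | rewrite Aint_aut].
by rewrite -fmorphV; split; [exact: H | rewrite Aint_aut].
Qed.
Let Usg u : U u -> U (sg u). Proof. exact: U_aut. Qed.
Let Urh u : U u -> U (rh u). Proof. exact: U_aut. Qed.
Let Uconj u : U u -> U u^*. Proof. exact: (@U_aut Num.conj). Qed.

Let Umul u v : U u -> U v -> U (u * v). Proof. exact: unitO_mul. Qed.
Let Uinv u : U u -> U u^-1. Proof. exact: unitO_inv. Qed.
Let Udiv u v : U u -> U v -> U (u / v). Proof. by move=> ? ?; apply: Umul => //; exact: Uinv. Qed.
Let Uexpz u (n : int) : U u -> U (u ^ n). Proof. exact: unitO_expz. Qed.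

Let conj1 : e1^* = e1. Proof. by rewrite conj_Creal // gtr0_real. Qed.
Let conj2 : e2^* = e2. Proof. by rewrite conj_Creal // gtr0_real. Qed.
Let sg1 : sg e1 = - e1^-1.
Proof. by apply: (mulfI e10); rewrite norm_e1 mulrN mulfV. Qed.
Let rh1 : rh e1 = e1. Proof. exact: QA_rh. Qed.
Let rh2 : rh e2 = n2 / e2.
Proof. by apply: (mulfI e20); rewrite norm_e2 mulrCA mulfV // mulr1. Qed.
Let sg2 : sg e2 = n2 / e2.
Proof.
rewrite -rh2; have := congr1 sg (QB_sgrh Q2).
by rewrite (sgK (rhL (QBL Q2))) => <-.
Qed.
Let sg3 : sg e3 = e3. Proof. exact: QD_sg. Qed.
Let rh3 : rh e3 = n3 / e3.
Proof. by apply: (mulfI e30); rewrite norm_e3 mulrCA mulfV // mulr1. Qed.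

(* w^2 = +- N(w) / rh (N'(w)), with N and N' the norms to Q(A) and Q(B), so w^2 is
   +- e1^b e2^c; positivity of its conjugates makes the exponents even. *)
Lemma real_norm_unit w : U w -> w^* = w -> (w * sg w = 1 \/ w * sg w = -1) ->
  (n2 = 1 -> exists2 b, Qgen L b & b ^+ 2 = 2 * e2) ->
  exists (s : bool) (b c : int), w = (-1) ^+ s * e1 ^ b * e2 ^ c.
Proof.
move=> Uw cw Nw Hn2; have Lw := UL Uw; have w0 := Un0 Uw.
have Lrw := rhL Lw; have Lsw := sgL Lw; have Lsrw := sgL Lrw.
have crw : (rh w)^* = rh w by rewrite -rhconj // cw.
have csrw : (sg (rh w))^* = sg (rh w) by rewrite -sgconj // crw.
have rw0 : rh w != 0 by rewrite fmorph_eq0.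
have sw0 : sg w != 0 by rewrite fmorph_eq0.
have [s1 [b Eb]] : exists (s : bool) (b : int), w * rh w = (-1) ^+ s * e1 ^ b.
  apply: (unit_power fu1); apply: unit_sub; first exact: Umul (Urh Uw).
  apply: fix_QA; first exact: Qgen_mul.
    by rewrite rmorphM /= cw crw.
  by rewrite rmorphM rhK // mulrC.
have [s2 [c Ec]] : exists (s : bool) (c : int), w * sg (rh w) = (-1) ^+ s * e2 ^ c.
  apply: (unit_power fu2); apply: unit_sub.
    exact: Umul (Usg (Urh Uw)).
  apply: fix_QB; first exact: Qgen_mul.
    by rewrite rmorphM /= cw csrw.
  by rewrite !rmorphM rhsg // rhK // sgK // mulrC.
have Erc : rh w * sg w = (-1) ^+ s2 * (n2 / e2) ^ c.
  have := congr1 rh Ec; rewrite !rmorphM rhsg // rhK // => ->.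
  by rewrite rmorph_sign fmorphXz rh2.
have [x sx Ex] : exists2 x, x = 1 \/ x = -1 & w ^+ 2 = x * (e1 ^ b * e2 ^ c).
  exists ((w * sg w) * ((-1) ^+ s1 * (-1) ^+ s2 * n2 ^ c)).
    by apply: sgn_mul => //; apply: sgn_mul; [exact: sgn_mul (sgn_bool _) (sgn_bool _) | exact: sgn_expz].
  have E : (w ^+ 2) * (rh w * sg w) = (w * sg w) * (w * rh w) by ring.
  rewrite Eb Erc div_expz in E.
  have ss : (-1) ^+ s2 * (-1) ^+ s2 = 1 :> algC by apply: sgn_sq; exact: sgn_bool.
  have sn : n2 ^ c * n2 ^ c = 1 by apply: sgn_sq; exact: sgn_expz.
  have ec0 : e2 ^ c != 0 by exact: Un0 (Uexpz _ U2).
  transitivity (w ^+ 2 * ((-1) ^+ s2 * (n2 ^ c / e2 ^ c)) * ((-1) ^+ s2 * n2 ^ c * e2 ^ c)).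
    transitivity (w ^+ 2 * ((-1) ^+ s2 * (-1) ^+ s2) * (n2 ^ c * n2 ^ c)).
      by rewrite ss sn !mulr1.
    by field.
  by rewrite E; ring.
have e1p n : 0 < e1 ^ n by rewrite exprz_gt0.
have e2p n : 0 < e2 ^ n by rewrite exprz_gt0.
have {}Ex : w ^+ 2 = e1 ^ b * e2 ^ c.
  rewrite Ex (sgn_pos sx) ?mul1r //.
  have := conj_pos w0; rewrite cw -expr2 Ex pmulr_lgt0 //; exact: mulr_gt0.
have [m Em] : exists m : int, b = m * 2.
  apply: neg1_pos; have srw0 : sg (rh w) != 0 by rewrite !fmorph_eq0.
  have := conj_pos srw0; rewrite csrw -expr2 -!rmorphXn Ex !rmorphM !fmorphXz.
  rewrite rh1 sg1 (QB_sgrh Q2) pmulr_lgt0 //.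
  by rewrite opp_inv_expz pmulr_lgt0 // invr_gt0.
have cpos : 0 < n2 ^ c.
  have := conj_pos rw0; rewrite crw -expr2 -rmorphXn Ex !rmorphM !fmorphXz.
  rewrite rh1 rh2 pmulr_rgt0 // div_expz pmulr_lgt0 //.
  by rewrite invr_gt0.
have [l El] : exists l : int, c = l * 2.
  case: sgn_n2 => n2E; last by apply: neg1_pos; rewrite -n2E.
  have [l [El|El]] := int_parity c; first by exists l.
  (* When e2 has norm 1 its conjugates carry no sign. An odd c would make e2 a square in L, and 2 e2
     being one, 2 would be a square too. *)
  have [be Lbe Ebe] := Hn2 n2E; exfalso.
  pose g := w / (e1 ^ m * e2 ^ l).
  have Lg : Qgen L g by apply: UL; apply: Udiv => //; apply: Umul; exact: Uexpz.
  apply: (sqrt2_notin_L (Qgen_div Lbe Lg)).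
  have e1m0 := lt0r_neq0 (e1p m); have e2l0 := lt0r_neq0 (e2p l).
  have g2 : g ^+ 2 = e2.
    rewrite /g expr_div_n Ex Em El expfzDr // expr1z exprMn -!exprz_exp -!exprnP.
    by field; rewrite e1m0 e2l0.
  by rewrite expr_div_n Ebe g2 mulfK.
have : (w - e1 ^ m * e2 ^ l) * (w + e1 ^ m * e2 ^ l) = 0.
  rewrite -subr_sqr Ex Em El exprMn -!exprz_exp -!exprnP; exact: subrr.
move/eqP; rewrite mulf_eq0 subr_eq0 addr_eq0 => /orP[]/eqP->.
  by exists false, m, l; rewrite expr0 mul1r.
by exists true, m, l; rewrite expr1 mulN1r mulNr.
Qed.

(** 3 and 4 are prime to p1 and p2, so an odd exponent of p1 or p2 survives. This meets the two side
    conditions of [imag_quad_unit]. *)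
Let nonsq (e f g c : nat) : odd f \/ odd g -> (c == 3)%N || (c == 4)%N ->
  forall n, (c * (2 ^ e * (p1 ^ f * p2 ^ g)) != n ^ 2)%N.
Proof.
move=> ofg c34 n; apply/eqP => /sqr_odd_logn H.
have c0 : (0 < c)%N by case/orP: c34 => /eqP->.
have x0 : (0 < 2 ^ e * (p1 ^ f * p2 ^ g))%N.
  by rewrite !muln_gt0 !expn_gt0 p1_gt0 p2_gt0.
have lc q : prime q -> (q %% 4 = 1)%N -> logn q c = 0%N.
  move=> pq q4; case/orP: c34 => /eqP->.
    rewrite logn_prime //; case: eqP q4 => // ->.
    by [].
  have -> : (4 = 2 ^ 2)%N by [].
  rewrite lognX logn_prime //; case: eqP q4 => // ->.
  by [].
case: ofg => o; [have := H p1 | have := H p2]; rewrite lognM // lc // lognE //.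
  rewrite (negbTE p1n2) (negbTE neq12) eqxx mul1n !mul0n !addn0.
  by rewrite add0n add0n o.
rewrite (negbTE p2n2) [p2 == p1]eq_sym (negbTE neq12) eqxx mul1n !mul0n.
by rewrite !add0n o.
Qed.

(* z = u / conj u is, by norms to Q(iA) and Q(iB), a fourth root of unity; +-i is
   impossible, so u or i u is real. *)
Lemma norm_one_form u : U u -> u * sg u = 1 ->
  (n2 = 1 -> exists2 b, Qgen L b & b ^+ 2 = 2 * e2) ->
  exists (a : nat) (b c : int), u = 'i ^+ a * e1 ^ b * e2 ^ c.
Proof.
move=> Uu Nu Hn2; have Lu := UL Uu; have u0 := Un0 Uu.
have cu0 : u^* != 0 by rewrite fmorph_eq0.
have su : sg u = u^-1 by apply: (mulfI u0); rewrite Nu mulfV.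
pose z := u / u^*; have Uz : U z by exact: Udiv (Uconj Uu).
have Lz := UL Uz; have z0 := Un0 Uz.
have cz : z^* = z^-1 by rewrite /z rmorphM fmorphV /= conjCK invf_div mulrC.
have sz : sg z = z^-1 by rewrite /z rmorphM fmorphV sgconj // su fmorphV /= invrK invf_div mulrC.
have Eu : u = z * u^* by rewrite /z divfK.
clearbody z.
have rcz : (rh z)^* = rh z^-1 by rewrite -rhconj // cz.
have rsz : sg (rh z) = rh z^-1 by rewrite -rhsg // sz.
have Lrz := rhL Lz; have Lsz := sgL Lz; have Lsrz := sgL Lrz.
have rz0 : rh z != 0 by rewrite fmorph_eq0.
have E1 : z * rh z = 1 \/ z * rh z = -1.
  have n4 := @nonsq 0 1 0 4 (or_introl isT) isT.
  have n3' := @nonsq 0 1 0 3 (or_introl isT) isT.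
  rewrite expn0 mul1n expn1 expn0 muln1 in n4 n3'.
  apply: (imag_quad_unit p1_gt0 n4 n3').
  - apply: fix_iA; first exact: Qgen_mul.
      by rewrite rmorphM rhK // mulrC.
    by rewrite !rmorphM /= sz rsz !fmorphV /= cz rcz !fmorphV /= !invrK.
  - by case: (Umul Uz (Urh Uz)) => -[].
  - by rewrite rmorphM /= cz rcz fmorphV; field; rewrite z0 rz0.
have E2 : z * sg (rh z) = 1 \/ z * sg (rh z) = -1.
  have n4 := @nonsq 1 0 1 4 (or_intror isT) isT.
  have n3' := @nonsq 1 0 1 3 (or_intror isT) isT.
  rewrite expn1 expn0 mul1n expn1 in n4 n3'.
  have d0 : (0 < 2 * p2)%N by rewrite muln_gt0.
  apply: (imag_quad_unit d0 n4 n3').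
  - apply: fix_iB; first exact: Qgen_mul.
      by rewrite !rmorphM rhsg // rhK // sgK // mulrC.
    by rewrite !rmorphM /= sgK // sz rcz rsz !fmorphV /= cz !invrK.
  - by case: (Umul Uz (Usg (Urh Uz))) => -[].
  - by rewrite rmorphM /= cz rsz !fmorphV /= rcz !fmorphV; field; rewrite z0 rz0.
(* Since [sg (rh z)] is the inverse of [rh z], the product of the two signs is z^2. *)
have E3 : z ^+ 2 = 1 \/ z ^+ 2 = -1.
  have := sgn_mul E1 E2; rewrite rsz fmorphV.
  by have -> : z * rh z * (z / rh z) = z ^+ 2 by field.
have real_case w s : s = 1 \/ s = -1 -> U w -> w^* = w -> w * sg w = s ->
    exists (a : nat) (b c : int), w = 'i ^+ a * e1 ^ b * e2 ^ c.
  move=> ss Uw cw Nw; have [|s' [b [c ->]]] := real_norm_unit Uw cw _ Hn2.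
    by rewrite Nw.
  have [a ->] := sgn_i (sgn_bool s').
  by exists a, b, c.
have not_i y : (y = 'i \/ y = - 'i) -> z <> y.
  move=> Hy zy; have y2 : y ^+ 2 = -1 by case: Hy => ->; rewrite ?sqrrN sqrCi.
  have cy : y^* = - y by case: Hy => ->; rewrite ?rmorphN /= conjCi ?opprK.
  have sy : sg y = y by case: Hy => ->; rewrite ?rmorphN /= sgi.
  (* If z = y is i or -i, then r is real, and so is its relative norm. But that norm is (1 - y)^2 =
     -2y, which is not real. *)
  pose r := (1 - y) * u.
  have cr : r^* = r.
    rewrite /r rmorphM rmorphB rmorph1 /= cy opprK [in RHS]Eu zy.
    have -> : (1 - y) * (y * u^*) = (y - y ^+ 2) * u^* by ring.
    by rewrite y2; ring.
  have Lr : Qgen L r.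
    apply: Qgen_mul => //; apply: Qgen_sub; first exact: Qgen1.
    by case: Hy => ->; [exact: Li | exact: Qgen_opp].
  have Nr : r * sg r = - 2 * y.
    rewrite /r rmorphM rmorphB rmorph1 sy su.
    have -> : (1 - y) * u * ((1 - y) / u) = 1 - 2 * y + y ^+ 2 by field.
    by rewrite y2; ring.
  have : (r * sg r)^* = r * sg r by rewrite rmorphM /= -sgconj // cr.
  rewrite Nr rmorphM /= cy rmorphN rmorph_nat => /eqP.
  rewrite mulrN -subr_eq0 -opprD oppr_eq0 -mulr2n mulrn_eq0 mulf_eq0 oppr_eq0 pnatr_eq0 /=.
  by case: Hy => ->; rewrite ?oppr_eq0 (negbTE i0).
case: E3 => /eqP; rewrite ?sqrf_eq1.
  case/orP => /eqP Ez.
    apply: (real_case u 1) => //; first by left.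
    by rewrite [in RHS]Eu Ez mul1r.
  (* For z = -1 it is i u that is real, with relative norm -1; hence both signs allowed in
     [real_norm_unit]. The exponent [a + 3] below divides by i again. *)
  have ciu : ('i * u)^* = 'i * u.
    by rewrite rmorphM /= conjCi [in RHS]Eu Ez; ring.
  have Niu : 'i * u * sg ('i * u) = -1.
    by rewrite rmorphM sgi su mulrACA mulfV // mulr1 -expr2 sqrCi.
  have [a [b [c E]]] := real_case _ (-1) (or_intror erefl) (Umul Ui Uu) ciu Niu.
  exists (a + 3)%N, b, c; apply: (mulfI i0); rewrite E exprD.
  have -> : ('i : algC) ^+ 3 = - 'i by rewrite exprS sqrCi mulrN1.
  transitivity (- 'i ^+ 2 * ('i ^+ a * e1 ^ b * e2 ^ c) : algC); last by ring.
  by rewrite sqrCi opprK mul1r.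
rewrite -sqrCi eqf_sqr => /orP[]/eqP Ez; exfalso.
  by apply: (not_i 'i) => //; left.
by apply: (not_i (- 'i)) => //; right.
Qed.

(** * Units of the form v / sg v *)

(** If j were odd, i would be a square y^2 in L, and y + 1/y would have square i + 1/i + 2 = 2. *)
Lemma unity_root_sqrt z (j : nat) : Qgen L z -> z ^+ 2 = 'i ^+ j -> exists l : nat, z = 'i ^+ l.
Proof.
move=> Lz; rewrite -[j]odd_double_half -muln2 exprD exprM.
set h := 'i ^+ j./2; have h0 : h != 0 by rewrite expf_neq0.
case: odd => Ez; last first.
  rewrite mul1r in Ez; move/eqP: Ez; rewrite eqf_sqr => /orP[]/eqP->.
    by exists j./2.
  by exists (2 + j./2)%N; rewrite exprD sqrCi mulN1r.
exfalso; pose y := z / h.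
have Ly : Qgen L y by apply: Qgen_div => //; exact: Qgen_exp.
have y2 : y ^+ 2 = 'i by rewrite /y expr_div_n Ez expr1 mulfK // expf_neq0.
have y0 : y != 0 by apply/eqP => y0; move: y2; rewrite y0 expr0n /= => /esym/eqP; rewrite (negbTE i0).
apply: (sqrt2_notin_L (Qgen_add Ly (Qgen_inv Ly))).
transitivity (y ^+ 2 + (y ^+ 2)^-1 + 2); first by field.
by rewrite y2 invCi subrr add0r.
Qed.

Let norm_e1pos n : 0 < e1 ^ n. Proof. by rewrite exprz_gt0. Qed.
Let norm_e2pos n : 0 < e2 ^ n. Proof. by rewrite exprz_gt0. Qed.
Let norm_e3pos n : 0 < e3 ^ n. Proof. by rewrite exprz_gt0. Qed.

Let i_conj (a : nat) : ('i : algC) ^+ a * ('i ^+ a)^* = 1.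
Proof. by rewrite rmorphXn /= conjCi -exprMn mulrN -expr2 sqrCi opprK expr1n. Qed.

(* The element Y = v conj(v) / (e1^b e2^c) satisfies Y^2 = e3^n for some n, and it
   differs from the element v * sg v of k by a root of unity. *)
Lemma boundary_form v (a : nat) (b c : int) : U v ->
  v / sg v = 'i ^+ a * e1 ^ b * e2 ^ c ->
  exists (m : int) (j : nat),
    v * v^* = e1 ^ b * e2 ^ c * e3 ^ m /\ v * sg v = 'i ^+ j * e3 ^ m.
Proof.
move=> Uv Ev; have Lv := UL Uv; have v0 := Un0 Uv.
have cv0 : v^* != 0 by rewrite fmorph_eq0.
have sv0 : sg v != 0 by rewrite fmorph_eq0.
have scv0 : (sg v)^* != 0 by rewrite fmorph_eq0.
pose w := v * sg v; have Uw : U w by exact: Umul (Usg Uv).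
have sw : sg w = w by rewrite /w rmorphM sgK // mulrC.
have kw : Qgen k w by apply: fixk => //; exact: UL.
have cw : w^* = v^* * (sg v)^* by rewrite /w rmorphM.
have w0 := Un0 Uw; have cw0 : w^* != 0 by rewrite fmorph_eq0.
have scw : sg w^* = w^* by rewrite sgconj ?sw //; exact: UL.
have [n En] : exists n : int, w * w^* = e3 ^ n.
  have [s [n En]] : exists (s : bool) (n : int), w * w^* = (-1) ^+ s * e3 ^ n.
    apply: (unit_power fu3); apply: unit_sub; first exact: Umul (Uconj Uw).
    apply: fix_QD.
    - by apply: UL; exact: Umul (Uconj Uw).
    - by rewrite rmorphM /= conjCK mulrC.
    - by rewrite rmorphM sw scw.
  exists n; rewrite En (sgn_pos (sgn_bool s)) ?mul1r //.
  by have := conj_pos w0; rewrite En pmulr_lgt0.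
have kcw : Qgen k w^* by apply: fixk => //; exact/conjL/UL.
pose z := w / w^*; have Uz : U z by exact: Udiv (Uconj Uw).
have kz : Qgen k z by exact: Qgen_div.
have z0 := Un0 Uz; have Lz := UL Uz.
have cz : z^* = z^-1 by rewrite /z rmorphM fmorphV /= conjCK invf_div mulrC.
have Ew : w = z * w^* by rewrite /z divfK.
clearbody z.
have krh y : Qgen k y -> Qgen k (rh y).
  apply: Qgen_aut => x; rewrite !inE => /orP[]/eqP->; rewrite ?rhD ?rhi.
    by apply: Qgen_opp; apply: Qgen_gen; rewrite !inE eqxx.
  by apply: Qgen_gen; rewrite !inE eqxx orbT.
have rz0 : rh z != 0 by rewrite fmorph_eq0.
(* z times and z divided by [rh z] lie in Q(i) and Q(iD), so both are roots of unity; their product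
   is z^2. *)
have [j1 E1] : exists n : nat, z * rh z = 'i ^+ n.
  apply: gauss_unit.
  - apply: fix_Qi; first by apply: Qgen_mul => //; exact: krh.
    by rewrite rmorphM rhK // mulrC.
  - by case: (Umul Uz (Urh Uz)) => -[].
  - by rewrite rmorphM /= cz -rhconj // cz fmorphV; field; rewrite z0 rz0.
have E2 : z / rh z = 1 \/ z / rh z = -1.
  have n4 := @nonsq 1 1 1 4 (or_intror isT) isT.
  have n3' := @nonsq 1 1 1 3 (or_intror isT) isT.
  have dE : (2 ^ 1 * (p1 ^ 1 * p2 ^ 1) = 2 * p1 * p2)%N by rewrite !expn1 mulnA.
  rewrite dE in n4 n3'.
  have d0 : (0 < 2 * p1 * p2)%N by rewrite !muln_gt0 p1_gt0.
  have Urz := Urh Uz.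
  apply: (imag_quad_unit d0 n4 n3').
  - apply: fix_iD; first by apply: Qgen_div => //; exact: krh.
    have -> : (z / rh z)^* = z^-1 * rh z.
      by rewrite fmorph_div /= cz -rhconj // cz fmorphV invrK.
    by rewrite rmorphM fmorphV rhK // mulrC.
  - by case: (Udiv Uz Urz) => -[].
  - by rewrite fmorph_div /= cz -rhconj // cz fmorphV; field; rewrite z0 rz0.
have [j2 E3] : exists j : nat, z ^+ 2 = 'i ^+ j.
  have [j2 E2'] := sgn_i E2; exists (j1 + j2)%N; rewrite exprD -E1 -E2'.
  by field.
have [j Ez] := unity_root_sqrt Lz E3.
pose Y := v * v^* / (e1 ^ b * e2 ^ c).
have den0 : e1 ^ b * e2 ^ c != 0 by rewrite mulf_neq0 ?gt_eqF.
have Y2 : Y ^+ 2 = e3 ^ n.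
  have Evc := congr1 (fun x => x * x^*) Ev.
  rewrite /= fmorph_div rmorphM rmorphM !fmorphXz /= conj1 conj2 in Evc.
  have {}Evc : v * v^* / (sg v * (sg v)^*) = (e1 ^ b * e2 ^ c) ^+ 2.
    transitivity (v / sg v * (v^* / (sg v)^*)); first by field; rewrite sv0 scv0.
    rewrite Evc; transitivity ('i ^+ a * ('i ^+ a)^* * (e1 ^ b * e2 ^ c) ^+ 2); first by ring.
    by rewrite i_conj mul1r.
  rewrite /Y expr_div_n -Evc -En cw /w; field.
  by rewrite sv0 scv0 v0 cv0.
have UY : U Y.
  by apply: Udiv; [exact: Umul (Uconj Uv) | apply: Umul; exact: Uexpz].
have Y0 := Un0 UY.
(* (w / Y)^2 = w / conj(w) = z is a power of i. Thus Y is w up to a root of unity, hence fixed by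
   [sg]: a positive unit of Q(D). *)
have [l El] : exists l : nat, w / Y = 'i ^+ l.
  apply: (unity_root_sqrt (j := j)); first by apply: UL; exact: Udiv.
  by rewrite expr_div_n Y2 -En -Ez {1}expr2 {1}Ew; field; rewrite w0 cw0.
have il0 : ('i : algC) ^+ l != 0 by rewrite expf_neq0.
have EY : Y = w / 'i ^+ l by rewrite -El; field; rewrite w0 Y0.
have Ypos : 0 < Y by rewrite divr_gt0 ?conj_pos ?mulr_gt0.
have cY : Y^* = Y by rewrite conj_Creal // gtr0_real.
have [s [m Em]] : exists (s : bool) (n : int), Y = (-1) ^+ s * e3 ^ n.
  apply: (unit_power fu3); apply: unit_sub => //; apply: fix_QD => //; first exact: UL.
  by rewrite EY fmorph_div sw rmorphXn sgi.
have {}Em : Y = e3 ^ m.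
  rewrite Em (sgn_pos (sgn_bool s)) ?mul1r //.
  by move: Ypos; rewrite Em pmulr_lgt0.
exists m, l; split.
  by rewrite -Em /Y mulrCA mulfV // mulr1.
by rewrite -El -Em divfK.
Qed.

(** Complex conjugation commutes with [sg] and [rh] on L, so [sg \o rh] and [rh] send v conj(v) to
    positive numbers; the signs acquired by e1, e2 and e3 must cancel. *)
Lemma boundary_parity v (a : nat) (b c : int) : U v ->
  v / sg v = 'i ^+ a * e1 ^ b * e2 ^ c ->
  exists (m : int) (j : nat),
    [/\ v * v^* = e1 ^ b * e2 ^ c * e3 ^ m, v * sg v = 'i ^+ j * e3 ^ m,
     0 < (-1) ^ b * n3 ^ m & 0 < n2 ^ c * n3 ^ m].
Proof.
move=> Uv /(boundary_form Uv)[m [j [EV Ew]]]; exists m, j.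
have Lv := UL Uv; have v0 := Un0 Uv.
split=> //.
  have := congr1 rh EV; move/(congr1 sg).
  rewrite !rmorphM (rhconj Lv) (sgconj (rhL Lv)) !fmorphXz rh1 sg1 (QB_sgrh Q2) rh3.
  rewrite fmorph_div sg3 (sgn_aut sg sgn_n3) opp_inv_expz div_expz => E.
  have : 0 < sg (rh v) * (sg (rh v))^* by apply: conj_pos; rewrite !fmorph_eq0.
  rewrite E; have -> : (-1) ^ b / e1 ^ b * e2 ^ c * (n3 ^ m / e3 ^ m) =
    ((-1) ^ b * n3 ^ m) * (e2 ^ c / (e1 ^ b * e3 ^ m)).
    by field; rewrite !gt_eqF.
  by rewrite pmulr_lgt0 // divr_gt0 // mulr_gt0.
have := congr1 rh EV; rewrite !rmorphM (rhconj Lv) !fmorphXz rh1 rh2 rh3 !div_expz => E.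
have : 0 < rh v * (rh v)^* by apply: conj_pos; rewrite !fmorph_eq0.
rewrite E; have -> : e1 ^ b * (n2 ^ c / e2 ^ c) * (n3 ^ m / e3 ^ m) =
  (n2 ^ c * n3 ^ m) * (e1 ^ b / (e2 ^ c * e3 ^ m)).
  by field; rewrite !gt_eqF.
by rewrite pmulr_lgt0 // divr_gt0 // mulr_gt0.
Qed.

(** For n3 = -1 and c = 0 the second sign makes m even, and then the first makes b even. For n3 = 1
    the signs are (-1)^b and (-1)^c. *)
Lemma boundary_even v (a : nat) (b c : int) : U v ->
  v / sg v = 'i ^+ a * e1 ^ b * e2 ^ c ->
  (n3 = -1 /\ c = 0) \/ (n3 = 1 /\ n2 = -1) ->
  (exists m : int, b = m * 2) /\ (exists m : int, c = m * 2).
Proof.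
move=> Uv Ev H; have [m [_ [_ _ P1 P2]]] := boundary_parity Uv Ev.
case: H => [[E3 c0]|[E3 E2]].
  split; last by exists 0; rewrite c0.
  move: P2; rewrite c0 expr0z mul1r E3 => /neg1_pos[l El].
  move: P1; rewrite E3 (@sgn_even (-1) m l (or_intror erefl) El) mulr1.
  exact: neg1_pos.
by move: P1 P2; rewrite E3 E2 exp1rz !mulr1 => /neg1_pos ? /neg1_pos.
Qed.

(** If [sg v] = -v, then v^2 is a power of i times e3^m. In each case v turns out to be a root of
    unity times an element of k, so it is fixed by [sg], which is absurd. The parity of m is settled
    by signs when n3 = -1; otherwise an odd m is absorbed by a square root of i e3 in k. *)
Lemma neg1_not_boundary v :
  n3 = -1 \/ (exists2 b, Qgen [:: D] b & b ^+ 2 = 2 * e3) ->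
  U v -> v / sg v <> -1.
Proof.
move=> H Uv Ev; have v0 := Un0 Uv; have Lv := UL Uv.
have sv0 : sg v != 0 by rewrite fmorph_eq0.
have sv : sg v = - v by rewrite -[in RHS](divfK sv0 v) Ev mulN1r opprK.
have fixed_absurd : sg v <> v.
  rewrite sv => /eqP; rewrite eq_sym -subr_eq0 opprK -mulr2n mulrn_eq0 /=.
  by rewrite (negbTE v0).
have Ev' : v / sg v = 'i ^+ 2 * e1 ^ 0 * e2 ^ 0 by rewrite Ev sqrCi !expr0z !mulr1.
have [m [j [_ Ew _ P2]]] := boundary_parity Uv Ev'.
have v2 : v ^+ 2 = 'i ^+ (j + 2) * e3 ^ m.
  by rewrite exprD sqrCi mulrAC -Ew sv; ring.
have e3m n : e3 ^ n != 0 by rewrite gt_eqF.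
have Le3 n : Qgen L (e3 ^ n) by exact: UL (Uexpz _ U3).
have sgi' n : sg ('i ^+ n) = 'i ^+ n by rewrite rmorphXn sgi.
have sge3 n : sg (e3 ^ n) = e3 ^ n by rewrite fmorphXz sg3.
have even_absurd l : m = l * 2 -> False.
  move=> El; have [||q Eq] := @unity_root_sqrt (v / e3 ^ l) (j + 2).
  - exact: Qgen_div.
  - by rewrite expr_div_n v2 El -exprz_exp mulfK // expf_neq0.
  - apply: fixed_absurd; have -> : v = 'i ^+ q * e3 ^ l by rewrite -Eq divfK.
    by rewrite rmorphM sgi' sge3.
case: H => [E3|[be Dbe Ebe]].
  by move: P2; rewrite E3 expr0z mul1r => /neg1_pos[l]; exact: even_absurd.
have [l [El|El]] := int_parity m; first exact: even_absurd El.
(* As (1 + i)^2 = 2i, a square root of 2 e3 becomes one of i e3. *)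
pose xi := (1 + 'i) * be / 2.
have xi2 : xi ^+ 2 = 'i * e3.
  have -> : xi ^+ 2 = (1 + 2 * 'i + 'i ^+ 2) * be ^+ 2 / 4 by rewrite /xi; field.
  by rewrite Ebe sqrCi; field.
have sxi : sg xi = xi.
  by rewrite /xi fmorph_div rmorphM rmorphD rmorph1 sgi rmorph_nat (QD_sg Dbe).
have Lxi : Qgen L xi.
  apply: Qgen_div; last exact: Qgen_nat.
  by apply: Qgen_mul; [apply: Qgen_add => //; exact: Qgen1 | exact: QDL].
clearbody xi.
have xi0 : xi != 0 by move: (mulf_neq0 i0 e30); rewrite -xi2 expf_eq0.
(* The exponent is j + 2 from v^2 plus 3 for the division by i. *)
have [||q Eq] := @unity_root_sqrt (v / e3 ^ l / xi) (j + 5).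
- by apply: Qgen_div => //; exact: Qgen_div.
- rewrite !expr_div_n v2 xi2 El expfzDr // expr1z -exprz_exp.
  have -> : ('i : algC) ^+ (j + 5) = 'i ^+ (j + 2) * 'i ^+ 3 by rewrite -exprD -addnA.
  have -> : ('i : algC) ^+ 3 = 'i^-1 by rewrite exprS sqrCi mulrN1 invCi.
  rewrite -exprnP; field.
  by rewrite e30 i0 e3m.
apply: fixed_absurd; have -> : v = 'i ^+ q * xi * e3 ^ l.
  by rewrite -Eq; field; rewrite xi0 e3m.
by rewrite !rmorphM sgi' sge3 sxi.
Qed.

Let dvd_two_primes q r : prime q -> (r %| 2 * q)%N -> r \in [:: 1; 2; q; 2 * q]%N.
Proof.
move=> pq /(prime_mul_dvdn (isT : prime 2))[r1 d1 Er].
rewrite -[q]muln1 in d1; have [r2] := prime_mul_dvdn pq d1.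
rewrite dvdn1 => /eqP->; rewrite muln1 => E1; rewrite !inE.
by case: Er => ->; case: E1 => ->; rewrite ?muln1 eqxx ?orbT.
Qed.

Let dvd_three_primes r : (r %| 2 * p1 * p2)%N ->
  r \in [:: 1; 2; p1; p2; 2 * p1; 2 * p2; p1 * p2; 2 * p1 * p2]%N.
Proof.
rewrite -mulnA mulnCA => /(prime_mul_dvdn pr1)[r1 /(dvd_two_primes pr2) d1 Er].
rewrite !inE in d1 *.
by case: Er => ->; case/or4P: d1 => /eqP->;
  rewrite ?muln1 ?[(p1 * (2 * p2))%N]mulnCA ?[(p1 * 2)%N]mulnC ?mulnA eqxx ?orbT.
Qed.

(** The squarefree number r of [norm_one_sqrt] divides 2 p2. Multiplying by B exchanges r and 2 p2 /
    r up to squares: r = 1 and r = 2 p2 would make e2 a square in Q(B), while r = 2 and r = p2 give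
    the claim. *)
Lemma sqrt_two_e2 : n2 = 1 -> exists2 b, Qgen [:: B] b & b ^+ 2 = 2 * e2.
Proof.
move=> n2E; have d0 : (0 < 2 * p2)%N by rewrite muln_gt0.
have N : e2 * rh e2 = 1 by rewrite norm_e2.
have [t [r [c [b [_ _ dr Hr [Qb Eb]]]]]] := norm_one_sqrt d0 rhB fu2 N.
have {dr} : (r %| 2 * p2)%N.
  (* With m = 2 p2 even, (2m)^2 divides m^4, so r divides m by squarefreeness. *)
  apply: (Hr _ (2 * 2)%N); apply: dvdn_trans dr _; rewrite expnM dvdn_exp2r //.
  by rewrite -mulnn dvdn_mul // dvdn_mulr.
have B2' : B ^+ 2 = 2 * p2%:R by rewrite B2 natrM.
have p20 : p2%:R != 0 :> algC by rewrite pnatr_eq0 -lt0n.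
have QB : Qgen [:: B] B by apply: Qgen_gen; rewrite mem_head.
move/(dvd_two_primes pr2); rewrite !inE => /or4P[] /eqP Er; rewrite Er in Eb.
- by case: (fund_unit_not_square fu2 Qb); rewrite Eb mul1r.
- by exists b.
- exists (b * B / p2%:R); first by apply: Qgen_div; [exact: Qgen_mul | exact: Qgen_nat].
  by rewrite expr_div_n exprMn Eb B2'; field.
- have QbB : Qgen [:: B] (b / B) by exact: Qgen_div.
  case: (fund_unit_not_square fu2 QbB).
  by rewrite expr_div_n Eb B2' natrM; field; rewrite p20.
Qed.

(** * The square class of e3 when its norm is one *)

Section SquareClass.

Variables x y : int.
Hypothesis e3E : e3 = x%:~R + y%:~R * D.
Hypothesis n3E : n3 = 1.

Let rh3E : rh e3 = x%:~R - y%:~R * D.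
Proof. by rewrite e3E rmorphD rmorphM !rmorph_int rhD mulrN. Qed.

Let trace_e3 : e3 + rh e3 = (2 * x)%:~R.
Proof. by rewrite rh3E e3E intrM; ring. Qed.

Let norm_xy : x ^+ 2 - (2 * p1 * p2)%:Z * y ^+ 2 = 1.
Proof.
apply: (@intr_inj algC); rewrite -[RHS]n3E -norm_e3 rh3E e3E intrB [X in _ - X]intrM.
rewrite !(rmorphXn (intr : int -> algC)) /= -[(2 * p1 * p2)%:~R]D2.
by ring.
Qed.

Let x_gt1 : 1 < x.
Proof.
rewrite -(ltr_int algC).
have H : e3^-1 = rh e3 by rewrite rh3 n3E mul1r.
have T : 2 * x%:~R = e3 + e3^-1 by rewrite H trace_e3 intrM.
have : 0 < (e3 - 1) ^+ 2 / e3.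
  by rewrite divr_gt0 // exprn_gt0 // subr_gt0.
have -> : (e3 - 1) ^+ 2 / e3 = e3 + e3^-1 - 2 by field.
rewrite -T; have -> : 2 * x%:~R - 2 = 2 * (x%:~R - 1) :> algC by ring.
by rewrite pmulr_rgt0 ?ltr0n // subr_gt0.
Qed.

(** The trace of e3 is 2x, so (e3 + 1)^2 = 2 (x + 1) e3 and (e3 - 1)^2 = 2 (x - 1) e3. *)
Lemma square_two_e3 : (exists n : nat, x + 1 = (n ^ 2)%:Z \/ x - 1 = (n ^ 2)%:Z) ->
  exists2 b, Qgen [:: D] b & b ^+ 2 = 2 * e3.
Proof.
have T : e3 + e3^-1 = 2 * x%:~R.
  have -> : e3^-1 = rh e3 by rewrite rh3 n3E mul1r.
  by rewrite trace_e3 intrM.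
case=> n [En|En].
  exists ((1 + e3) / n%:R).
    by apply: Qgen_div; [apply: Qgen_add => //; exact: Qgen1 | exact: Qgen_nat].
  have n0 : n%:R != 0 :> algC.
    by rewrite pnatr_eq0; apply/eqP => n0; rewrite n0 in En; move: x_gt1 En; clear; lia.
  have E : n%:R ^+ 2 = x%:~R + 1 :> algC by rewrite -natrX -[LHS]/((n ^ 2)%:Z%:~R) -En intrD.
  have -> : ((1 + e3) / n%:R) ^+ 2 = e3 * (e3 + e3^-1 + 2) / n%:R ^+ 2.
    by field; rewrite n0 e30.
  rewrite T; have -> : 2 * x%:~R + 2 = 2 * n%:R ^+ 2 :> algC by rewrite E; ring.
  by field.
exists ((e3 - 1) / n%:R).
  by apply: Qgen_div; [apply: Qgen_sub => //; exact: Qgen1 | exact: Qgen_nat].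
have n0 : n%:R != 0 :> algC.
  by rewrite pnatr_eq0; apply/eqP => n0; rewrite n0 in En; move: x_gt1 En; clear; lia.
have E : n%:R ^+ 2 = x%:~R - 1 :> algC by rewrite -natrX -[LHS]/((n ^ 2)%:Z%:~R) -En intrB.
have -> : ((e3 - 1) / n%:R) ^+ 2 = e3 * (e3 + e3^-1 - 2) / n%:R ^+ 2.
  by field; rewrite n0 e30.
rewrite T; have -> : 2 * x%:~R - 2 = 2 * n%:R ^+ 2 :> algC by rewrite E; ring.
by field.
Qed.

(** The squarefree part r of 2x + 2 divides 2 p1 p2, and multiplying by D identifies r with 2 p1 p2
    / r. The pair 1, 2 p1 p2 would make e3 a square; 2 gives x + 1 and p1 p2 gives x - 1 as a
    square; the other two pairs give the second alternative. *)
Lemma e3_square_class :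
  (exists n : nat, x + 1 = (n ^ 2)%:Z \/ x - 1 = (n ^ 2)%:Z) \/
  (exists2 b, Qgen [:: D] b & b ^+ 2 = p1%:R * e3 \/ b ^+ 2 = 2 * p1%:R * e3).
Proof.
have d0 : (0 < 2 * p1 * p2)%N by rewrite !muln_gt0 p1_gt0.
have N : e3 * rh e3 = 1 by rewrite norm_e3.
have [t [r [c [b [Et Ec dr Hr [Qb Eb]]]]]] := norm_one_sqrt d0 rhD fu3 N.
have {Et} Et : t = 2 * x by apply: (@intr_inj algC); rewrite -Et trace_e3.
rewrite {}Et in Ec.
have {dr} : (r %| 2 * p1 * p2)%N.
  apply: (Hr _ (2 * 2)%N); apply: dvdn_trans dr _; rewrite expnM dvdn_exp2r //.
  by rewrite -mulnn dvdn_mul // -mulnA dvdn_mulr.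
have D2' : D ^+ 2 = 2 * p1%:R * p2%:R by rewrite D2 !natrM.
have p10 : p1%:R != 0 :> algC by rewrite pnatr_eq0 -lt0n.
have p20 : p2%:R != 0 :> algC by rewrite pnatr_eq0 -lt0n.
have QD : Qgen [:: D] D by apply: Qgen_gen; rewrite mem_head.
have QbD n : Qgen [:: D] (b * D / n%:R).
  by apply: Qgen_div; [exact: Qgen_mul | exact: Qgen_nat].
have two0 : (2 : algC) != 0 by rewrite pnatr_eq0.
move/dvd_three_primes; rewrite !inE; case/orP=> [|/orP[|/orP[|/orP[|/orP[|/orP[|/orP[]]]]]]] /eqP Er;
  rewrite Er in Eb Ec.
- by case: (fund_unit_not_square fu3 Qb); rewrite Eb mul1r.
- by left; exists c; left; move: Ec; clear; lia.
- by right; exists b => //; left.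
- right; exists (b * D / p2%:R); [exact: QbD | right].
  by rewrite expr_div_n exprMn Eb D2'; field.
- by right; exists b => //; right; rewrite Eb natrM.
- right; exists (b * D / (2 * p2)%:R); [exact: QbD | left].
  by rewrite expr_div_n exprMn Eb D2' natrM; field; rewrite p20.
(* Here 2 (x + 1) = p1 p2 c^2; combined with x^2 - 1 = 2 p1 p2 y^2 this makes x - 1 a quotient of
   squares. *)
- left; have Ec2 : (c ^ 2)%:Z * (x - 1) = (2 * y) ^+ 2.
    have pp0 : (p1 * p2)%:Z != 0 by rewrite -lt0n muln_gt0 p1_gt0.
    apply: (mulfI pp0).
    transitivity ((p1 * p2 * c ^ 2)%N%:Z * (x - 1)); first by rewrite !PoszM; ring.
    rewrite -Ec; transitivity (2 * (x ^+ 2 - 1)); first by ring.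
    have -> : x ^+ 2 = 1 + (2 * p1 * p2)%:Z * y ^+ 2 by rewrite -norm_xy; ring.
    by rewrite !PoszM; ring.
  have c0 : (0 < c)%N.
    by case: c Ec {Eb Ec2} => //; rewrite exp0n // muln0; move: x_gt1; clear; lia.
  have Ec3 : (c ^ 2 * `|x - 1| = (2 * `|y|) ^ 2)%N by move: x_gt1 Ec2; clear; lia.
  have dv : (c %| 2 * `|y|)%N by rewrite -(@dvdn_pexp2r _ _ 2) // -Ec3 dvdn_mulr.
  case/dvdnP: dv => q Eq; exists q; right.
  have : (`|x - 1| = q ^ 2)%N.
    by apply/eqP; rewrite -(@eqn_pmul2l (c ^ 2)) ?expn_gt0 ?c0 // Ec3 Eq expnMn mulnC.
  by move: x_gt1; clear; lia.
have QbD' : Qgen [:: D] (b / D) by exact: Qgen_div.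
case: (fund_unit_not_square fu3 QbD').
by rewrite expr_div_n Eb D2' !natrM; field; rewrite p20.
Qed.

End SquareClass.

Let sqr1i : (1 + 'i : algC) ^+ 2 = 2 * 'i.
Proof.
have -> : (1 + 'i : algC) ^+ 2 = 1 + 2 * 'i + 'i ^+ 2 by ring.
by rewrite sqrCi; ring.
Qed.
Let L1i : Qgen L (1 + 'i).
Proof. by apply: Qgen_add => //; exact: Qgen1. Qed.

(** v is a square root of i e2. The relative norm of i e2 is -1, so v [sg v] is i or -i, and v /
    [sg v] = v^2 / (v [sg v]). *)
Lemma boundary_e2 : n2 = 1 ->
  exists2 v, U v & exists2 x, x = 1 \/ x = -1 & v / sg v = x * e2.
Proof.
move=> n2E; have [b Qb Eb] := sqrt_two_e2 n2E.
pose v := (1 + 'i) * b / 2.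
have Ev : v ^+ 2 = 'i * e2 by rewrite /v expr_div_n exprMn sqr1i Eb; field.
have Uv : U v.
  apply: unitO_sqrt; first by rewrite Ev; exact: Umul.
  by apply: Qgen_div; [apply: Qgen_mul => //; exact: QBL | exact: Qgen_nat].
clearbody v; have v0 := Un0 Uv; have sv0 : sg v != 0 by rewrite fmorph_eq0.
exists v => //.
have : (v * sg v) ^+ 2 = 'i ^+ 2.
  rewrite exprMn -rmorphXn Ev rmorphM sgi sg2 n2E; field.
  by rewrite e20.
move/eqP; rewrite eqf_sqr => E.
exists ('i / (v * sg v)).
  by case/orP: E => /eqP->; [left | right]; field; rewrite ?i0.
have -> : v / sg v = v ^+ 2 / (v * sg v) by field; rewrite v0 sv0.
by rewrite Ev mulrAC.
Qed.

(** b is fixed by [sg] and A is negated, so dividing b by A gives an element negated by [sg]. The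
    factor (1 + i) / 2 removes the 2 in the second case; the squares are the units e3 and i e3. *)
Lemma boundary_neg1 : (exists2 b, Qgen [:: D] b &
  b ^+ 2 = p1%:R * e3 \/ b ^+ 2 = 2 * p1%:R * e3) ->
  exists2 v, U v & v / sg v = -1.
Proof.
case=> b Qb Eb.
suff [v [Lv Uv2 sv]] : exists v, [/\ Qgen L v, U (v ^+ 2) & sg v = - v].
  have Uv : U v by exact: unitO_sqrt.
  by exists v => //; rewrite sv invrN mulrN mulfV ?(Un0 Uv).
have p10 : p1%:R != 0 :> algC by rewrite pnatr_eq0 -lt0n.
have Lb := QDL Qb.
case: Eb => Eb.
  exists (b / A); split; first exact: Qgen_div.
    by rewrite expr_div_n Eb A2 mulrAC mulfV // mul1r.
  by rewrite fmorph_div (QD_sg Qb) sgA invrN mulrN.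
exists ((1 + 'i) * b / (2 * A)); split.
- apply: Qgen_div; first exact: Qgen_mul.
  by apply: Qgen_mul => //; exact: Qgen_nat.
- have -> : ((1 + 'i) * b / (2 * A)) ^+ 2 = 'i * e3.
    by rewrite expr_div_n !exprMn sqr1i Eb A2; field.
  exact: Umul.
- rewrite fmorph_div !rmorphM (QD_sg Qb) sgA rmorphD rmorph1 sgi rmorph_nat.
  by rewrite mulrN invrN mulrN.
Qed.

Let trace_L z : Qgen L z -> z^* = z -> z \in Aint ->
  exists t : int, z + sg z + rh z + sg (rh z) = t%:~R.
Proof.
move=> Lz cz iz; have Lsz := sgL Lz; have Lrz := rhL Lz; have Lsrz := sgL Lrz.
apply: rat_int; last by rewrite !rpredD ?Aint_aut.
have LT : Qgen L (z + sg z + rh z + sg (rh z)) by do ! apply: Qgen_add => //.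
have QT : Qgen [:: A] (z + sg z + rh z + sg (rh z)).
  apply: fix_QA => //.
    by rewrite !rmorphD /= -!sgconj // -!rhconj // cz.
  by rewrite !rmorphD !rhsg // !rhK //; ring.
apply: (Qgen_fixed (nu := sg) (a := A)) => //; first by rewrite A2; exact: Qgen_nat.
by rewrite !rmorphD !sgK //; ring.
Qed.

(** * The product e1 e2 e3 when e1, e2 and e3 all have norm -1 *)

Section AllNormsMinusOne.

Hypotheses (n2E : n2 = -1) (n3E : n3 = -1).

Let eta := e1 * e2 * e3.

(* With z = e1 e2, the element Q = (1 + z)^2 e3 / z of Q(D) has square norm h^2, so
   Q (Q + rh Q + 2 h) = (Q + h)^2. *)
Lemma eta_times_nat : exists (r : nat) (g : algC),
  [/\ (0 < r)%N, (forall k e, (r %| k ^ e)%N -> (r %| k)%N), Qgen L g, g^* = g &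
    g ^+ 2 = r%:R * eta].
Proof.
pose z := e1 * e2; have z_gt0 : 0 < z by exact: mulr_gt0.
have z0 : z != 0 by rewrite gt_eqF.
have z10 : 1 + z != 0 by rewrite gt_eqF // addr_gt0.
pose R := (1 + z) ^+ 2 / z; pose Q := R * e3.
have R_gt0 : 0 < R by rewrite divr_gt0 // exprn_gt0 // addr_gt0.
have Q_gt0 : 0 < Q by exact: mulr_gt0.
have Uz : U z by exact: Umul.
have Lz := UL Uz.
have LR : Qgen L R.
  by apply: Qgen_div => //; apply: Qgen_exp; apply: Qgen_add => //; exact: Qgen1.
have LQ : Qgen L Q by apply: Qgen_mul => //; exact: UL.
have cQ : Q^* = Q by rewrite conj_Creal // gtr0_real.
have sz : sg z = z^-1 by rewrite /z rmorphM sg1 sg2 n2E; field; rewrite e10 e20.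
have rz : rh z = - (e1 / e2) by rewrite /z rmorphM rh1 rh2 n2E; field.
have sQ : sg Q = Q.
  rewrite /Q rmorphM sg3 /R fmorph_div rmorphXn rmorphD rmorph1 sz; field.
  by rewrite z0.
have iQ : Q \in Aint.
  have -> : Q = (z + z^-1 + 2) * e3 by rewrite /Q /R; field.
  have [[_ i1] [_ i2] _] := Uz; have [[_ i3] _ _] := U3.
  by apply: rpredM => //; apply: rpredD; [exact: rpredD | exact: Aint_nat].
(* The norm of Q is the square of (1 + e1 e2)(e1 - e2) / (e1 e2), which is the trace of e1 minus the
   trace of e2. *)
have [h h0] : exists h : nat, Q * rh Q = h%:R ^+ 2.
  have i1 : e1 \in Aint by case: U1 => -[].
  have i2 : e2 \in Aint by case: U2 => -[].
  have Le1 := UL U1; have Le2 := UL U2.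
  have [t1 E1] : exists t : int, e1 - e1^-1 = t%:~R.
    have -> : e1 - e1^-1 = e1 + sg e1 by rewrite sg1.
    apply: rat_int; last by rewrite rpredD ?Aint_aut.
    apply: (Qgen_fixed (nu := sg) (a := A)) => //; first by rewrite A2; exact: Qgen_nat.
      apply: Qgen_add => //; rewrite sg1; apply: Qgen_opp; exact: Qgen_inv.
    by rewrite rmorphD sgK // addrC.
  have [t2 E2] : exists t : int, e2 - e2^-1 = t%:~R.
    have -> : e2 - e2^-1 = e2 + rh e2 by rewrite rh2 n2E mulN1r.
    apply: rat_int; last by rewrite rpredD ?Aint_aut.
    apply: (Qgen_fixed (nu := rh) (a := B)) => //; first by rewrite B2; exact: Qgen_nat.
      by apply: Qgen_add => //; rewrite rh2 n2E mulN1r; apply: Qgen_opp; exact: Qgen_inv.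
    by rewrite rmorphD rhK // addrC.
  exists `|(t1 - t2)%R|%N.
  rewrite -natrX -intr_sqr intrB -E1 -E2.
  rewrite /Q /R rmorphM rh3 n3E fmorph_div rmorphXn rmorphD rmorph1 rz /z.
  by field; rewrite e10 e20 e30.
pose r0 := Q + rh Q + 2 * h%:R.
have r0E : r0 * Q = (Q + h%:R) ^+ 2.
  have -> : r0 * Q = Q ^+ 2 + Q * rh Q + 2 * h%:R * Q by rewrite /r0; ring.
  by rewrite h0; ring.
have Qh_gt0 : 0 < Q + h%:R by rewrite ltr_wpDr ?ler0n.
have r0_gt0 : 0 < r0.
  by have := exprn_gt0 2 Qh_gt0; rewrite -r0E pmulr_lgt0.
have [t Et] : exists t : int, r0 = t%:~R.
  apply: rat_int; last first.
    by apply: rpredD; [rewrite rpredD ?Aint_aut | apply: rpredM; exact: Aint_nat].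
  apply: Qgen_add; last by apply: Qgen_mul; exact: Qgen_nat.
  have Dh : Qgen [:: D] (Q + rh Q).
    have LrQ := rhL LQ.
    apply: fix_QD; first exact: Qgen_add.
      by rewrite rmorphD /= -rhconj // cQ.
    by rewrite rmorphD -rhsg // sQ.
  apply: (Qgen_fixed (nu := rh) (a := D)) => //; first by rewrite D2; exact: Qgen_nat.
  by rewrite rmorphD rhK // addrC.
have t0 : 0 < t by rewrite -(ltr_int algC) -Et.
have [|r [c [Ec r_gt0 Hr]]] := @squarefree_part `|t|; first by move: t0; clear; lia.
have rc : r%:R * c%:R ^+ 2 = r0 by rewrite -natrX -natrM -Ec natr_absz gtr0_norm.
have c0 : c%:R != 0 :> algC.
  by apply: contraTneq r0_gt0 => c0; rewrite -rc c0 expr0n mulr0 ltxx.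
(* (Q + h)^2 = r c^2 Q and Q = (1 + z)^2 e3 / z, so the factor z / (1 + z) turns Q into z e3 =
   eta. *)
exists r, ((Q + h%:R) / c%:R * z / (1 + z)); split=> //.
- apply: Qgen_div; last by apply: Qgen_add => //; exact: Qgen1.
  apply: Qgen_mul => //; apply: Qgen_div; last exact: Qgen_nat.
  by apply: Qgen_add => //; exact: Qgen_nat.
- rewrite conj_Creal // gtr0_real // divr_gt0 ?addr_gt0 // mulr_gt0 // divr_gt0 //.
  by rewrite lt0r c0 ler0n.
- have -> : ((Q + h%:R) / c%:R * z / (1 + z)) ^+ 2 =
     (Q + h%:R) ^+ 2 / c%:R ^+ 2 * z ^+ 2 / (1 + z) ^+ 2 by field; rewrite z10 c0.
  rewrite -r0E -rc /Q /R /eta -/z; field.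
  by rewrite z10 c0 z0.
Qed.

(** The integrality argument of [norm_one_sqrt], one degree higher: r divides the traces of g, gA,
    gB and gD from Q(A, B), and these recover 4 D^2 g. *)
Lemma eta_square_class : exists (r : nat) (g : algC),
  [/\ (r %| 2 * p1 * p2)%N, Qgen L g & g ^+ 2 = r%:R * eta].
Proof.
have [r [g [r0 Hr Lg cg Eg]]] := eta_times_nat.
exists r, g; split=> //.
have r0' : r%:R != 0 :> algC by rewrite pnatr_eq0 -lt0n.
have Ueta : U eta by apply: Umul => //; exact: Umul.
have ig : g \in Aint.
  by apply: Aint_sqrt; rewrite Eg; apply: rpredM; [exact: Aint_nat | case: Ueta => -[]].
have gH (nu : {rmorphism algC -> algC}) : (nu g) ^+ 2 / r%:R \in Aint.
  rewrite -rmorphXn Eg rmorphM rmorph_nat mulrAC mulfV // mul1r Aint_aut.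
  by case: Ueta => -[].
have T s : Qgen L s -> s^* = s -> s \in Aint -> exists2 t : int,
    g * s + sg (g * s) + rh (g * s) + sg (rh (g * s)) = t%:~R & (t%:~R / r%:R : algC) \in Aint.
  move=> Ls cs is'; have [t Et] : exists t : int,
      g * s + sg (g * s) + rh (g * s) + sg (rh (g * s)) = t%:~R.
    by apply: trace_L; [exact: Qgen_mul | rewrite rmorphM /= cg cs | exact: rpredM].
  exists t => //; apply: squarefree_dvd_int => //; rewrite -Et.
  have term (nu : {rmorphism algC -> algC}) : (nu (g * s)) ^+ 2 / r%:R \in Aint.
    by rewrite rmorphM [nu g * _]mulrC; apply: sqr_div_Aint_mul; [rewrite Aint_aut | exact: gH].
  have add := sqr_div_Aint_add r0'.
  exact: add (add _ _ (add _ _ (term idfun) (term sg)) (term rh)) (term (sg \o rh)).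
have iA : A \in Aint by apply: Aint_sqrt; rewrite A2; exact: Aint_nat.
have iB : B \in Aint by apply: Aint_sqrt; rewrite B2; exact: Aint_nat.
have iD : D \in Aint by apply: Aint_sqrt; rewrite D2; exact: Aint_nat.
have [t1 E1 d1] := T 1 (Qgen1 _) (rmorph1 _) Aint1.
have [t2 E2 d2] := T A LA conjA iA.
have [t3 E3 d3] := T B LB conjB iB.
have [t4 E4 d4] := T D LD conjD iD.
have Esum : 4 * D ^+ 2 * g =
    D ^+ 2 * t1%:~R + B ^+ 2 * A * t2%:~R + A ^+ 2 * B * t3%:~R + D * t4%:~R.
  rewrite -E1 -E2 -E3 -E4 mulr1 !rmorphM sgA sgB sgD rhA rhB rhD !rmorphN sgA sgB sgD DAB.
  by ring.
have i4 : 4 * D ^+ 2 * g / r%:R \in Aint.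
  have -> : 4 * D ^+ 2 * g / r%:R = D ^+ 2 * (t1%:~R / r%:R) + B ^+ 2 * A * (t2%:~R / r%:R)
      + A ^+ 2 * B * (t3%:~R / r%:R) + D * (t4%:~R / r%:R) by rewrite Esum; field.
  have mulA a b : a \in Aint -> b \in Aint -> a * b \in Aint by exact: rpredM.
  have := (rpredX 2 iD, (rpredX 2 iA, rpredX 2 iB)) => -[i1 [i2 i3]].
  apply: rpredD; [apply: rpredD; [apply: rpredD |] |].
  - exact: mulA.
  - exact: mulA (mulA _ _ i3 iA) d2.
  - exact: mulA (mulA _ _ i2 iB) d3.
  - exact: mulA.
have : (((4 * (2 * p1 * p2)) ^ 2)%N%:R / r%:R : algC) \in Aint.
  have -> : ((4 * (2 * p1 * p2)) ^ 2)%N%:R / r%:R = (4 * D ^+ 2 * g / r%:R) ^+ 2 * eta^-1 :> algC.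
    rewrite D2 natrX natrM; set d := (2 * p1 * p2)%:R.
    have -> : (4 * d * g / r%:R) ^+ 2 = 16 * d ^+ 2 * g ^+ 2 / r%:R ^+ 2 by field.
    by rewrite Eg; field; rewrite r0' (Un0 Ueta).
  by apply: rpredM; [exact: rpredX | case: Ueta => _ []].
(* With m = 2 p1 p2 even, 4m divides m^3, so r divides m^6 and hence m. *)
move/(dvdn_of_Aint r0) => dr; apply: (Hr _ (3 * 2)%N); apply: dvdn_trans dr _.
rewrite expnM dvdn_exp2r // expnS mulnC dvdn_mul //.
by rewrite -mulnA expnMn dvdn_mulr.
Qed.

(** For each divisor r of 2 p1 p2, r or 2r is the square of an element of L, and 2i = (1 + i)^2. So
    s eta is a square v^2 with s = 1 or s = i. Then v [sg v] is s e3 up to sign, which leaves e1 e2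
    in v / [sg v]. *)
Lemma boundary_e1e2 : exists2 v, U v &
  exists2 x, x = 1 \/ x = -1 & v / sg v = x * (e1 * e2).
Proof.
have Ueta : U eta by apply: Umul => //; exact: Umul.
have sEta : eta * sg eta = e3 ^+ 2.
  by rewrite /eta !rmorphM sg1 sg2 sg3 n2E; field; rewrite e10 e20.
have [r [g [dr Lg Eg]]] := eta_square_class.
have fin v s : Qgen L v -> U s -> sg s = s -> v ^+ 2 = s * eta ->
    exists2 v, U v & exists2 x, x = 1 \/ x = -1 & v / sg v = x * (e1 * e2).
  move=> Lv Us ss Ev; have s0 := Un0 Us.
  have Uv : U v by apply: unitO_sqrt => //; rewrite Ev; exact: Umul.
  have v0 := Un0 Uv; have sv0 : sg v != 0 by rewrite fmorph_eq0.
  exists v => //.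
  have : (v * sg v) ^+ 2 = (s * e3) ^+ 2.
    rewrite exprMn -rmorphXn Ev rmorphM ss [in RHS]exprMn -sEta; ring.
  move/eqP; rewrite eqf_sqr => E.
  exists (s * e3 / (v * sg v)).
    by case/orP: E => /eqP->; [left | right]; field; rewrite s0 e30.
  have -> : v / sg v = v ^+ 2 / (v * sg v) by field; rewrite v0 sv0.
  by rewrite Ev /eta; field; rewrite v0 sv0.
have p10 : p1%:R != 0 :> algC by rewrite pnatr_eq0 -lt0n.
have p20 : p2%:R != 0 :> algC by rewrite pnatr_eq0 -lt0n.
have fin1 s : Qgen L s -> s != 0 -> s ^+ 2 = r%:R ->
    exists2 v, U v & exists2 x, x = 1 \/ x = -1 & v / sg v = x * (e1 * e2).
  move=> Ls s0 Es; apply: (fin (g / s) 1); first exact: Qgen_div.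
  - by split; rewrite ?invr1 ?oner_eq0 //; exact: ringO1.
  - exact: rmorph1.
  - by rewrite expr_div_n Eg -Es; field.
have fin2 s : Qgen L s -> s != 0 -> s ^+ 2 = 2 * r%:R ->
    exists2 v, U v & exists2 x, x = 1 \/ x = -1 & v / sg v = x * (e1 * e2).
  move=> Ls s0 Es; apply: (fin ((1 + 'i) * g / s) 'i) => //.
  - by apply: Qgen_div => //; exact: Qgen_mul.
  - have r0 : r%:R != 0 :> algC.
      by apply: contraNneq s0 => r0; move/eqP: Es; rewrite r0 mulr0 expf_eq0.
    by rewrite expr_div_n exprMn sqr1i Eg Es; field.
have B2' : B ^+ 2 = 2 * p2%:R by rewrite B2 natrM.
have D2' : D ^+ 2 = 2 * p1%:R * p2%:R by rewrite D2 !natrM.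
have L2 : Qgen L 2 by exact: Qgen_nat.
have two0 : (2 : algC) != 0 by rewrite pnatr_eq0.
move: dr fin1 fin2 => /dvd_three_primes; rewrite !inE.
case/orP=> [|/orP[|/orP[|/orP[|/orP[|/orP[|/orP[]]]]]]] /eqP -> fin1 fin2.
- by apply: (fin1 1); rewrite ?oner_eq0 ?expr1n //; exact: Qgen1.
- by apply: (fin2 2) => //; ring.
- exact: (fin1 A).
- exact: (fin2 B).
- apply: (fin2 (2 * A)); [exact: Qgen_mul | exact: mulf_neq0 |].
  by rewrite exprMn A2 natrM; ring.
- exact: (fin1 B).
- by apply: (fin2 D) => //; rewrite D2' natrM mulrA.
- exact: (fin1 D).
Qed.

End AllNormsMinusOne.

(** * Counting the classes *)

(** It is a root of X^2 - X - (p1 - 1)/4, integral because p1 is 1 modulo 4. *)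
Lemma omega_Aint : (1 + A) / 2 \in Aint.
Proof.
have Eq := divn_eq p1 4; rewrite p1mod4 mulnC in Eq; move: (p1 %/ 4)%N Eq => q Eq.
have A2' : A ^+ 2 = 4 * q%:R + 1 by rewrite A2 Eq natrD natrM.
apply: (@root_monic_Aint ('X^2 - 'X - (q%:R)%:P)).
- rewrite rootE !hornerE; apply/eqP.
  have -> : ((1 + A) / 2) ^+ 2 = (1 + 2 * A + A ^+ 2) / 4 by field.
  by rewrite A2'; field.
- rewrite monicE -addrA lead_coefDl ?lead_coefXn // size_polyXn.
  rewrite -opprD size_polyN; apply: leq_ltn_trans (size_polyD _ _) _.
  by rewrite size_polyX size_polyC; case: (_ == 0).
- apply/polyOverP => i; apply/intrP.
  exists ((i == 2)%N%:Z - (i == 1)%N%:Z - (if (i == 0)%N then q else 0%N)%:Z).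
  by rewrite !coefE !intrB; case: (i == 0)%N.
Qed.

Lemma kernel_count (zs : seq algC) :
  (forall z, z \in zs -> U z /\ z * sg z = 1) ->
  (forall i j, (i < size zs)%N -> (j < size zs)%N -> i <> j ->
     forall v, U v -> zs`_i / zs`_j <> v / sg v) ->
  (forall z, U z -> z * sg z = 1 ->
     exists2 i, (i < size zs)%N & exists2 v, U v & z = zs`_i * (v / sg v)) ->
  card_capitulation_kernel k L (size zs).
Proof.
have iA : A \in Aint by apply: Aint_sqrt; rewrite A2; exact: Aint_nat.
have iB : B \in Aint by apply: Aint_sqrt; rewrite B2; exact: Aint_nat.
pose om := (1 + A) / 2.
have Lom : Qgen L om.
  by apply: Qgen_div; [apply: Qgen_add => //; exact: Qgen1 | exact: Qgen_nat].
have rom : ringO L om by split=> //; exact: omega_Aint.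
have som : sg om = (1 - A) / 2 by rewrite /om fmorph_div rmorphD rmorph1 sgA rmorph_nat.
have Eom : om = (1 + A) / 2 by [].
clearbody om.
have rsom : ringO L (sg om) by case: rom => ? ?; split; [exact: sgL | rewrite Aint_aut].
have rA : ringO L A by []. have rB : ringO L B by [].
have rz (n : int) : ringO L n%:~R by split; [exact: Qgen_int | exact: Aint_int].
have r1 := ringO1 L.
(* p1 and 8 p2 are the discriminants of the k-bases (1, om) and (1, B) of L. *)
have [u [v Euv]] : exists u v : int, u * p1%:Z + v * (8 * p2)%:Z = 1.
  have [u [v E]] := Bezoutz p1%:Z (8 * p2)%:Z; exists u, v.
  rewrite E /gcdz /= -[RHS]/(1%N%:Z); congr Posz; apply/eqP.
  rewrite -[_ == _]/(coprime _ _) prime_coprime // Euclid_dvdM // negb_or.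
  rewrite (_ : 8 = 2 ^ 3)%N // Euclid_dvdX // andbT !dvdn_prime2 //.
  by rewrite p1n2.
have {}Euv : u%:~R * p1%:R + v%:~R * (8 * p2%:R) = 1 :> algC.
  by rewrite -natrM -[RHS]/(1%:~R) -Euv intrD !intrM.
have B2' : B ^+ 2 = 2 * p2%:R by rewrite B2 natrM.
(* With Tr the relative trace, Tr(om a) - [sg om] Tr(a) = A a and Tr(B a) + B Tr(a) = 2 B a. The
   weights u A and 2 v B turn these into u p1 a and 8 v p2 a, whose sum is a. *)
apply: (@card_kernel_cohomology k L sg kL sgk sgL sgK fixk om A
  [:: (- u%:~R * A * sg om, 1); (u%:~R * A, om); (v%:~R * 2 * B * B, 1); (v%:~R * 2 * B, B)]) => //.
- by rewrite som Eom; field.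
- move=> p; rewrite !inE => /or4P[]/eqP->; split=> //=.
  + by apply: ringO_mul => //; apply: ringO_mul => //; exact: ringO_opp.
  + exact: ringO_mul.
  + by apply: ringO_mul => //; apply: ringO_mul => //; apply: ringO_mul => //; exact: (rz 2).
  + by apply: ringO_mul => //; apply: ringO_mul => //; exact: (rz 2).
move=> a La; rewrite !big_cons big_nil /= !mul1r !rmorphM sgB.
transitivity ((u%:~R * A ^+ 2 + v%:~R * (4 * B ^+ 2)) * a).
  rewrite A2 B2'; have -> : 4 * (2 * p2%:R) = 8 * p2%:R :> algC by ring.
  by rewrite Euv mul1r.
by rewrite som Eom; field.
Qed.

(** The exponents of e1 and e2 are bits because e1 / [sg e1] = - e1^2 and e2 / [sg e2] = n2 e2^2. *)
Let rep (t : nat * bool * bool) : algC := 'i ^+ t.1.1 * e1 ^+ t.1.2 * e2 ^+ t.2.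

Let i4 : ('i : algC) ^+ 4 = 1.
Proof. by rewrite (exprM _ 2 2) sqrCi sqrrN expr1n. Qed.

Let UX u n : U u -> U (u ^+ n). Proof. exact: (Uexpz n%:Z). Qed.

Let Urep t : U (rep t).
Proof. by apply: Umul; [apply: Umul|]; exact: UX. Qed.

Let norm_rep (a : nat) (b c : bool) :
  rep (a, b, c) * sg (rep (a, b, c)) = (-1) ^+ (a + b) * n2 ^+ c.
Proof.
rewrite /rep /= !rmorphM !rmorphXn /= sgi sg1 sg2 exprD.
transitivity (('i ^+ 2) ^+ a * (e1 * - e1^-1) ^+ b * (e2 * (n2 / e2)) ^+ c).
  rewrite !exprMn; ring.
have -> : e2 * (n2 / e2) = n2 by rewrite mulrC divfK.
by rewrite sqrCi mulrN mulfV.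
Qed.

Let norm_boundary v : U v -> v / sg v * sg (v / sg v) = 1.
Proof.
move=> Uv; have v0 := Un0 Uv; have sv0 : sg v != 0 by rewrite fmorph_eq0.
by rewrite fmorph_div (sgK (UL Uv)); field; rewrite v0 sv0.
Qed.

(** The even parts of the exponents are boundaries up to a sign, which goes into the power of i.
    That c = 0 stays 0 serves the case where e2 has been eliminated beforehand. *)
Lemma reduce_form (a : nat) (b c : int) : exists (a' : nat) (b' c' : bool),
  [/\ (a' < 4)%N, c = 0 -> c' = false &
    exists2 v, U v & 'i ^+ a * e1 ^ b * e2 ^ c = rep (a', b', c') * (v / sg v)].
Proof.
have split2 (n : int) : exists m : int, exists d : bool, n = m * 2 + (d : nat)%:Z /\ (n = 0 -> d = false).
  have [m [E|E]] := int_parity n; exists m; [exists false | exists true]; split=> //.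
  - by rewrite E addr0.
  - by move=> n0; move: E; rewrite n0; clear; lia.
have [m [b' [Eb _]]] := split2 b; have [l [c' [Ec c'0]]] := split2 c.
have [q Eq] : exists q : nat, (-1) ^ m * n2 ^ l = 'i ^+ q.
  by apply: sgn_i; apply: sgn_mul; apply: sgn_expz => //; right.
exists ((a + q) %% 4)%N, b', c'; split=> //; first by rewrite ltn_mod.
exists (e1 ^ m * e2 ^ l); first by apply: Umul; exact: Uexpz.
have e1m0 := lt0r_neq0 (norm_e1pos m); have e2l0 := lt0r_neq0 (norm_e2pos l).
have sm : (-1) ^ m * (-1) ^ m = 1 :> algC by apply: sgn_sq; apply: sgn_expz; right.
have sl : n2 ^ l * n2 ^ l = 1 by apply: sgn_sq; exact: sgn_expz.
have m0 : (-1) ^ m != 0 :> algC by rewrite expfz_neq0 // oppr_eq0 oner_eq0.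
have l0 : n2 ^ l != 0.
  by apply: contra_eqN sl => /eqP->; rewrite mul0r eq_sym oner_eq0.
rewrite /rep /= (expr_mod _ i4) exprD -Eq Eb Ec !expfzDr // -!exprz_exp -!exprnP.
rewrite rmorphM !fmorphXz sg1 sg2 opp_inv_expz div_expz.
transitivity ('i ^+ a * e1 ^+ b' * e2 ^+ c' * ((-1) ^ m * (-1) ^ m) * (n2 ^ l * n2 ^ l)
   * (e1 ^ m) ^+ 2 * (e2 ^ l) ^+ 2 / ((-1) ^ m * (-1) ^ m) / (n2 ^ l * n2 ^ l)).
  by rewrite sm sl; field.
field.
by rewrite m0 l0 e1m0 e2l0.
Qed.

Let parity_rep z (a : nat) (b c : bool) v : z * sg z = 1 -> U v ->
  z = rep (a, b, c) * (v / sg v) -> (-1) ^+ (a + b) * n2 ^+ c = 1.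
Proof.
move=> Nz Uv Ez; rewrite -norm_rep -[RHS]Nz Ez (rmorphM sg (rep (a, b, c)) (v / sg v)).
by rewrite mulrACA (norm_boundary Uv) mulr1.
Qed.

Let sign_even (n : nat) : (-1) ^+ n = 1 :> algC -> ~~ odd n.
Proof.
rewrite -signr_odd; case: odd => // /eqP.
by rewrite expr1 eq_sym -subr_eq0 opprK -[X in X == 0]/(2%:R : algC) pnatr_eq0.
Qed.

(** The parity condition on a triple says that its unit has relative norm 1. Two equivalent triples
    agree in both bits by [boundary_even], and then their quotient can only be -1: either -1 is no
    boundary, or no two triples share their bits. *)
Lemma kernel_count_reps (ts : seq (nat * bool * bool)) : uniq ts ->
  (forall t, t \in ts -> (t.1.1 < 4)%N && ~~ odd (t.1.1 + t.1.2 + t.2)) ->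
  (n3 = -1 /\ forall t, t \in ts -> t.2 = false) \/ (n3 = 1 /\ n2 = -1) ->
  (n3 = -1 \/ (exists2 b, Qgen [:: D] b & b ^+ 2 = 2 * e3)) \/
    {in ts &, forall t t', t.1.2 = t'.1.2 -> t.2 = t'.2 -> t = t'} ->
  (forall z, U z -> z * sg z = 1 ->
     exists2 t, t \in ts & exists2 v, U v & z = rep t * (v / sg v)) ->
  card_capitulation_kernel k L (size ts).
Proof.
move=> uts wf Hn Hneg Hsurj; rewrite -(size_map rep); apply: kernel_count.
- move=> _ /mapP[[[a b] c] tts ->]; split; first exact: Urep.
  rewrite norm_rep; have /andP[_ /= par] := wf _ tts.
  have -> : n2 ^+ c = (-1) ^+ c.
    by case: Hn => [[_ /(_ _ tts) /= ->]|[_ ->]].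
  by rewrite -exprD -signr_odd (negbTE par).
- move=> i j; rewrite size_map => li lj nij v Uv.
  pose t0 := (0%N, false, false).
  rewrite !(nth_map t0) // => E.
  have ti := mem_nth t0 li; have tj := mem_nth t0 lj.
  have nt : nth t0 ts i != nth t0 ts j by rewrite nth_uniq //; apply/eqP.
  move: ti tj nt E; case: (nth t0 ts i) => -[a b] c; case: (nth t0 ts j) => -[a' b'] c'.
  move=> ti tj nt E; have /andP[/= a4 par] := wf _ ti; have /andP[/= a'4 par'] := wf _ tj.
  (* Adding 3 a' stands for subtracting a', as i^4 = 1. *)
  have {}E : v / sg v = 'i ^+ (a + 3 * a') * e1 ^ (b%:Z - b'%:Z) * e2 ^ (c%:Z - c'%:Z).
    rewrite -E /rep /= !expfzDr // -!invr_expz -!exprnP exprD.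
    have -> : ('i : algC) ^+ (3 * a') = ('i ^+ a')^-1.
      have H : ('i : algC) ^+ (3 * a') * 'i ^+ a' = 1.
        by rewrite -exprD -mulSnr exprM i4 expr1n.
      apply: (mulIf (expf_neq0 a' i0)); rewrite H mulVf //; exact: expf_neq0.
    by field; rewrite !expf_neq0.
  have Hn' : (n3 = -1 /\ c%:Z - c'%:Z = 0) \/ (n3 = 1 /\ n2 = -1).
    case: Hn => [[-> H]|]; last by right.
    by left; rewrite (H _ ti : c = _) (H _ tj : c' = _).
  have [[m Em] [l El]] := boundary_even Uv E Hn'.
  have Eb : b = b' by move: Em; clear; case: b; case: b' => //=; lia.
  have Ec : c = c' by move: El; clear; case: c; case: c' => //=; lia.
  case: Hneg => [Hneg|Hinj]; last by move: nt; rewrite (Hinj _ _ ti tj) // eqxx.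
  have na : a != a' by apply: contraNneq nt => ->; rewrite Eb Ec.
  apply: (neg1_not_boundary Hneg Uv).
  rewrite E Eb Ec !subrr !expr0z !mulr1 -(expr_mod _ i4) -sqrCi; congr ('i ^+ _).
  rewrite Eb Ec in par.
  (* a and a' are distinct, below 4 and of the same parity, so a + 3 a' is 2 modulo 4. *)
  move: a4 a'4 na par par'; clear.
  by case: a => [|[|[|[|]]]] //; case: a' => [|[|[|[|]]]] //; case: b'; case: c'.
- move=> z Uz Nz; have [t tts [v Uv Ez]] := Hsurj z Uz Nz.
  exists (index t ts); first by rewrite size_map index_mem.
  by exists v => //; rewrite (nth_map t) ?index_mem // nth_index.
Qed.

Let Hn2 : n2 = 1 -> exists2 b, Qgen L b & b ^+ 2 = 2 * e2.
Proof. by case/sqrt_two_e2 => b /QBL; exists b. Qed.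

(** Up to sign e2 or e1 e2 is a boundary, according to the norm of e2, so e2 can be eliminated.
    There remain the i^a e1^b with a + b even. *)
Lemma kernel_norm3_neg1 : n3 = -1 -> card_capitulation_kernel k L 4.
Proof.
move=> n3E; pose ts := [:: (0, false, false); (2, false, false); (1, true, false); (3, true, false)]%N.
apply: (@kernel_count_reps ts) => //.
- by apply/allP.
- by left; split=> // t; rewrite !inE => /or4P[]/eqP->.
- by left; left.
move=> z Uz Nz; have [a [b [c Ez]]] := norm_one_form Uz Nz Hn2.
have [v0 [d [x [Uv0 sx E0]]]] : exists (v0 : algC) (d : int) (x : algC),
    [/\ U v0, x = 1 \/ x = -1 & v0 / sg v0 = x * (e1 ^ d * e2)].
  case: sgn_n2 => n2E.
    have [v Uv [x sx E]] := boundary_e2 n2E.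
    by exists v, 0, x; rewrite expr0z mul1r.
  by have [v Uv [x sx E]] := boundary_e1e2 n2E n3E; exists v, 1, x.
have [q Eq] := sgn_i (sgn_expz c sx).
have x2 : x ^ c * x ^ c = 1 by apply: sgn_sq; exact: sgn_expz.
have [a' [b' [c' [a4 c0 [v Uv E]]]]] := reduce_form (a + q) (b - d * c) 0.
rewrite {}c0 // in E.
have e2c0 := lt0r_neq0 (norm_e2pos c).
have e1dc0 := lt0r_neq0 (norm_e1pos (d * c)).
have {}Ez : z = rep (a', b', false) * (v * v0 ^ c / sg (v * v0 ^ c)).
  rewrite rmorphM fmorphXz.
  transitivity (rep (a', b', false) * (v / sg v) * (v0 / sg v0) ^ c).
    rewrite -E E0 expr0z mulr1 exprD -Eq expfzDr // -invr_expz expfzMl expfzMl exprz_exp.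
    transitivity ('i ^+ a * e1 ^ b * e2 ^ c * (x ^ c * x ^ c)); first by rewrite x2 mulr1.
    by field.
  by rewrite div_expz; field; rewrite -fmorphXz !fmorph_eq0 !(Un0 _) //; exact: Uexpz.
have Uw : U (v * v0 ^ c) by apply: Umul => //; exact: Uexpz.
have := parity_rep Nz Uw Ez; rewrite expr0 mulr1 => /sign_even par.
exists (a', b', false); last by exists (v * v0 ^ c).
by move: a4 par; clear; case: a' => [|[|[|[|]]]] //; case: b'.
Qed.

(** No class collapses: of the sixteen triples, the eight with a + b + c even remain. *)
Lemma kernel_norm3_1_square : n3 = 1 -> n2 = -1 ->
  (exists2 b, Qgen [:: D] b & b ^+ 2 = 2 * e3) -> card_capitulation_kernel k L 8.
Proof.
move=> n3E n2E Hsq; pose ts := [:: (0, false, false); (2, false, false);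
  (1, true, false); (3, true, false); (1, false, true); (3, false, true);
  (0, true, true); (2, true, true)]%N.
apply: (@kernel_count_reps ts) => //.
- by apply/allP.
- by right.
- by left; right.
move=> z Uz Nz; have [a [b [c Ez]]] := norm_one_form Uz Nz Hn2.
have [a' [b' [c' [a4 _ [v Uv E]]]]] := reduce_form a b c.
rewrite -{}Ez in E; exists (a', b', c'); last by exists v.
have := parity_rep Nz Uv E; rewrite n2E -exprD => /sign_even par.
by move: a4 par; clear; case: a' => [|[|[|[|]]]] //; case: b'; case: c'.
Qed.

(** -1 is now a boundary, so a matters only modulo 2, and its parity is fixed by the two bits. *)
Lemma kernel_norm3_1_nonsquare : n3 = 1 -> n2 = -1 ->
  (exists2 b, Qgen [:: D] b & b ^+ 2 = p1%:R * e3 \/ b ^+ 2 = 2 * p1%:R * e3) ->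
  card_capitulation_kernel k L 4.
Proof.
move=> n3E n2E /boundary_neg1[v0 Uv0 Ev0].
pose ts := [:: (0, false, false); (1, true, false); (1, false, true); (0, true, true)]%N.
apply: (@kernel_count_reps ts) => //.
- by apply/allP.
- by right.
- by right=> t t'; rewrite !inE => /or4P[]/eqP-> /or4P[]/eqP->.
move=> z Uz Nz; have [a [b [c Ez]]] := norm_one_form Uz Nz Hn2.
have [a' [b' [c' [a4 _ [v Uv E]]]]] := reduce_form a b c.
rewrite -{}Ez in E.
have := parity_rep Nz Uv E; rewrite n2E -exprD => /sign_even par.
have [a'2|a'2] := ltnP a' 2.
  exists (a', b', c'); last by exists v.
  by move: a'2 par; clear; case: a' => [|[|]] //; case: b'; case: c'.
exists ((a' - 2)%N, b', c').
  by move: a4 a'2 par; clear; case: a' => [|[|[|[|]]]] //; case: b'; case: c'.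
exists (v * v0); first exact: Umul.
have v00 := Un0 Uv0; have sv0 : sg v != 0 by rewrite fmorph_eq0 Un0.
have sv00 : sg v0 != 0 by rewrite fmorph_eq0.
have -> : v * v0 / sg (v * v0) = - (v / sg v).
  by rewrite rmorphM -[RHS]mulN1r -Ev0; field; rewrite sv0 sv00.
rewrite E mulrN -mulNr; congr (_ * _); rewrite /rep /=.
by rewrite -{1}(subnK a'2) exprD sqrCi; ring.
Qed.

End Field.

Unset Implicit Arguments.

Theorem theorem31 (p1 p2 : nat) (eps2 : algC) (x y : int) :
  prime p1 -> prime p2 -> p1 != p2 ->
  (p1 %% 4 = 1)%N -> (p2 %% 4 = 1)%N ->
  fund_unit (2 * p2) eps2 ->
  fund_unit (2 * p1 * p2) (x%:~R + y%:~R * sqrtC (2 * p1 * p2)%:R) ->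
  let eps3 := x%:~R + y%:~R * sqrtC (2 * p1 * p2)%:R : algC in
  let k := [:: sqrtC (2 * p1 * p2)%:R; 'i] in
  let K1 := [:: sqrtC (2 * p1 * p2)%:R; 'i; sqrtC p1%:R] in
  (((qnorm_is (2 * p2) eps2 (-1) /\ qnorm_is (2 * p1 * p2) eps3 (-1)) \/
    (qnorm_is (2 * p2) eps2 1 /\ qnorm_is (2 * p1 * p2) eps3 (-1))) ->
     card_capitulation_kernel k K1 4) /\
  ((qnorm_is (2 * p1 * p2) eps3 1 /\ qnorm_is (2 * p2) eps2 (-1)) ->
     ((exists n : nat, x + 1 = (n ^ 2)%:Z \/ x - 1 = (n ^ 2)%:Z) ->
        card_capitulation_kernel k K1 8) /\
     (~ (exists n : nat, x + 1 = (n ^ 2)%:Z \/ x - 1 = (n ^ 2)%:Z) ->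
        card_capitulation_kernel k K1 4)).
Proof.
move=> pr1 pr2 n12 p1m4 p2m4 fu2 fu3 eps3 k K1.
have [sg [rh [[sgA sgD sgi] [rhA rhB rhi]]]] := field_automorphisms pr1 pr2 n12 p1m4 p2m4.
have [e1 fu1 N1] := fund_unit_norm_neg1 pr1 p1m4 sgA.
have rhD : rh (sqrtC (2 * p1 * p2)%:R) = - sqrtC (2 * p1 * p2)%:R.
  have -> : sqrtC (2 * p1 * p2)%:R = sqrtC p1%:R * sqrtC (2 * p2)%:R :> algC.
    by rewrite -sqrtCM ?nnegrE ?ler0n // -natrM mulnCA mulnA.
  by rewrite rmorphM rhA rhB mulrN.
have N2 v : qnorm_is (2 * p2) eps2 v -> eps2 * rh eps2 = ratr v by exact: qnorm_aut.
have N3 v : qnorm_is (2 * p1 * p2) eps3 v -> eps3 * rh eps3 = ratr v by exact: qnorm_aut.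
have rn1 : ratr (-1) = -1 :> algC by rewrite rmorphN rmorph1.
have r1 : ratr 1 = 1 :> algC by rewrite rmorph1.
split.
  move=> H; have [M3 [n2 M2 s2]] : eps3 * rh eps3 = -1 /\
      exists2 n2, eps2 * rh eps2 = n2 & n2 = 1 \/ n2 = -1.
    case: H => -[/N2 M2 /N3 ->]; rewrite rn1; split=> //.
      by exists (-1); [rewrite M2 rn1 | right].
    by exists 1; [rewrite M2 r1 | left].
  exact: (kernel_norm3_neg1 pr1 pr2 n12 p1m4 p2m4 sgA sgD sgi rhA rhB rhi
    fu1 fu2 fu3 N1 M2 M3 s2 (or_intror erefl) erefl).
case=> /N3 M3 /N2 M2; rewrite r1 in M3; rewrite rn1 in M2.
have sq := square_two_e3 rhA rhB fu3 M3 erefl erefl.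
have cl := e3_square_class pr1 pr2 rhA rhB fu3 M3 erefl erefl.
split=> [/sq Hb|nsq].
  exact: (kernel_norm3_1_square pr1 pr2 n12 p1m4 p2m4 sgA sgD sgi rhA rhB rhi
    fu1 fu2 fu3 N1 M2 M3 (or_intror erefl) (or_introl erefl) erefl erefl Hb).
case: cl => [/nsq//|Hb].
exact: (kernel_norm3_1_nonsquare pr1 pr2 n12 p1m4 p2m4 sgA sgD sgi rhA rhB rhi
  fu1 fu2 fu3 N1 M2 M3 (or_intror erefl) (or_introl erefl) erefl erefl Hb).
Qed.
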